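(* Let $\tau_1\ge\tau_0>0$, $a\in(-1,1)$, $b\in\mathbb{R}$, and let $N:[0,\tau_0]\to\mathbb{R}$ and $M:[0,\tau_1]\to\mathbb{R}$ be piecewise continuously differentiable. If $b\neq 0$ and if for all $s\in\mathbb{C}$, $\operatorname{rank}[F_0(s),F_1(s)]=1$ (that is, $F_0$ and $F_1$ have no common zero in $\mathbb{C}$), then there exist two unique piecewise continuously differentiable functions $(f,g)$, with $f:[0,\tau_0]\to\mathbb{R}$ and $g:[0,\tau_1]\to\mathbb{R}$, such that $I_1(\nu)=0$ for $\nu\in[0,\tau_0)$, $I_2(\nu)=0$ for $\nu\in[\tau_0,\tau_1)$, and $I_3(\nu)=0$ for $\nu\in[\tau_1,\tau_1+\tau_0]$.
   Context: The holomorphic functions $F_0,F_1:\mathbb{C}\to\mathbb{C}$ are $$F_0(s)=1-a e^{-\tau_0 s}-\int_0^{\tau_0}N(\nu)e^{-\nu s}\,d\nu,\qquad F_1(s)=b e^{-\tau_1 s}+\int_0^{\tau_1}M(\nu)e^{-\nu s}\,d\nu .$$ Given $f:[0,\tau_0]\to\mathbb{R}$ and $g:[0,\tau_1]\to\mathbb{R}$, the functions $I_1,I_2,I_3$ (for $\nu$ in $[0,\tau_0]$, $[\tau_0,\tau_1]$, $[\tau_1,\tau_0+\tau_1]$ respectively) are $$I_1(\nu)=g(\nu)+N(\nu)+\int_0^\nu f(\eta)M(\nu-\eta)\,d\eta-\int_0^\nu g(\eta)N(\nu-\eta)\,d\eta,$$ $$I_2(\nu)=g(\nu)-a\,g(\nu-\tau_0)+\int_0^{\tau_0}f(\eta)M(\nu-\eta)\,d\eta-\int_{\nu-\tau_0}^{\nu}g(\eta)N(\nu-\eta)\,d\eta,$$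 $$I_3(\nu)=b\,f(\nu-\tau_1)+\int_{\nu-\tau_1}^{\tau_0}f(\eta)M(\nu-\eta)\,d\eta-a\,g(\nu-\tau_0)-\int_{\nu-\tau_0}^{\tau_1}g(\eta)N(\nu-\eta)\,d\eta .$$
   Formalization: Uniqueness is stated for f on [0,τ0) and g on [0,τ1): the endpoint values enter only through b f(τ0) = a g(τ1), so g(τ1) may be changed freely with f(τ0) adjusted, and uniqueness on the closed intervals fails unless endpoint values are fixed by convention. *)

(* Defs.v *)
From Stdlib Require Import Reals.
From Coquelicot Require Import Coquelicot.

Open Scope R_scope.

Definition C1 (h : R -> R) : Prop :=
  forall t, ex_derive h t /\ continuous (Derive h) t.

(* A function on [l, r] is a total function, of which only the values on [l, r]
   are meant.  On every open piece u coincides with a C^1 function defined past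
   the ends of the piece: u and u' have finite one-sided limits there, u may
   jump, and its values at the break points (l and r included) are arbitrary. *)
Definition piecewise_C1 (l r : R) (u : R -> R) : Prop :=
  exists (n : nat) (x : nat -> R),
    x O = l /\ x n = r /\
    forall i, (i < n)%nat ->
      x i < x (S i) /\
      exists h, C1 h /\ forall t, x i < t < x (S i) -> u t = h t.

Definition Cexp (z : C) : C :=
  (exp (Re z) * cos (Im z), exp (Re z) * sin (Im z)).

(* Integral of a complex-valued function of a real variable. *)
Definition CInt (u : R -> C) (l r : R) : C :=
  RInt (V := C_R_CompleteNormedModule) u l r.

Definition F0 (tau0 a : R) (N : R -> R) (s : C) : C :=
  (RtoC 1 - RtoC a * Cexp (- (RtoC tau0 * s))
   - CInt (fun nu => RtoC (N nu) * Cexp (- (RtoC nu * s))) 0 tau0)%C.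

Definition F1 (tau1 b : R) (M : R -> R) (s : C) : C :=
  (RtoC b * Cexp (- (RtoC tau1 * s))
   + CInt (fun nu => RtoC (M nu) * Cexp (- (RtoC nu * s))) 0 tau1)%C.

Definition I1 (N M f g : R -> R) (nu : R) : R :=
  g nu + N nu
  + RInt (fun eta => f eta * M (nu - eta)) 0 nu
  - RInt (fun eta => g eta * N (nu - eta)) 0 nu.

Definition I2 (tau0 a : R) (N M f g : R -> R) (nu : R) : R :=
  g nu - a * g (nu - tau0)
  + RInt (fun eta => f eta * M (nu - eta)) 0 tau0
  - RInt (fun eta => g eta * N (nu - eta)) (nu - tau0) nu.

Definition I3 (tau0 tau1 a b : R) (N M f g : R -> R) (nu : R) : R :=
  b * f (nu - tau1)
  + RInt (fun eta => f eta * M (nu - eta)) (nu - tau1) tau0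
  - a * g (nu - tau0)
  - RInt (fun eta => g eta * N (nu - eta)) (nu - tau0) tau1.

Definition is_solution (tau0 tau1 a b : R) (N M f g : R -> R) : Prop :=
  piecewise_C1 0 tau0 f /\
  piecewise_C1 0 tau1 g /\
  (forall nu, 0 <= nu < tau0 -> I1 N M f g nu = 0) /\
  (forall nu, tau0 <= nu < tau1 -> I2 tau0 a N M f g nu = 0) /\
  (forall nu, tau1 <= nu <= tau1 + tau0 -> I3 tau0 tau1 a b N M f g nu = 0).

(* The right endpoints are left out: apart from integrals, which do not see it,
   the value g tau1 enters the equations only through
   I3 (tau1 + tau0) = b * f tau0 - a * g tau1, so g tau1 is free and
   f tau0 = a * g tau1 / b follows it. *)
Definition same_solution (tau0 tau1 : R) (f g f' g' : R -> R) : Prop :=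
  (forall nu, 0 <= nu < tau0 -> f' nu = f nu) /\
  (forall nu, 0 <= nu < tau1 -> g' nu = g nu).

(* Main.v *)
Require Import Defs.
From Stdlib Require Import Reals Lia Lra List.
From Stdlib Require Import Classical ClassicalEpsilon FunctionalExtensionality.
From mathcomp Require all_boot all_order all_algebra Rstruct complex.
From Coquelicot Require Import Coquelicot.
Import Defs.

Open Scope R_scope.

(** Extend [f], [g], [N], [M] by zero and write [u # v] for convolution.  The three
    equations then say, on the whole of [0, tau0 + tau1),

      g(t) - a g(t - tau0) + b f(t - tau1) = (g # N)(t) - (f # M)(t) - N(t),

    and at the right end only that [b f(tau0) = a g(tau1)].  The left side is an
    operator in [(f, g)] with an explicit inverse ([inv_f], [inv_g]), obtained by
    running the recursion [g = u + a g(. - tau0)] forward.  In the unknown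
    [u = left side] the equation becomes [u = K u - N], where [K], called
    [reduced_op], consists of convolutions and so maps bounded functions to Lipschitz
    ones ([reduced_op_smoothing]).

    For such a [K] the Fredholm alternative is elementary.  Interpolating [K u]
    linearly on a fine grid splits [K] into a finite-rank operator and one of norm at
    most 1/2 ([finite_rank_splitting]); the latter is handled by a Neumann series, so
    everything comes down to a finite linear system.  Hence [u = K u + r] is solvable
    for all [r] as soon as [u = K u] has only the zero solution
    ([fredholm_solvable]), and in any case the solutions of [u = K u] form a
    finite-dimensional space ([independent_bounded]).  As [N] may have jumps, the
    alternative is applied to [w = u + N], which satisfies [w = K w - K N].  Both existence and uniqueness
    are thus reduced to [kernel_trivial]: the homogeneous equation has no nonzero
    solution.

    In Laplace transforms the homogeneous equation reads
    [F0(s) g^(s) + F1(s) f^(s) = 0].  If [(f, g)] solves it, then so does the pair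
    [(F, G)] with

      s F^(s) = f^(s) + c F0(s),     s G^(s) = g^(s) - c F1(s),

    provided that [c] makes both right sides vanish at [s = 0].  Such a [c] exists
    because [F0(0)] and [F1(0)] are not both zero, while
    [F0(0) g^(0) + F1(0) f^(0) = 0].  The map [(f, g) |-> (F, G)] is linear ([shift]).
    On the complexified finite-dimensional space of solutions it would have an
    eigenvector, [F = mu f] and [G = mu g].  If [mu = 0], then [c = 0] and [f], [g]
    have zero primitives, so they vanish.  Otherwise, with [lambda = 1 / mu],

      (s - lambda) F^(s) = c F0(s),     (s - lambda) G^(s) = - c F1(s),

    and at [s = lambda] the rank condition forces [c = 0], hence [F = G = 0].

    No transform is used below: [s F^] is expressed by primitives, and evaluation at
    [lambda] by integrating against [exp (- lambda t)] ([exponential_re],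
    [exponential_im]).  To convolve functions with jumps they are written, outside a
    finite set, as sums of [step x * h] with [h] continuous or C1 ([pieces]). *)

(** * Finite-dimensional linear algebra *)

Fixpoint rsum (n : nat) (F : nat -> R) : R :=
  match n with O => 0 | S k => rsum k F + F k end.

Module LinearAlgebra.

Import all_boot all_order all_algebra Rstruct complex.
Import GRing.Theory.
Local Open Scope ring_scope.

Local Open Scope R_scope.

Lemma rsum_bigE n (F : nat -> R) : rsum n F = (\sum_(i < n) F i)%R.
Proof. by elim: n => [|n IH]; rewrite ?big_ord0 // big_ord_recr /= -IH. Qed.

(** Extension of a row vector by zero, so as to index it by natural numbers. *)
Definition entry {n} (v : 'rV[R]_n) (k : nat) : R :=
  if insub k is Some i then (v 0 i)%R else 0.

Lemma entryE n (v : 'rV[R]_n) (i : 'I_n) : entry v i = (v 0 i)%R.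
Proof. by rewrite /entry valK. Qed.

(** If [1 - A] is singular, its kernel gives the first alternative. *)
Lemma fixed_point_or_solvable (n : nat) (A : nat -> nat -> R) :
  (exists c : nat -> R, (exists i, (i < n)%coq_nat /\ c i <> 0) /\
     forall i, (i < n)%coq_nat -> c i = rsum n (fun j => A i j * c j)) \/
  (forall y : nat -> R, exists c : nat -> R,
     forall i, (i < n)%coq_nat -> c i = y i + rsum n (fun j => A i j * c j)).
Proof.
pose B : 'M[R]_n := \matrix_(i, j) A j i.
have mulE (v : 'rV[R]_n) (i : 'I_n) :
    ((v *m B) 0 i)%R = rsum n (fun j => A i j * entry v j).
  rewrite rsum_bigE mxE; apply: eq_bigr => j _.
  by rewrite entryE mxE; exact: mulrC.
case: (boolP ((1%:M - B)%R \in unitmx)) => [Bu | nBu].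
- right=> y.
  pose v := (\row_i y i) *m invmx (1%:M - B)%R.
  exists (entry v) => i /ltP ltin.
  have : v *m (1%:M - B)%R = \row_i y i by rewrite -mulmxA mulVmx // mulmx1.
  rewrite mulmxBr mulmx1 => /rowP /(_ (Ordinal ltin)).
  rewrite [RHS]mxE [LHS]mxE [X in (_ + X)%R]mxE mulE -[v 0%R _]entryE /=.
  by move/eqP; rewrite subr_eq => /eqP.
- left.
  move: nBu; rewrite -row_free_unit -kermx_eq0 => /rowV0Pn [v] /sub_kermxP vB v0.
  exists (entry v); split.
    have /rV0Pn [i vi] := v0.
    by exists i; split; [apply/ltP | rewrite entryE; apply/eqP].
  move=> i /ltP ltin.
  move: vB; rewrite mulmxBr mulmx1 => /eqP; rewrite subr_eq0 => /eqP vB.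
  by rewrite -[RHS](mulE v (Ordinal ltin)) -vB -entryE.
Qed.

Lemma dependent_vectors (n : nat) (v : nat -> nat -> R) :
  exists c : nat -> R, (exists k, (k < S n)%coq_nat /\ c k <> 0) /\
    forall i, (i < n)%coq_nat -> rsum (S n) (fun k => c k * v k i) = 0.
Proof.
pose B : 'M[R]_(n.+1, n) := \matrix_(i, j) v i j.
have : kermx B != 0%R.
  rewrite kermx_eq0 /row_free; apply/negP => /eqP rB.
  by have := rank_leq_col B; rewrite rB ltnn.
move/rowV0Pn => [w] /sub_kermxP wB /rV0Pn [i wi].
exists (entry w); split.
  by exists i; split; [apply/ltP | rewrite entryE; apply/eqP].
move=> j /ltP ltjn; have /rowP /(_ (Ordinal ltjn)) := wB.
rewrite !mxE => E; rewrite rsum_bigE -[RHS]E; apply: eq_bigr => k _.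
by rewrite entryE mxE.
Qed.

(** The complex eigenvector is the row [xr + i xi], its eigenvalue [mr + i mi]. *)
Lemma complex_eigenvector (n : nat) (A : nat -> nat -> R) :
  (0 < n)%coq_nat ->
  exists (mr mi : R) (xr xi : nat -> R),
    (exists i, (i < n)%coq_nat /\ (xr i <> 0 \/ xi i <> 0)) /\
    forall j, (j < n)%coq_nat ->
      rsum n (fun i => xr i * A i j) = mr * xr j - mi * xi j /\
      rsum n (fun i => xi i * A i j) = mr * xi j + mi * xr j.
Proof.
move=> /ltP n0.
pose B : 'M[R[i]]_n := \matrix_(i, j) (A i j)%:C%C.
have [[mr mi] /eigenvalueP [x xB x0]] := complex.Theorem7' B n0.
exists mr, mi, (entry (map_mx (@Re R) x)), (entry (map_mx (@Im R) x)); split.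
  have /rV0Pn [i xi] := x0.
  exists i; split; first by apply/ltP.
  rewrite !entryE !mxE; move: xi; case: (x 0%R i) => p q /= /eqP pq.
  case: (eqVneq p 0) => [p0 | /eqP]; last by left.
  by right=> q0; apply: pq; rewrite p0 q0.
move=> j /ltP ltjn; have /rowP /(_ (Ordinal ltjn)) := xB.
rewrite !mxE => E; rewrite !rsum_bigE.
rewrite -[j]/(nat_of_ord (Ordinal ltjn)) !entryE ![map_mx _ _ _ _]mxE.
have -> : (\sum_(i < n) Rmult (entry (map_mx (@Re R) x) i) (A i (Ordinal ltjn)))%R =
          Re (\sum_i x 0%R i * B i (Ordinal ltjn))%R.
  rewrite raddf_sum; apply: eq_bigr => i _; rewrite entryE !mxE.
  by case: (x 0%R i) => p q /=; rewrite !mulr0 subr0.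
have -> : (\sum_(i < n) Rmult (entry (map_mx (@Im R) x) i) (A i (Ordinal ltjn)))%R =
          Im (\sum_i x 0%R i * B i (Ordinal ltjn))%R.
  rewrite raddf_sum; apply: eq_bigr => i _; rewrite entryE !mxE.
  by case: (x 0%R i) => p q /=; rewrite !mulr0 add0r.
by rewrite E; case: (x 0%R (Ordinal ltjn)).
Qed.

End LinearAlgebra.

(** * A Fredholm alternative *)

Lemma rsum_ext n F G : (forall i, (i < n)%nat -> F i = G i) -> rsum n F = rsum n G.
Proof.
  induction n as [|n IH]; simpl; intros H; [reflexivity|].
  rewrite IH by (intros; apply H; lia). now rewrite H by lia.
Qed.

Lemma rsum_0 n F : (forall i, (i < n)%nat -> F i = 0) -> rsum n F = 0.
Proof.
  induction n as [|n IH]; simpl; intros H; [reflexivity|].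
  rewrite IH by (intros; apply H; lia). rewrite H by lia. ring.
Qed.

Lemma rsum_lin n F G c :
  rsum n (fun i => F i + c * G i) = rsum n F + c * rsum n G.
Proof. induction n as [|n IH]; simpl; [|rewrite IH]; ring. Qed.

Lemma rsum_swap n m (F : nat -> nat -> R) :
  rsum n (fun i => rsum m (F i)) = rsum m (fun j => rsum n (fun i => F i j)).
Proof.
  induction n as [|n IH]; simpl.
  - symmetry. now apply rsum_0.
  - rewrite IH. rewrite <- (Rmult_1_l (rsum m (F n))).
    rewrite <- rsum_lin. apply rsum_ext. intros; ring.
Qed.

Lemma rsum_scal n F c : rsum n (fun i => c * F i) = c * rsum n F.
Proof. induction n as [|n IH]; simpl; [|rewrite IH]; ring. Qed.

Lemma rsum_abs n F M :
  (forall i, (i < n)%nat -> Rabs (F i) <= M) -> Rabs (rsum n F) <= INR n * M.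
Proof.
  induction n as [|n IH]; intros H.
  - simpl. rewrite Rabs_R0. lra.
  - rewrite S_INR. simpl rsum.
    eapply Rle_trans; [apply Rabs_triang|].
    assert (H1 := IH (fun i Hi => H i (Nat.lt_lt_succ_r _ _ Hi))).
    assert (H2 := H n (Nat.lt_succ_diag_r n)). lra.
Qed.

Lemma rsum_telescope n (x : nat -> R) :
  rsum n (fun i => x (S i) - x i) = x n - x O.
Proof. induction n as [|n IH]; simpl; [|rewrite IH]; ring. Qed.

Definition lipschitz (L : R) (u : R -> R) : Prop :=
  forall x y, Rabs (u x - u y) <= L * Rabs (x - y).

(** The space on which the Fredholm alternative is developed.  Its elements are
    determined on [0, T] and bounded, and a pointwise limit of functions that have a
    common Lipschitz constant stays in it. *)
Definition anchored (T : R) (u : R -> R) : Prop :=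
  (forall t, t <= 0 -> u t = 0) /\ (forall t, T <= t -> u t = u T) /\
  exists L, lipschitz L u.

Lemma anchored_lin T u v c :
  anchored T u -> anchored T v -> anchored T (fun t => u t + c * v t).
Proof.
  intros (u0 & uT & Lu & Hu) (v0 & vT & Lv & Hv). split; [|split].
  - intros t Ht. rewrite u0, v0 by lra. ring.
  - intros t Ht. now rewrite (uT t), (vT t) by lra.
  - exists (Lu + Rabs c * Lv). intros x y.
    replace (u x + c * v x - (u y + c * v y))
      with ((u x - u y) + c * (v x - v y)) by ring.
    eapply Rle_trans; [apply Rabs_triang|]. rewrite Rabs_mult.
    specialize (Hu x y). specialize (Hv x y).
    assert (Hc := Rabs_pos c).
    assert (Rabs c * Rabs (v x - v y) <= Rabs c * (Lv * Rabs (x - y)))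
      by (apply Rmult_le_compat_l; lra). lra.
Qed.

Lemma anchored_0 T : anchored T (fun _ => 0).
Proof.
  split; [|split]; auto. exists 0. intros x y.
  rewrite Rminus_diag, Rabs_R0. lra.
Qed.

Lemma anchored_rsum T n c (Z : nat -> R -> R) :
  (forall i, (i < n)%nat -> anchored T (Z i)) ->
  anchored T (fun t => rsum n (fun i => c i * Z i t)).
Proof.
  induction n as [|n IH]; intros HZ; simpl.
  - apply anchored_0.
  - apply (anchored_lin T (fun t => rsum n (fun i => c i * Z i t)) (Z n)).
    + apply IH. intros; apply HZ; lia.
    + apply HZ; lia.
Qed.

Lemma anchored_bounded T u :
  0 <= T -> anchored T u -> exists M, 0 <= M /\ forall t, Rabs (u t) <= M.
Proof.
  intros HT (u0 & uT & L & HL).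
  assert (L0 : 0 <= L).
  { specialize (HL 1 0). rewrite Rminus_0_r, Rabs_R1 in HL.
    assert (H := Rabs_pos (u 1 - u 0)). lra. }
  assert (HB : forall t, 0 <= t <= T -> Rabs (u t) <= L * T).
  { intros t Ht. specialize (HL t 0). rewrite (u0 0), !Rminus_0_r in HL by lra.
    rewrite (Rabs_pos_eq t) in HL by lra.
    apply Rle_trans with (1 := HL). apply Rmult_le_compat_l; lra. }
  assert (LT : 0 <= L * T) by now apply Rmult_le_pos.
  exists (L * T); split; [assumption|]. intros t.
  destruct (Rle_dec t 0) as [H|H].
  - rewrite u0 by assumption. now rewrite Rabs_R0.
  - destruct (Rle_dec T t) as [H'|H'].
    + rewrite uT by assumption. apply HB; lra.
    + apply HB; lra.
Qed.

Lemma additive_0 (A : (R -> R) -> R) :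
  A (fun _ => 0 + -1 * 0) = A (fun _ => 0) + -1 * A (fun _ => 0) ->
  A (fun _ => 0) = 0.
Proof.
  replace (fun _ : R => 0 + -1 * 0) with (fun _ : R => 0)
    by (apply functional_extensionality; intros; ring).
  lra.
Qed.

Definition linear_on (P : (R -> R) -> Prop) (K : (R -> R) -> R -> R) : Prop :=
  forall u v c, P u -> P v ->
  forall t, K (fun s => u s + c * v s) t = K u t + c * K v t.

Lemma linear_on_0 P K :
  linear_on P K -> P (fun _ => 0) -> forall t, K (fun _ => 0) t = 0.
Proof.
  intros HK H0 t. exact (additive_0 (fun u => K u t) (HK _ _ (-1) H0 H0 t)).
Qed.

Lemma linear_on_rsum T K n c (Z : nat -> R -> R) :
  linear_on (anchored T) K ->
  (forall i, (i < n)%nat -> anchored T (Z i)) ->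
  forall t, K (fun s => rsum n (fun i => c i * Z i s)) t
            = rsum n (fun i => c i * K (Z i) t).
Proof.
  intros HK. induction n as [|n IH]; intros HZ t; simpl.
  - now apply (linear_on_0 _ _ HK), anchored_0.
  - rewrite (HK (fun s => rsum n (fun i => c i * Z i s)) (Z n)).
    + rewrite IH; [reflexivity|]. intros; apply HZ; lia.
    + apply anchored_rsum. intros; apply HZ; lia.
    + apply HZ; lia.
Qed.

Definition smoothing (T : R) (K : (R -> R) -> R -> R) : Prop :=
  linear_on (anchored T) K /\
  (forall u, anchored T u -> forall t, t <= 0 -> K u t = 0) /\
  (forall u, anchored T u -> forall t, T <= t -> K u t = K u T) /\
  exists L, 0 <= L /\ forall u M, anchored T u ->
    (forall t, Rabs (u t) <= M) -> lipschitz (L * M) (K u).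

Lemma smoothing_anchored T K u :
  0 <= T -> smoothing T K -> anchored T u -> anchored T (K u).
Proof.
  intros HT (Hl & H0 & HT' & L & L0 & HL) Hu.
  destruct (anchored_bounded T u HT Hu) as (M & M0 & HM).
  split; [|split]; auto. exists (L * M). auto.
Qed.

Lemma is_lim_seq_Rabs_sub_le (x : nat -> R) (l y c : R) :
  is_lim_seq x l -> eventually (fun n => Rabs (x n - y) <= c) ->
  Rabs (l - y) <= c.
Proof.
  intros Hx Hc.
  assert (H : is_lim_seq (fun n => Rabs (x n - y)) (Rabs (l - y))).
  { apply (is_lim_seq_abs _ (l - y)).
    apply (is_lim_seq_minus' x (fun _ => y)); auto. apply is_lim_seq_const. }
  apply (is_lim_seq_le_loc _ (fun _ => c) (Rabs (l - y)) c Hc H).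
  apply is_lim_seq_const.
Qed.

Lemma half_pow_lim (M : R) : is_lim_seq (fun n => M * (/2) ^ n) 0.
Proof.
  replace (Finite 0) with (Rbar_mult M 0) by (simpl; f_equal; ring).
  apply is_lim_seq_scal_l, is_lim_seq_geom.
  rewrite Rabs_pos_eq; lra.
Qed.

Lemma le_half_pow_0 (x M : R) : (forall n, Rabs x <= M * (/2) ^ n) -> x = 0.
Proof.
  intros H.
  assert (H1 : Rabs x <= 0).
  { apply (is_lim_seq_le (fun _ => Rabs x) (fun n => M * (/2) ^ n) (Rabs x) 0).
    - exact H.
    - apply is_lim_seq_const.
    - apply half_pow_lim. }
  assert (H2 := Rabs_pos x). destruct (Req_dec x 0) as [E|E]; [exact E|].
  assert (H3 := Rabs_pos_lt x E). lra.
Qed.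

Section Neumann.

Context (T : R) (B : (R -> R) -> R -> R) (HT : 0 <= T).
Context (Hq : forall u M, anchored T u -> (forall t, Rabs (u t) <= M) ->
           forall t, Rabs (B u t) <= M / 2).

(** A bound [M] for [u] improves to [M / 2], then to [M / 4], and so on. *)
Lemma contraction_fixpoint_0 u :
  anchored T u -> (forall t, u t = B u t) -> forall t, u t = 0.
Proof.
  intros Hu Hfix.
  destruct (anchored_bounded T u HT Hu) as (M & M0 & HM).
  intros t. apply (le_half_pow_0 _ M). intros n. revert t.
  induction n as [|n IH]; intros t.
  - simpl. rewrite Rmult_1_r. apply HM.
  - rewrite Hfix. simpl.
    replace (M * (/2 * (/2)^n)) with (M * (/2)^n / 2) by field.
    now apply Hq.
Qed.

(** Neumann series.  The iterates are uniformly bounded, so the smoothing property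
    gives them a common Lipschitz constant, which the pointwise limit inherits. *)
Lemma contraction_solvable y :
  smoothing T B -> anchored T y -> exists u, anchored T u /\ forall t, u t = y t + B u t.
Proof.
  intros HB Hy.
  destruct (anchored_bounded T y HT Hy) as (M & M0 & HM).
  pose (it := fix it (n : nat) : R -> R :=
    match n with O => y | S k => fun t => y t + B (it k) t end).
  assert (Hlin := proj1 HB).
  assert (HX : forall n, anchored T (it n)).
  { induction n as [|n IH]; simpl; [exact Hy|].
    replace (fun t => y t + B (it n) t) with (fun t => y t + 1 * B (it n) t)
      by (apply functional_extensionality; intros; ring).
    apply anchored_lin; [exact Hy|]. now apply smoothing_anchored. }
  assert (Hsub : forall u v, anchored T u -> anchored T v ->
            anchored T (fun s => u s + -1 * v s))
    by (intros; now apply anchored_lin).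
  assert (Hd : forall n t, Rabs (it (S n) t - it n t) <= M / 2 * (/2) ^ n).
  { induction n as [|n IH]; intros t.
    - simpl. replace (y t + B y t - y t) with (B y t) by ring.
      rewrite Rmult_1_r. now apply Hq.
    - change (Rabs ((y t + B (it (S n)) t) - (y t + B (it n) t)) <= M / 2 * (/2) ^ (S n)).
      replace (y t + B (it (S n)) t - (y t + B (it n) t))
        with (B (it (S n)) t + -1 * B (it n) t) by ring.
      rewrite <- Hlin by apply HX.
      replace (M / 2 * (/2) ^ (S n)) with (M / 2 * (/2) ^ n / 2) by (simpl; field).
      apply Hq; [now apply Hsub|]. intros s.
      replace (it (S n) s + -1 * it n s) with (it (S n) s - it n s) by ring.
      apply IH. }
  assert (Hpow : forall n, 0 < (/2)^n) by (intros; apply pow_lt; lra).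
  assert (Hc : forall n k t, Rabs (it (k + n)%nat t - it n t) <= M * (/2) ^ n).
  { intros n k t.
    apply Rle_trans with (M * (/2)^n - M * (/2)^(k + n)).
    - induction k as [|k IH].
      + simpl. rewrite !Rminus_diag, Rabs_R0. lra.
      + replace (it (S k + n)%nat t - it n t)
          with ((it (S (k + n)) t - it (k + n)%nat t) + (it (k + n)%nat t - it n t))
          by (simpl; ring).
        eapply Rle_trans; [apply Rabs_triang|].
        specialize (Hd (k + n)%nat t).
        change (S k + n)%nat with (S (k + n)).
        assert (E : M * (/2) ^ (S (k+n)) = M / 2 * (/2)^(k+n)) by (simpl; field).
        lra.
    - assert (0 <= M * (/2)^(k+n)) by (apply Rmult_le_pos; [lra|apply Rlt_le, Hpow]).
      lra. }
  assert (Hex : forall t, is_lim_seq (fun n => it n t) (real (Lim_seq (fun n => it n t)))).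
  { intros t. apply Lim_seq_correct', ex_lim_seq_cauchy_corr.
    intros eps.
    destruct (proj1 (is_lim_seq_Reals _ _) (half_pow_lim (2 * M)) eps (cond_pos eps))
      as [N HN].
    exists N. intros n m Hn Hm.
    specialize (HN N (Nat.le_refl N)). unfold Rdist in HN.
    rewrite Rminus_0_r, Rabs_pos_eq in HN
      by (apply Rmult_le_pos; [lra|apply Rlt_le, Hpow]).
    replace (it n t - it m t) with ((it n t - it N t) - (it m t - it N t)) by ring.
    eapply Rle_lt_trans; [apply Rabs_triang|]. rewrite Rabs_Ropp.
    assert (H1 := Hc N (n - N)%nat t). assert (H2 := Hc N (m - N)%nat t).
    rewrite Nat.sub_add in H1, H2 by assumption. lra. }
  pose (u := fun t => real (Lim_seq (fun n => it n t))).
  assert (Hu : forall n t, Rabs (u t - it n t) <= M * (/2) ^ n).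
  { intros n t. apply (is_lim_seq_Rabs_sub_le _ _ _ _ (Hex t)).
    exists n. intros m Hm. rewrite <- (Nat.sub_add n m Hm). apply Hc. }
  assert (HuX : anchored T u).
  { split; [|split].
    - intros t Ht. unfold u. rewrite (Lim_seq_ext _ (fun _ => 0)).
      + now rewrite Lim_seq_const.
      + intros n. apply (proj1 (HX n)). exact Ht.
    - intros t Ht. unfold u. f_equal. apply Lim_seq_ext.
      intros n. apply (proj1 (proj2 (HX n))). exact Ht.
    - destruct Hy as (_ & _ & Ly & HLy).
      destruct HB as (_ & _ & _ & C & C0 & HC).
      assert (Hbd : forall n t, Rabs (it n t) <= 2 * M).
      { intros n t. assert (H1 := Hc O n t). rewrite Nat.add_0_r in H1.
        specialize (HM t). simpl in H1.
        replace (it n t) with ((it n t - y t) + y t) by ring.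
        eapply Rle_trans; [apply Rabs_triang|]. lra. }
      assert (L0 : 0 <= Ly).
      { specialize (HLy 1 0). rewrite Rminus_0_r, Rabs_R1 in HLy.
        assert (H := Rabs_pos (y 1 - y 0)). lra. }
      exists (Ly + C * (2 * M)). intros a b.
      assert (Hlip : forall n, Rabs (it n a - it n b) <= (Ly + C * (2 * M)) * Rabs (a - b)).
      { intros n. destruct n as [|n].
        - simpl. eapply Rle_trans; [apply HLy|].
          apply Rmult_le_compat_r; [apply Rabs_pos|].
          assert (0 <= C * (2 * M)) by (apply Rmult_le_pos; lra). lra.
        - simpl.
          replace (y a + B (it n) a - (y b + B (it n) b))
            with ((y a - y b) + (B (it n) a - B (it n) b)) by ring.
          eapply Rle_trans; [apply Rabs_triang|].
          assert (H1 := HLy a b).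
          assert (H2 := HC (it n) (2 * M) (HX n) (Hbd n) a b). lra. }
      assert (Hl : is_lim_seq (fun n => it n a - it n b) (u a - u b))
        by (apply is_lim_seq_minus'; apply Hex).
      rewrite <- (Rminus_0_r (u a - u b)).
      apply (is_lim_seq_Rabs_sub_le _ _ _ _ Hl).
      exists O. intros n _. rewrite Rminus_0_r. apply Hlip. }
  exists u. split; [exact HuX|]. intros t.
  apply Rminus_diag_uniq. apply (le_half_pow_0 _ M). intros n.
  replace (u t - (y t + B u t))
    with ((u t - it (S n) t) - (B u t + -1 * B (it n) t)) by (simpl; ring).
  rewrite <- Hlin by auto.
  eapply Rle_trans; [apply Rabs_triang|]. rewrite Rabs_Ropp.
  assert (H1 := Hu (S n) t).
  assert (H2 : Rabs (B (fun s => u s + -1 * it n s) t) <= M * (/2)^n / 2).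
  { apply Hq; [now apply Hsub|]. intros s.
    replace (u s + -1 * it n s) with (u s - it n s) by ring. apply Hu. }
  change (it (S n) t) with (y t + B (it n) t) in *. simpl pow in H1. lra.
Qed.

End Neumann.

(** Combinations of translates of the ramp are the piecewise linear functions; they
    serve for interpolation on a grid. *)
Definition ramp (x : R) : R := Rmax 0 (Rmin 1 x).

Lemma ramp_lipschitz h s :
  0 < h -> lipschitz (/ h) (fun t => ramp ((t - s) / h)).
Proof.
  intros Hh x y.
  assert (E : / h * Rabs (x - y) = Rabs ((x - s) / h - (y - s) / h)).
  { replace ((x - s) / h - (y - s) / h) with (/ h * (x - y)) by (field; lra).
    rewrite Rabs_mult, (Rabs_pos_eq (/ h)); [reflexivity|].
    apply Rlt_le, Rinv_0_lt_compat, Hh. }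
  rewrite E. unfold ramp, Rmax, Rmin.
  repeat destruct Rle_dec; unfold Rabs; repeat destruct Rcase_abs; lra.
Qed.

Lemma ramp_le_0 x : x <= 0 -> ramp x = 0.
Proof. intros H. unfold ramp, Rmax, Rmin. repeat destruct Rle_dec; lra. Qed.

Lemma ramp_ge_1 x : 1 <= x -> ramp x = 1.
Proof. intros H. unfold ramp, Rmax, Rmin. repeat destruct Rle_dec; lra. Qed.

Lemma div_le_intro x c h : 0 < h -> x <= c * h -> x / h <= c.
Proof.
  intros Hh H. apply Rmult_le_reg_r with h; [lra|].
  replace (x / h * h) with x by (field; lra). lra.
Qed.

Lemma le_div_intro x c h : 0 < h -> c * h <= x -> c <= x / h.
Proof.
  intros Hh H. apply Rmult_le_reg_r with h; [lra|].
  replace (x / h * h) with x by (field; lra). lra.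
Qed.

Lemma ramp_bound x : 0 <= ramp x <= 1.
Proof. unfold ramp, Rmax, Rmin. repeat destruct Rle_dec; lra. Qed.

(** Piecewise linear interpolation on the grid of mesh [h], written with increments.
    On the cell of [t] the earlier ramps equal 1, and their sum telescopes to the
    value of [w] at the left end of the cell. *)
Lemma interpolation_error w L h k t :
  0 < h -> lipschitz L w -> (forall s, s <= 0 -> w s = 0) -> t <= INR k * h ->
  Rabs (w t - rsum k (fun i => (w (INR (S i) * h) - w (INR i * h))
                               * ramp ((t - INR i * h) / h))) <= 2 * L * h.
Proof.
  intros Hh HL H0. revert t.
  assert (L0 : 0 <= L).
  { specialize (HL 1 0). rewrite Rminus_0_r, Rabs_R1 in HL.
    assert (H := Rabs_pos (w 1 - w 0)). lra. }
  assert (Lh : 0 <= L * h) by (apply Rmult_le_pos; lra).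
  induction k as [|k IH]; intros t Ht.
  - simpl in *. rewrite H0 by lra. rewrite Rminus_diag, Rabs_R0. lra.
  - destruct (Rle_dec t (INR k * h)) as [Hk|Hk].
    + simpl rsum. rewrite (ramp_le_0 ((t - INR k * h) / h)).
      * rewrite Rmult_0_r, Rplus_0_r. now apply IH.
      * apply div_le_intro; lra.
    + cbn [rsum].
      rewrite (rsum_ext k _ (fun i => w (INR (S i) * h) - w (INR i * h))).
      2:{ intros i Hi. rewrite ramp_ge_1; [ring|].
          apply le_div_intro; [lra|].
          assert (INR (S i) <= INR k) by (apply le_INR; lia).
          assert (INR (S i) * h <= INR k * h) by (apply Rmult_le_compat_r; lra).
          rewrite S_INR in *. lra. }
      rewrite (rsum_telescope k (fun i => w (INR i * h))).
      simpl (INR 0). rewrite Rmult_0_l, (H0 0) by lra.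
      set (a := INR k * h) in *. set (b := INR (S k) * h) in *.
      assert (Eb : b = a + h) by (unfold a, b; rewrite S_INR; ring).
      assert (H1 := HL t a). assert (H2 := HL b a).
      rewrite (Rabs_pos_eq (t - a)) in H1 by lra. rewrite (Rabs_pos_eq (b - a)) in H2 by lra.
      assert (H3 := ramp_bound ((t - a) / h)).
      replace (w t - (w a - 0 + (w b - w a) * ramp ((t - a) / h)))
        with ((w t - w a) - (w b - w a) * ramp ((t - a) / h)) by ring.
      eapply Rle_trans; [apply Rabs_triang|]. rewrite Rabs_Ropp, Rabs_mult.
      rewrite (Rabs_pos_eq (ramp _)) by lra.
      assert (Rabs (w b - w a) * ramp ((t - a) / h) <= Rabs (w b - w a) * 1)
        by (apply Rmult_le_compat_l; [apply Rabs_pos|lra]).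
      assert (L * (t - a) <= L * h) by (apply Rmult_le_compat_l; lra).
      replace (b - a) with h in H2 by lra. lra.
Qed.

Section Fredholm.

Context (T : R) (K : (R -> R) -> R -> R) (HT : 0 < T) (HK : smoothing T K).

(** Subtracting the interpolant of [K u] on a fine grid leaves a small operator, as
    [K u] has a Lipschitz constant proportional to the bound on [u]. *)
Lemma finite_rank_splitting :
  exists (m : nat) (phi : nat -> (R -> R) -> R) (e : nat -> R -> R),
    let B := fun u t => K u t + -1 * rsum m (fun i => phi i u * e i t) in
    (forall i u v c, anchored T u -> anchored T v ->
       phi i (fun s => u s + c * v s) = phi i u + c * phi i v) /\
    (forall i, (i < m)%nat -> anchored T (e i)) /\
    smoothing T B /\
    forall u M, anchored T u -> (forall t, Rabs (u t) <= M) ->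
      forall t, Rabs (B u t) <= M / 2.
Proof.
  destruct HK as (Hlin & HK0 & HKT & L & L0 & HL).
  (* On a mesh [h] with [4 (L + 1) h < 1] the interpolation error [2 L M h] is at most
     [M / 2]. *)
  destruct (nfloor_ex (4 * (L + 1) * T)) as [m0 [_ Hm0]].
  { apply Rlt_le. repeat apply Rmult_lt_0_compat; lra. }
  set (m := S m0).
  assert (Hm : 4 * (L + 1) * T < INR m) by (unfold m; rewrite S_INR; lra).
  assert (Hm1 : 0 < INR m) by (apply lt_0_INR; unfold m; lia).
  set (h := T / INR m).
  assert (Hh : 0 < h) by now apply Rdiv_lt_0_compat.
  assert (HmT : INR m * h = T) by (unfold h; field; lra).
  assert (HLh : 4 * (L + 1) * h < 1).
  { unfold h. apply Rmult_lt_reg_r with (INR m); [lra|].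
    replace (4 * (L + 1) * (T / INR m) * INR m) with (4 * (L + 1) * T) by (field; lra).
    lra. }
  pose (phi := fun (i : nat) u => K u (INR (S i) * h) - K u (INR i * h)).
  pose (e := fun (i : nat) t => ramp ((t - INR i * h) / h)).
  assert (Hphi : forall i u v c, anchored T u -> anchored T v ->
     phi i (fun s => u s + c * v s) = phi i u + c * phi i v).
  { intros i u v c Hu Hv. unfold phi. rewrite !Hlin by assumption. ring. }
  assert (He : forall i, (i < m)%nat -> anchored T (e i)).
  { intros i Hi. unfold e. split; [|split].
    - intros t Ht. apply ramp_le_0, div_le_intro; [lra|].
      assert (0 <= INR i * h) by (apply Rmult_le_pos; [apply pos_INR|lra]).
      lra.
    - assert (H : forall t, T <= t -> ramp ((t - INR i * h) / h) = 1).
      { intros t Ht. apply ramp_ge_1, le_div_intro; [lra|].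
        assert (INR (S i) <= INR m) by (apply le_INR; lia).
        assert (INR (S i) * h <= INR m * h) by (apply Rmult_le_compat_r; lra).
        rewrite S_INR in *. lra. }
      intros t Ht. rewrite !H by lra. reflexivity.
    - exists (/ h). now apply ramp_lipschitz. }
  exists m, phi, e. cbv zeta. split; [exact Hphi|]. split; [exact He|].
  assert (HB0 : forall u, anchored T u -> forall t, t <= 0 ->
            K u t + -1 * rsum m (fun i => phi i u * e i t) = 0).
  { intros u Hu t Ht. rewrite HK0 by assumption. rewrite rsum_0; [ring|].
    intros i Hi. rewrite (proj1 (He i Hi)) by assumption. ring. }
  assert (HBT : forall u, anchored T u -> forall t, T <= t ->
            K u t + -1 * rsum m (fun i => phi i u * e i t)
            = K u T + -1 * rsum m (fun i => phi i u * e i T)).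
  { intros u Hu t Ht. rewrite HKT by assumption. do 2 f_equal.
    apply rsum_ext. intros i Hi. now rewrite (proj1 (proj2 (He i Hi)) t). }
  split; [split; [|split; [|split]]|].
  - intros u v c Hu Hv t. rewrite Hlin by assumption.
    rewrite (rsum_ext m _ (fun i => phi i u * e i t + c * (phi i v * e i t))).
    + rewrite rsum_lin. ring.
    + intros i _. rewrite Hphi by assumption. ring.
  - exact HB0.
  - exact HBT.
  - exists (L + INR m * L). split.
    { assert (0 <= INR m * L) by (apply Rmult_le_pos; lra). lra. }
    intros u M Hu HM x y.
    replace (K u x + -1 * rsum m (fun i => phi i u * e i x)
             - (K u y + -1 * rsum m (fun i => phi i u * e i y)))
      with ((K u x - K u y)
            - (rsum m (fun i => phi i u * e i x) + -1 * rsum m (fun i => phi i u * e i y)))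
      by ring.
    rewrite <- rsum_lin.
    eapply Rle_trans; [apply Rabs_triang|]. rewrite Rabs_Ropp.
    assert (H1 := HL u M Hu HM x y).
    assert (H2 : Rabs (rsum m (fun i => phi i u * e i x + -1 * (phi i u * e i y)))
                 <= INR m * (L * M * Rabs (x - y))).
    { apply rsum_abs. intros i Hi.
      replace (phi i u * e i x + -1 * (phi i u * e i y))
        with (phi i u * (e i x - e i y)) by ring.
      rewrite Rabs_mult.
      assert (H3 : Rabs (phi i u) <= L * M * h).
      { unfold phi. eapply Rle_trans; [apply (HL u M Hu HM)|].
        rewrite S_INR. replace ((INR i + 1) * h - INR i * h) with h by ring.
        rewrite (Rabs_pos_eq h) by lra. lra. }
      assert (H4 : Rabs (e i x - e i y) <= / h * Rabs (x - y))
        by now apply ramp_lipschitz.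
      replace (L * M * Rabs (x - y)) with (L * M * h * (/ h * Rabs (x - y)))
        by (field; lra).
      apply Rmult_le_compat; auto using Rabs_pos. }
    lra.
  - intros u M Hu HM.
    assert (M0 : 0 <= M) by (eapply Rle_trans; [apply Rabs_pos|apply (HM 0)]).
    assert (HBle : forall t, t <= T ->
      Rabs (K u t + -1 * rsum m (fun i => phi i u * e i t)) <= M / 2).
    { intros t Ht.
      replace (K u t + -1 * rsum m (fun i => phi i u * e i t))
        with (K u t - rsum m (fun i => phi i u * e i t)) by ring.
      eapply Rle_trans.
      - apply (interpolation_error (K u) (L * M) h m t Hh (HL u M Hu HM)); auto. lra.
      - assert (H := Rmult_le_compat_r M _ _ M0 (Rlt_le _ _ HLh)).
        assert (0 <= M * h) by (apply Rmult_le_pos; lra). lra. }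
    intros t. destruct (Rle_dec t T) as [Ht|Ht]; [now apply HBle|].
    rewrite HBT by (assumption || lra). apply HBle. lra.
Qed.

(** Let [Z i] solve [Z i = e i + B (Z i)] and [z] solve [z = r + B z].  Then
    [z + sum c_i Z i] solves the equation exactly when [c] solves a square linear
    system, and a nonzero solution of the homogeneous system would contradict
    injectivity. *)
Theorem fredholm_solvable :
  (forall u, anchored T u -> (forall t, u t = K u t) -> forall t, u t = 0) ->
  forall r, anchored T r ->
  exists u, anchored T u /\ forall t, u t = K u t + r t.
Proof.
  intros Hinj r Hr.
  destruct finite_rank_splitting as (m & phi & e & Hphi & He & HB & Hq).
  set (B := fun u t => K u t + -1 * rsum m (fun i => phi i u * e i t)) in *.
  assert (HT0 : 0 <= T) by lra.
  assert (HZ : forall i, exists z, (i < m)%nat ->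
             anchored T z /\ forall t, z t = e i t + B z t).
  { intros i. destruct (Nat.lt_ge_cases i m) as [Hi|Hi].
    - destruct (contraction_solvable T B HT0 Hq (e i) HB (He i Hi)) as [z Hz].
      exists z. auto.
    - exists (fun _ => 0). intros. lia. }
  assert (HZ' : exists Z : nat -> R -> R, forall i, (i < m)%nat ->
             anchored T (Z i) /\ forall t, Z i t = e i t + B (Z i) t).
  { exists (fun i => proj1_sig (constructive_indefinite_description _ (HZ i))).
    intros i. apply (proj2_sig (constructive_indefinite_description _ (HZ i))). }
  clear HZ. destruct HZ' as [Z HZ].
  destruct (contraction_solvable T B HT0 Hq r HB Hr) as (z & Hz & Ez).
  assert (HZX : forall c, anchored T (fun t => rsum m (fun i => c i * Z i t)))
    by (intros; apply anchored_rsum; intros; now apply HZ).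
  assert (phi_0 : forall i, phi i (fun _ => 0) = 0).
  { intros i. exact (additive_0 _ (Hphi i _ _ (-1) (anchored_0 T) (anchored_0 T))). }
  assert (phi_sum : forall i c n, (n <= m)%nat ->
     phi i (fun t => rsum n (fun j => c j * Z j t)) = rsum n (fun j => phi i (Z j) * c j)).
  { intros i c n. induction n as [|n IH]; intros Hn; simpl; [apply phi_0|].
    rewrite (Hphi i (fun t => rsum n (fun j => c j * Z j t)) (Z n)).
    - rewrite IH by lia. ring.
    - apply anchored_rsum. intros; apply HZ; lia.
    - apply HZ; lia. }
  assert (ZE : forall c t, rsum m (fun i => c i * Z i t)
     = rsum m (fun i => c i * e i t) + B (fun s => rsum m (fun i => c i * Z i s)) t).
  { intros c t.
    rewrite (linear_on_rsum T B m c Z (proj1 HB)) by (intros; now apply HZ).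
    rewrite <- (Rmult_1_l (rsum m (fun i => c i * B (Z i) t))), <- rsum_lin.
    apply rsum_ext. intros i Hi. rewrite (proj2 (HZ i Hi)). ring. }
  destruct (LinearAlgebra.fixed_point_or_solvable m (fun i j => phi i (Z j)))
    as [(c & (i & Hi & ci) & Hc) | Hsol].
  - exfalso. apply ci. rewrite Hc by assumption.
    rewrite <- phi_sum by lia.
    replace (fun t => rsum m (fun j => c j * Z j t)) with (fun _ : R => 0); [apply phi_0|].
    apply functional_extensionality. intros t. symmetry.
    apply (Hinj _ (HZX c)). clear t. intros t. rewrite ZE at 1. unfold B.
    rewrite (rsum_ext m (fun i0 => phi i0 _ * e i0 t) (fun i0 => c i0 * e i0 t)).
    + ring.
    + intros j Hj. rewrite phi_sum by lia. now rewrite <- Hc.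
  - destruct (Hsol (fun i => phi i z)) as [c Hc].
    exists (fun t => z t + 1 * rsum m (fun i => c i * Z i t)).
    split; [now apply (anchored_lin T z), HZX|]. intros t.
    rewrite (proj1 HK z (fun s => rsum m (fun i => c i * Z i s))) by auto.
    rewrite ZE, Ez. unfold B.
    rewrite (rsum_ext m (fun i => phi i (fun s => rsum m _) * e i t)
       (fun i => c i * e i t + -1 * (phi i z * e i t))).
    + rewrite rsum_lin. ring.
    + intros j Hj. rewrite phi_sum by lia. rewrite (Hc j Hj). ring.
Qed.

(** A solution of [u = K u] on which the functionals of the finite-rank part vanish is
    a fixed point of the small part. *)
Lemma kernel_finite_dimensional :
  exists (m : nat) (phi : nat -> (R -> R) -> R),
    (forall i u v c, anchored T u -> anchored T v ->
       phi i (fun s => u s + c * v s) = phi i u + c * phi i v) /\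
    forall u, anchored T u -> (forall t, u t = K u t) ->
      (forall i, (i < m)%nat -> phi i u = 0) -> forall t, u t = 0.
Proof.
  destruct finite_rank_splitting as (m & phi & e & Hphi & He & HB & Hq).
  exists m, phi. split; [exact Hphi|]. intros u Hu Hfix H0.
  apply (contraction_fixpoint_0 T _ (Rlt_le _ _ HT) Hq u Hu).
  intros t. rewrite (rsum_0 m).
  - rewrite <- Hfix. ring.
  - intros i Hi. rewrite H0 by assumption. ring.
Qed.

Definition fixed (u : R -> R) : Prop := anchored T u /\ forall t, u t = K u t.

Lemma fixed_lin u v c : fixed u -> fixed v -> fixed (fun t => u t + c * v t).
Proof.
  intros [Hu Eu] [Hv Ev]. split; [now apply anchored_lin|].
  intros t. rewrite (proj1 HK) by assumption. now rewrite <- Eu, <- Ev.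
Qed.

Lemma fixed_0 : fixed (fun _ => 0).
Proof.
  split; [apply anchored_0|]. intros t. symmetry.
  apply (linear_on_0 _ _ (proj1 HK)), anchored_0.
Qed.

Lemma fixed_rsum n c (v : nat -> R -> R) :
  (forall i, (i < n)%nat -> fixed (v i)) ->
  fixed (fun t => rsum n (fun i => c i * v i t)).
Proof.
  induction n as [|n IH]; intros Hv; simpl; [apply fixed_0|].
  apply (fixed_lin (fun t => rsum n (fun i => c i * v i t)) (v n)).
  - apply IH. intros; apply Hv; lia.
  - apply Hv; lia.
Qed.

Definition independent (d : nat) (v : nat -> R -> R) : Prop :=
  (forall i, (i < d)%nat -> fixed (v i)) /\
  forall c, (forall t, rsum d (fun i => c i * v i t) = 0) ->
    forall i, (i < d)%nat -> c i = 0.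

(** More vectors than functionals are dependent after applying the functionals, hence
    dependent. *)
Lemma independent_bounded : exists m, forall v, ~ independent (S m) v.
Proof.
  destruct kernel_finite_dimensional as (m & phi & Hphi & H0).
  exists m. intros v [Hv Hi].
  destruct (LinearAlgebra.dependent_vectors m (fun k i => phi i (v k)))
    as (c & (k & Hk & ck) & Hc).
  apply ck. apply Hi; [|exact Hk].
  destruct (fixed_rsum (S m) c v Hv) as [HX Hfix].
  apply (H0 _ HX Hfix). intros i Hil.
  rewrite <- (Hc i Hil).
  assert (phi_0 := additive_0 _ (Hphi i _ _ (-1) (anchored_0 T) (anchored_0 T))).
  assert (Hn : forall n, (n <= S m)%nat ->
     phi i (fun t => rsum n (fun j => c j * v j t)) = rsum n (fun j => c j * phi i (v j))).
  { induction n as [|n IH]; intros Hn; simpl; [apply phi_0|].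
    rewrite (Hphi i (fun t => rsum n (fun j => c j * v j t)) (v n)).
    - rewrite IH by lia. ring.
    - apply anchored_rsum. intros j Hj. apply (Hv j). lia.
    - apply (Hv n). lia. }
  apply Hn. lia.
Qed.

Lemma kernel_basis :
  (exists u, fixed u /\ exists t, u t <> 0) ->
  exists d v, (0 < d)%nat /\ independent d v /\
    forall w, fixed w -> exists c, forall t, w t = rsum d (fun i => c i * v i t).
Proof.
  intros (u & Hu & t0 & ut0).
  destruct independent_bounded as [m Hm].
  assert (Hmax : exists d v, (0 < d)%nat /\ independent d v /\
                   forall v', ~ independent (S d) v').
  { apply NNPP. intros Hno.
    assert (Hall : forall d, exists v, independent (S d) v).
    { induction d as [|d [v Hv]].
      - exists (fun _ => u). split; [auto|].
        intros c Hc i Hi. specialize (Hc t0). simpl in Hc.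
        replace i with O by lia.
        destruct (Rmult_integral (c O) (u t0)); [lra|assumption|contradiction].
      - apply NNPP. intros Hn. apply Hno. exists (S d), v.
        split; [lia|]. split; [exact Hv|]. intros v' Hv'. apply Hn. now exists v'. }
    destruct (Hall m) as [v Hv]. exact (Hm v Hv). }
  destruct Hmax as (d & v & Hd & [Hv Hi] & Hmax).
  exists d, v. split; [exact Hd|]. split; [now split|].
  intros w Hw.
  (* By maximality, [v] extended by [w] is dependent, and [w] has a nonzero coefficient. *)
  pose (v' := fun i => if Compare_dec.lt_dec i d then v i else w).
  assert (Ev : forall c t, rsum (S d) (fun i => c i * v' i t)
                           = rsum d (fun i => c i * v i t) + c d * w t).
  { intros c t. simpl. f_equal.
    - apply rsum_ext. intros i Hid. unfold v'. now destruct (Compare_dec.lt_dec i d).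
    - unfold v'. destruct (Compare_dec.lt_dec d d); [lia|reflexivity]. }
  assert (Hc : exists c, (forall t, rsum (S d) (fun i => c i * v' i t) = 0) /\ c d <> 0).
  { apply NNPP. intros Hno. apply (Hmax v'). split.
    - intros i Hid. unfold v'. destruct (Compare_dec.lt_dec i d); auto.
    - intros c Hc.
      assert (cd : c d = 0) by (apply NNPP; intros H; apply Hno; now exists c).
      assert (Hc' : forall i, (i < d)%nat -> c i = 0).
      { apply Hi. intros t. specialize (Hc t). rewrite Ev, cd in Hc. lra. }
      intros i Hid. destruct (Nat.eq_dec i d) as [->|]; [exact cd|].
      apply Hc'. lia. }
  destruct Hc as (c & Hc & cd).
  exists (fun i => - / c d * c i). intros t.
  specialize (Hc t). rewrite Ev in Hc.
  rewrite (rsum_ext d _ (fun i => - / c d * (c i * v i t))) by (intros; ring).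
  rewrite rsum_scal.
  replace (rsum d (fun i => c i * v i t)) with (- (c d * w t)) by lra.
  field. exact cd.
Qed.

(** The eigenvector is [p + i q], with eigenvalue [mr + i mi]. *)
Theorem kernel_eigenvector (Sh : (R -> R) -> R -> R) :
  (forall u, fixed u -> fixed (Sh u)) -> linear_on fixed Sh ->
  (exists u, fixed u /\ exists t, u t <> 0) ->
  exists mr mi p q, fixed p /\ fixed q /\ (exists t, p t <> 0 \/ q t <> 0) /\
    forall t, Sh p t = mr * p t - mi * q t /\ Sh q t = mr * q t + mi * p t.
Proof.
  intros HSh Hlin Hne.
  destruct (kernel_basis Hne) as (d & v & Hd & [Hv Hi] & Hspan).
  assert (HA : forall i, exists c, (i < d)%nat ->
             forall t, Sh (v i) t = rsum d (fun j => c j * v j t)).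
  { intros i. destruct (Nat.lt_ge_cases i d) as [Hid|Hid].
    - destruct (Hspan _ (HSh _ (Hv i Hid))) as [c Hc]. now exists c.
    - exists (fun _ => 0). lia. }
  pose (A := fun i => proj1_sig (constructive_indefinite_description _ (HA i))).
  assert (HA' : forall i, (i < d)%nat ->
             forall t, Sh (v i) t = rsum d (fun j => A i j * v j t)).
  { intros i. exact (proj2_sig (constructive_indefinite_description _ (HA i))). }
  assert (HSum : forall x n t, (n <= d)%nat ->
     Sh (fun s => rsum n (fun i => x i * v i s)) t
     = rsum n (fun i => x i * Sh (v i) t)).
  { intros x n t. induction n as [|n IH]; intros Hn; simpl.
    - apply (linear_on_0 _ _ Hlin), fixed_0.
    - rewrite (Hlin (fun s => rsum n (fun i => x i * v i s)) (v n)).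
      + rewrite IH by lia. reflexivity.
      + apply fixed_rsum. intros j Hj. apply Hv. lia.
      + apply Hv. lia. }
  assert (HxA : forall x t, Sh (fun s => rsum d (fun i => x i * v i s)) t
     = rsum d (fun j => rsum d (fun i => x i * A i j) * v j t)).
  { intros x t. rewrite HSum by lia.
    rewrite (rsum_ext d _ (fun i => rsum d (fun j => x i * A i j * v j t))).
    - rewrite rsum_swap. apply rsum_ext. intros j Hj.
      rewrite (rsum_ext d _ (fun i => v j t * (x i * A i j))) by (intros; ring).
      rewrite rsum_scal. ring.
    - intros i Hid. rewrite (HA' i Hid), <- rsum_scal. apply rsum_ext. intros; ring. }
  destruct (LinearAlgebra.complex_eigenvector d A Hd)
    as (mr & mi & xr & xi & (k & Hk & xk) & Hx).
  exists mr, mi, (fun t => rsum d (fun i => xr i * v i t)),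
    (fun t => rsum d (fun i => xi i * v i t)).
  split; [now apply fixed_rsum|]. split; [now apply fixed_rsum|]. split.
  - apply NNPP. intros Hno.
    destruct xk as [xk|xk]; apply xk; apply Hi; auto; intros t;
      apply NNPP; intros Ht; apply Hno; exists t; auto.
  - intros t. rewrite !HxA. split.
    + rewrite (rsum_ext d _ (fun j => mr * (xr j * v j t) + - mi * (xi j * v j t))).
      * rewrite rsum_lin, rsum_scal. ring.
      * intros j Hj. rewrite (proj1 (Hx j Hj)). ring.
    + rewrite (rsum_ext d _ (fun j => mr * (xi j * v j t) + mi * (xr j * v j t))).
      * rewrite rsum_lin, rsum_scal. ring.
      * intros j Hj. rewrite (proj2 (Hx j Hj)). ring.
Qed.

End Fredholm.

(** * Continuous and C1 functions *)

Definition cont (h : R -> R) : Prop := forall t, continuous h t.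

Lemma cont_const c : cont (fun _ => c).
Proof. intros t. apply continuous_const. Qed.

Lemma cont_mult f g : cont f -> cont g -> cont (fun t => f t * g t).
Proof. intros Hf Hg t. now apply (continuous_mult (K := R_AbsRing)). Qed.

Lemma cont_plus f g : cont f -> cont g -> cont (fun t => f t + g t).
Proof. intros Hf Hg t. now apply (continuous_plus (V := R_NormedModule)). Qed.

Lemma cont_comp f g : cont f -> cont g -> cont (fun t => f (g t)).
Proof. intros Hf Hg t. now apply continuous_comp. Qed.

Lemma cont_shift f d : cont f -> cont (fun t => f (t - d)).
Proof.
  intros Hf. apply (cont_comp f (fun t => t - d) Hf). intros t.
  apply (continuous_minus (V := R_NormedModule));
    [apply continuous_id|apply continuous_const].
Qed.

Lemma cont_reflect f d : cont f -> cont (fun t => f (d - t)).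
Proof.
  intros Hf. apply (cont_comp f (fun t => d - t) Hf). intros t.
  apply (continuous_minus (V := R_NormedModule));
    [apply continuous_const|apply continuous_id].
Qed.

Lemma C1_cont h : C1 h -> cont h.
Proof. intros H t. apply (ex_derive_continuous (V := R_NormedModule)), H. Qed.

Lemma C1_Derive_cont h : C1 h -> cont (Derive h).
Proof. intros H t. apply H. Qed.

Lemma C1_intro h dh : (forall t, is_derive h t (dh t)) -> cont dh -> C1 h.
Proof.
  intros H Hc t. split; [eexists; apply H|].
  apply (continuous_ext dh); [|apply Hc].
  intros x. symmetry. now apply is_derive_unique.
Qed.

Lemma C1_scal h c : C1 h -> C1 (fun t => c * h t).
Proof.
  intros H. apply (C1_intro _ (fun t => c * Derive h t)).
  - intros t. apply (is_derive_scal h), Derive_correct, H.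
  - apply cont_mult; [apply cont_const|now apply C1_Derive_cont].
Qed.

Lemma C1_plus h k : C1 h -> C1 k -> C1 (fun t => h t + k t).
Proof.
  intros H K. apply (C1_intro _ (fun t => Derive h t + Derive k t)).
  - intros t. apply (is_derive_plus h k); apply Derive_correct; [apply H|apply K].
  - now apply cont_plus; apply C1_Derive_cont.
Qed.

Lemma C1_shift h d : C1 h -> C1 (fun t => h (t - d)).
Proof.
  intros H. apply (C1_intro _ (fun t => Derive h (t - d))).
  - intros t. auto_derive; [apply H|].
    change (fun x : R => h x) with h. unfold Rminus. ring.
  - now apply cont_shift, C1_Derive_cont.
Qed.

Lemma C1_const c : C1 (fun _ => c).
Proof.
  apply (C1_intro _ (fun _ => 0)); [|apply cont_const].
  intros t. apply (is_derive_const (V := R_NormedModule)).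
Qed.

(** * Integration *)

Definition integrable (f : R -> R) : Prop := forall l r, ex_RInt f l r.

Lemma integrable_cont f : cont f -> integrable f.
Proof. intros H l r. apply (ex_RInt_continuous (V := R_CompleteNormedModule)). auto. Qed.

Lemma integrable_ext f g : (forall t, f t = g t) -> integrable f -> integrable g.
Proof. intros H Hf l r. apply (ex_RInt_ext f); auto. Qed.

Lemma integrable_plus f g :
  integrable f -> integrable g -> integrable (fun t => f t + g t).
Proof. intros Hf Hg l r. now apply (ex_RInt_plus (V := R_NormedModule)). Qed.

Lemma integrable_scal f c : integrable f -> integrable (fun t => c * f t).
Proof. intros Hf l r. now apply (ex_RInt_scal (V := R_NormedModule) f). Qed.

Lemma integrable_glue x f g h :
  integrable f -> integrable g ->
  (forall t, t < x -> h t = f t) -> (forall t, x < t -> h t = g t) ->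
  integrable h.
Proof.
  intros Hf Hg Ef Eg.
  assert (H : forall l r, l <= r -> ex_RInt h l r).
  { intros l r Hlr.
    assert (Hl : forall r', l <= r' -> r' <= x -> ex_RInt h l r').
    { intros r' H1 H2. apply (ex_RInt_ext f); [|apply Hf].
      intros t. rewrite Rmin_left, Rmax_right by lra. intros Ht. symmetry; apply Ef; lra. }
    assert (Hr : forall l', l' <= r -> x <= l' -> ex_RInt h l' r).
    { intros l' H1 H2. apply (ex_RInt_ext g); [|apply Hg].
      intros t. rewrite Rmin_left, Rmax_right by lra. intros Ht. symmetry; apply Eg; lra. }
    destruct (Rle_dec r x); [apply Hl; lra|].
    destruct (Rle_dec x l); [apply Hr; lra|].
    apply (ex_RInt_Chasles h l x r); [apply Hl|apply Hr]; lra. }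
  intros l r. destruct (Rle_dec l r); [now apply H|].
  apply ex_RInt_swap, H. lra.
Qed.

Lemma RInt_plus_R f g l r : ex_RInt f l r -> ex_RInt g l r ->
  RInt (fun t => f t + g t) l r = RInt f l r + RInt g l r.
Proof. apply (RInt_plus (V := R_CompleteNormedModule)). Qed.

Lemma RInt_scal_R f c l r : ex_RInt f l r ->
  RInt (fun t => c * f t) l r = c * RInt f l r.
Proof. apply (RInt_scal (V := R_CompleteNormedModule)). Qed.

Lemma RInt_Chasles_R f l m r : integrable f ->
  RInt f l m + RInt f m r = RInt f l r.
Proof. intros H. apply (RInt_Chasles (V := R_CompleteNormedModule) f); apply H. Qed.

Lemma RInt_eq (f g : R -> R) l r : l <= r ->
  (forall t, l < t < r -> f t = g t) -> RInt f l r = RInt g l r.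
Proof.
  intros Hlr H. apply (RInt_ext (V := R_CompleteNormedModule)).
  intros t. rewrite Rmin_left, Rmax_right by lra. apply H.
Qed.

Lemma RInt_ext_R (f g : R -> R) l r : (forall t, f t = g t) -> RInt f l r = RInt g l r.
Proof. intros H. apply (RInt_ext (V := R_CompleteNormedModule)). auto. Qed.

Lemma RInt_reflect (f : R -> R) c l r : integrable f ->
  RInt (fun s => f (c - s)) l r = RInt f (c - r) (c - l) :> R.
Proof.
  intros Hf.
  assert (H := RInt_comp_lin (V := R_CompleteNormedModule) f (-1) c l r (Hf _ _)).
  replace (-1 * l + c) with (c - l) in H by ring.
  replace (-1 * r + c) with (c - r) in H by ring.
  assert (H1 := RInt_Chasles_R f (c - l) (c - r) (c - l) Hf).
  assert (H0 := RInt_Chasles_R f (c - l) (c - l) (c - l) Hf).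
  transitivity (- RInt f (c - l) (c - r)); [|lra].
  rewrite <- H.
  transitivity (RInt (fun s => -1 * (-1 * f (-1 * s + c))) l r).
  - apply RInt_ext_R. intros s. replace (-1 * s + c) with (c - s) by ring. ring.
  - rewrite RInt_scal_R.
    + change (fun s : R => scal (-1) (f (-1 * s + c))) with
        (fun s => -1 * f (-1 * s + c)). ring.
    + apply (ex_RInt_comp_lin (V := R_NormedModule) f (-1) c l r). apply Hf.
Qed.

Lemma RInt_zero (f : R -> R) l r :
  (forall t, Rmin l r < t < Rmax l r -> f t = 0) -> RInt f l r = 0.
Proof.
  intros H. rewrite (RInt_ext (V := R_CompleteNormedModule) f (fun _ => 0)) by exact H.
  rewrite (RInt_const (V := R_CompleteNormedModule)).
  apply Rmult_0_r.
Qed.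

Lemma RInt_eq0 (f : R -> R) l r : l <= r ->
  (forall t, l < t < r -> f t = 0) -> RInt f l r = 0.
Proof.
  intros Hlr H. apply RInt_zero.
  intros t. rewrite Rmin_left, Rmax_right by lra. apply H.
Qed.

(** * Piecewise functions *)

Definition step (x t : R) : R := if Rle_dec x t then 1 else 0.

Lemma step_1 x t : x <= t -> step x t = 1.
Proof. unfold step. destruct Rle_dec; lra. Qed.

Lemma step_0 x t : t < x -> step x t = 0.
Proof. unfold step. destruct Rle_dec; lra. Qed.

(** Sums of functions [step x * h] with [P h].  They vanish before 0, and the class is
    stable under delays, truncations and convolution. *)
Inductive pieces (P : (R -> R) -> Prop) : (R -> R) -> Prop :=
| pieces_nil u : (forall t, u t = 0) -> pieces P u
| pieces_cons u v x h : pieces P u -> 0 <= x -> P h ->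
    (forall t, v t = u t + step x t * h t) -> pieces P v.

Lemma pieces_ext P u v : (forall t, u t = v t) -> pieces P u -> pieces P v.
Proof.
  intros E H. replace v with u; [exact H|]. now apply functional_extensionality.
Qed.

Lemma pieces_one P x h : 0 <= x -> P h -> pieces P (fun t => step x t * h t).
Proof.
  intros Hx Hh. apply (pieces_cons P (fun _ => 0) _ x h); auto.
  - now apply pieces_nil.
  - intros; ring.
Qed.

Lemma pieces_plus P u v :
  pieces P u -> pieces P v -> pieces P (fun t => u t + v t).
Proof.
  intros Hu Hv. induction Hv as [v E|v0 v x h Hv IH Hx Hh E].
  - apply (pieces_ext P u); [|exact Hu]. intros t. rewrite E. ring.
  - apply (pieces_cons P (fun t => u t + v0 t) _ x h); auto.
    intros t. rewrite E. ring.
Qed.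

Lemma pieces_mono (P P' : (R -> R) -> Prop) u :
  (forall h, P h -> P' h) -> pieces P u -> pieces P' u.
Proof.
  intros HP H. induction H as [u E|u v x h Hu IH Hx Hh E].
  - now apply pieces_nil.
  - apply (pieces_cons P' u v x h); auto.
Qed.

Lemma pieces_neg P u t : pieces P u -> t < 0 -> u t = 0.
Proof.
  intros H Ht. induction H as [u E|u v x h Hu IH Hx Hh E]; [apply E|].
  rewrite E, IH, step_0 by lra. ring.
Qed.

Definition stable (P : (R -> R) -> Prop) : Prop :=
  (forall h c, P h -> P (fun t => c * h t)) /\
  (forall h d, P h -> P (fun t => h (t - d))).

Lemma stable_cont : stable cont.
Proof.
  split.
  - intros h c H. apply cont_mult; [apply cont_const|exact H].
  - intros h d. apply cont_shift.
Qed.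

Lemma stable_C1 : stable C1.
Proof. split; [intros; now apply C1_scal|intros; now apply C1_shift]. Qed.

Lemma pieces_scal P u c : stable P -> pieces P u -> pieces P (fun t => c * u t).
Proof.
  intros [Hs _] H. induction H as [u E|u v x h Hu IH Hx Hh E].
  - apply pieces_nil. intros t. rewrite E. ring.
  - apply (pieces_cons P (fun t => c * u t) _ x (fun t => c * h t)); auto.
    intros t. rewrite E. ring.
Qed.

Lemma pieces_lin P u v c : stable P -> pieces P u -> pieces P v ->
  pieces P (fun t => u t + c * v t).
Proof. intros HP Hu Hv. apply (pieces_plus P u); auto. now apply pieces_scal. Qed.

Lemma pieces_shift P u d : stable P -> pieces P u ->
  pieces P (fun t => step 0 t * u (t - d)).
Proof.
  intros [_ Hs] H. induction H as [u E|u v x h Hu IH Hx Hh E].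
  - apply pieces_nil. intros t. rewrite E. ring.
  - apply (pieces_cons P (fun t => step 0 t * u (t - d)) _
             (Rmax 0 (x + d)) (fun t => h (t - d))); auto using Rmax_l.
    intros t. rewrite E. rewrite Rmult_plus_distr_l. f_equal.
    rewrite <- Rmult_assoc. f_equal.
    unfold step, Rmax. repeat destruct Rle_dec; lra.
Qed.

Lemma pieces_delay P u d : stable P -> 0 <= d -> pieces P u ->
  pieces P (fun t => u (t - d)).
Proof.
  intros HP Hd Hu. apply (pieces_ext P (fun t => step 0 t * u (t - d))).
  - intros t. destruct (Rle_dec 0 t) as [H|H].
    + rewrite step_1 by exact H. ring.
    + rewrite (pieces_neg P u (t - d) Hu) by lra. ring.
  - now apply pieces_shift.
Qed.

Lemma pieces_step P u y : 0 <= y -> pieces P u -> pieces P (fun t => step y t * u t).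
Proof.
  intros Hy H. induction H as [u E|u v x h Hu IH Hx Hh E].
  - apply pieces_nil. intros t. rewrite E. ring.
  - apply (pieces_cons P (fun t => step y t * u t) _ (Rmax x y) h); auto.
    + unfold Rmax. destruct Rle_dec; lra.
    + intros t. rewrite E. rewrite Rmult_plus_distr_l. f_equal.
      rewrite <- Rmult_assoc. f_equal.
      unfold step, Rmax. repeat destruct Rle_dec; lra.
Qed.

(** Riemann integrability of a product is not immediate from that of its factors; this
    notion is the one that passes through products with [pieces]. *)
Definition multiplier (f : R -> R) : Prop :=
  forall w, cont w -> integrable (fun t => w t * f t).

Lemma multiplier_1 : multiplier (fun _ => 1).
Proof.
  intros w Hw. apply (integrable_ext w); [intros; ring|now apply integrable_cont].
Qed.

Lemma multiplier_integrable f : multiplier f -> integrable f.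
Proof.
  intros H. apply (integrable_ext (fun t => 1 * f t)); [intros; ring|].
  apply (H (fun _ => 1)), cont_const.
Qed.

Lemma multiplier_pieces f u : multiplier f -> pieces cont u ->
  multiplier (fun t => f t * u t).
Proof.
  intros Hf H. induction H as [u E|u v x h Hu IH Hx Hh E]; intros w Hw.
  - apply (integrable_ext (fun _ => 0)); [|apply integrable_cont, cont_const].
    intros t. rewrite E. ring.
  - apply (integrable_ext (fun t => w t * (f t * u t) + step x t * (w t * h t * f t))).
    { intros t. rewrite E. ring. }
    apply integrable_plus; [now apply IH|].
    apply (integrable_glue x (fun _ => 0) (fun t => w t * h t * f t)).
    + apply integrable_cont, cont_const.
    + apply (Hf (fun t => w t * h t)). now apply cont_mult.
    + intros t Ht. rewrite step_0 by lra. ring.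
    + intros t Ht. rewrite step_1 by lra. ring.
Qed.

Lemma multiplier_reflected_pieces f u s : multiplier f -> pieces cont u ->
  multiplier (fun t => f t * u (s - t)).
Proof.
  intros Hf H. induction H as [u E|u v x h Hu IH Hx Hh E]; intros w Hw.
  - apply (integrable_ext (fun _ => 0)); [|apply integrable_cont, cont_const].
    intros t. rewrite E. ring.
  - apply (integrable_ext (fun t => w t * (f t * u (s - t))
                                    + step x (s - t) * (w t * h (s - t) * f t))).
    { intros t. rewrite E. ring. }
    apply integrable_plus; [now apply IH|].
    apply (integrable_glue (s - x) (fun t => w t * h (s - t) * f t) (fun _ => 0)).
    + apply (Hf (fun t => w t * h (s - t))). apply cont_mult; [exact Hw|].
      now apply cont_reflect.
    + apply integrable_cont, cont_const.
    + intros t Ht. rewrite step_1 by lra. ring.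
    + intros t Ht. rewrite step_0 by lra. ring.
Qed.

Lemma multiplier_of_pieces u : pieces cont u -> multiplier u.
Proof.
  intros Hu w Hw. apply (integrable_ext (fun t => w t * (1 * u t))); [intros; ring|].
  exact (multiplier_pieces _ _ multiplier_1 Hu w Hw).
Qed.

Lemma pieces_integrable u : pieces cont u -> integrable u.
Proof. intros Hu. now apply multiplier_integrable, multiplier_of_pieces. Qed.

Lemma pieces_C1_cont u : pieces C1 u -> pieces cont u.
Proof. apply pieces_mono, C1_cont. Qed.

(** * Convolution *)

Definition conv (u v : R -> R) (t : R) : R := RInt (fun s => u s * v (t - s)) 0 t.

Lemma conv_integrable u v t : pieces cont u -> pieces cont v ->
  integrable (fun s => u s * v (t - s)).
Proof.
  intros Hu Hv. apply multiplier_integrable, multiplier_reflected_pieces; auto.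
  now apply multiplier_of_pieces.
Qed.

Lemma conv_lin_l u v w c t : pieces cont u -> pieces cont v -> pieces cont w ->
  conv (fun s => u s + c * v s) w t = conv u w t + c * conv v w t.
Proof.
  intros Hu Hv Hw. unfold conv.
  rewrite <- RInt_scal_R by now apply conv_integrable.
  rewrite <- RInt_plus_R.
  - f_equal. apply functional_extensionality. intros; ring.
  - now apply conv_integrable.
  - now apply (integrable_scal (fun s => v s * w (t - s))), conv_integrable.
Qed.

Lemma conv_nonpos u v t : pieces cont u -> t <= 0 -> conv u v t = 0.
Proof.
  intros Hu Ht. apply RInt_zero.
  intros s. rewrite Rmin_right, Rmax_left by lra. intros Hs.
  rewrite (pieces_neg _ _ s Hu) by lra. ring.
Qed.

Lemma conv_comm u v t : pieces cont u -> pieces cont v -> conv u v t = conv v u t.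
Proof.
  intros Hu Hv. unfold conv.
  transitivity (RInt (fun s => u s * v (t - s)) (t - t) (t - 0)).
  { now rewrite Rminus_diag, Rminus_0_r. }
  rewrite <- (RInt_reflect (fun s => u s * v (t - s)) t 0 t) by now apply conv_integrable.
  apply RInt_ext_R. intros s. replace (t - (t - s)) with s by ring. ring.
Qed.

Lemma conv_lin_r u v w c t : pieces cont u -> pieces cont v -> pieces cont w ->
  conv w (fun s => u s + c * v s) t = conv w u t + c * conv w v t.
Proof.
  intros Hu Hv Hw. rewrite conv_comm, conv_lin_l, (conv_comm u), (conv_comm v);
    auto using pieces_lin, stable_cont.
Qed.

Lemma conv_delay u v d t : 0 <= d -> pieces cont u -> pieces cont v ->
  conv (fun s => u (s - d)) v t = conv u v (t - d).
Proof.
  intros Hd Hu Hv.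
  assert (Hu' : pieces cont (fun s => u (s - d)))
    by (apply pieces_delay; auto using stable_cont).
  destruct (Rle_dec t d) as [H|H].
  - rewrite (conv_nonpos u) by (auto; lra).
    destruct (Rle_dec t 0); [now apply conv_nonpos|].
    apply RInt_eq0; [lra|]. intros s Hs. rewrite (pieces_neg _ _ (s - d) Hu) by lra. ring.
  - unfold conv.
    rewrite <- (RInt_Chasles_R _ 0 d t) by now apply (conv_integrable (fun s => u (s - d))).
    rewrite RInt_eq0; [|lra|intros s Hs; rewrite (pieces_neg _ _ (s - d) Hu) by lra; ring].
    set (f := fun s => u s * v (t - d - s)).
    assert (Hf : integrable f) by now apply conv_integrable.
    assert (E := RInt_comp_lin (V := R_CompleteNormedModule) f 1 (- d) d t (Hf _ _)).
    replace (1 * d + - d) with 0 in E by ring.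
    replace (1 * t + - d) with (t - d) in E by ring.
    rewrite <- E, Rplus_0_l. f_equal. apply functional_extensionality. intros s.
    unfold f, scal; simpl; unfold mult; simpl.
    replace (1 * s + - d) with (s - d) by ring.
    replace (t - d - (s - d)) with (t - s) by ring. ring.
Qed.

(** The convolution of [step x * h] and [step y * k] from the time [x + y] on; before
    it is zero. *)
Definition conv_core (h k : R -> R) (x y t : R) : R :=
  RInt (fun s => h s * k (t - s)) x (t - y).

Lemma conv_one h k x y t : 0 <= x -> 0 <= y -> cont h -> cont k ->
  conv (fun s => step x s * h s) (fun s => step y s * k s) t
  = step (x + y) t * conv_core h k x y t.
Proof.
  intros Hx Hy Hh Hk. unfold conv, conv_core.
  assert (Hi : integrable (fun s => step x s * h s * (step y (t - s) * k (t - s)))).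
  { apply (conv_integrable (fun s => step x s * h s) (fun s => step y s * k s));
      now apply pieces_one. }
  destruct (Rle_dec (x + y) t) as [H|H].
  - rewrite step_1 by exact H.
    rewrite <- (RInt_Chasles_R _ 0 x t Hi), <- (RInt_Chasles_R _ x (t - y) t Hi).
    rewrite (RInt_eq0 _ 0 x), (RInt_eq0 _ (t - y) t); try lra.
    + rewrite Rplus_0_l, Rplus_0_r, Rmult_1_l. apply RInt_eq; [lra|].
      intros s Hs. rewrite !step_1 by lra. ring.
    + intros s Hs. rewrite (step_0 y) by lra. ring.
    + intros s Hs. rewrite (step_0 x) by lra. ring.
  - rewrite (step_0 (x + y)) by lra. rewrite Rmult_0_l. apply RInt_zero.
    intros s Hs. destruct (Rle_dec x s).
    + rewrite (step_0 y) by lra. ring.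
    + rewrite (step_0 x) by lra. ring.
Qed.

(** Uniform continuity of [F] near [{c} x [a, b]]. *)
Lemma continuous_RInt_param (F : R -> R -> R) (a b c : R) : a <= b ->
  (forall t, a <= t <= b -> continuity_2d_pt F c t) ->
  (forall x, ex_RInt (F x) a b) ->
  continuous (fun x => RInt (F x) a b) c.
Proof.
  intros Hab HF Hi. apply continuity_pt_filterlim.
  intros eps Heps.
  assert (He : 0 < eps / (2 * (b - a + 1))).
  { apply Rdiv_lt_0_compat; lra. }
  destruct (uniform_continuity_2d_1d' F a b c HF (mkposreal _ He)) as [delta Hd].
  exists delta. split; [apply cond_pos|]. intros x [_ Hx].
  simpl in Hx |- *. unfold Rdist in *.
  apply Rabs_lt_between in Hx.
  assert (E : RInt (F x) a b - RInt (F c) a b = RInt (fun s => F x s - F c s) a b).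
  { symmetry. apply (RInt_minus (V := R_CompleteNormedModule)); apply Hi. }
  rewrite E.
  apply Rle_lt_trans with ((b - a) * (eps / (2 * (b - a + 1)))).
  - apply abs_RInt_le_const; [exact Hab| |].
    + apply (ex_RInt_minus (V := R_NormedModule)); apply Hi.
    + intros s Hs. apply Rlt_le.
      assert (Dp := cond_pos delta).
      apply (Hd s c s x); try lra. rewrite Rminus_diag, Rabs_R0. exact Dp.
  - apply Rmult_lt_reg_r with (2 * (b - a + 1)); [lra|].
    replace ((b - a) * (eps / (2 * (b - a + 1))) * (2 * (b - a + 1)))
      with ((b - a) * eps) by (field; lra).
    assert (0 <= (b - a) * eps) by (apply Rmult_le_pos; lra). lra.
Qed.

Lemma continuity_2d_comp (f : R -> R) (g : R -> R -> R) x y :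
  cont f -> continuity_2d_pt g x y -> continuity_2d_pt (fun u v => f (g u v)) x y.
Proof.
  intros Hf Hg. apply (continuity_1d_2d_pt_comp f g); [|exact Hg].
  apply continuity_pt_filterlim, Hf.
Qed.

Lemma continuity_2d_sub x y : continuity_2d_pt (fun u v => u - v) x y.
Proof.
  apply (continuity_2d_pt_minus (fun u _ => u) (fun _ v => v)).
  - apply continuity_2d_pt_id1.
  - apply continuity_2d_pt_id2.
Qed.

(** The substitution [s = (t - y - x) z + x] makes the domain of integration fixed. *)
Lemma conv_core_cont h k x y : cont h -> cont k -> cont (conv_core h k x y).
Proof.
  intros Hh Hk c.
  set (F := fun t s => (t - y - x) * (h ((t - y - x) * s + x) * k (t - ((t - y - x) * s + x)))).
  apply (continuous_ext (fun t => RInt (F t) 0 1)).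
  { intros t. unfold conv_core.
    assert (E := RInt_comp_lin (V := R_CompleteNormedModule)
       (fun s => h s * k (t - s)) (t - y - x) x 0 1).
    etransitivity; [apply E|].
    - apply integrable_cont, cont_mult; [exact Hh|now apply cont_reflect].
    - replace ((t - y - x) * 0 + x) with x by ring. replace ((t - y - x) * 1 + x) with (t - y) by ring. reflexivity. }
  assert (H1 : forall t s, continuity_2d_pt (fun t s => t - y - x) t s).
  { intros t s. apply (continuity_2d_pt_minus (fun t _ => t - y) (fun _ _ => x)).
    - apply (continuity_2d_pt_minus (fun t _ => t) (fun _ _ => y)).
      + apply continuity_2d_pt_id1.
      + apply continuity_2d_pt_const.
    - apply continuity_2d_pt_const. }
  assert (H2 : forall t s, continuity_2d_pt (fun t s => (t - y - x) * s + x) t s).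
  { intros t s. apply (continuity_2d_pt_plus (fun t s => (t - y - x) * s) (fun _ _ => x)).
    - apply (continuity_2d_pt_mult (fun t _ => t - y - x) (fun _ s => s)); [apply H1|].
      apply continuity_2d_pt_id2.
    - apply continuity_2d_pt_const. }
  assert (HF : forall t s, continuity_2d_pt F t s).
  { intros t s.
    apply (continuity_2d_pt_mult (fun t _ => t - y - x)
       (fun t s => h ((t - y - x) * s + x) * k (t - ((t - y - x) * s + x)))); [apply H1|].
    apply (continuity_2d_pt_mult (fun t s => h ((t - y - x) * s + x))
       (fun t s => k (t - ((t - y - x) * s + x)))).
    - apply continuity_2d_comp; auto.
    - apply (continuity_2d_comp k); auto.
      apply (continuity_2d_pt_minus (fun t _ => t)); auto using continuity_2d_pt_id1. }
  apply continuous_RInt_param; [lra|intros; apply HF|].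
  intros t. apply integrable_cont. intros s. unfold F.
  apply continuity_pt_filterlim.
  intros eps Heps. destruct (HF t s (mkposreal eps Heps)) as [d Hd].
  exists d. split; [apply cond_pos|]. intros z [_ Hz].
  apply Hd; [|exact Hz]. rewrite Rminus_diag, Rabs_R0. apply cond_pos.
Qed.

Lemma conv_core_derive h k x y t : cont h -> C1 k ->
  is_derive (conv_core h k x y) t
    (h (t - y) * k y + conv_core h (Derive k) x y t).
Proof.
  intros Hh Hk.
  assert (Hd : forall u s, is_derive (fun u => h s * k (u - s)) u (h s * Derive k (u - s))).
  { intros u s. auto_derive; [apply Hk|]. change (fun x : R => k x) with k. unfold Rminus. ring. }
  assert (HD : forall u s, Derive (fun u => h s * k (u - s)) u = h s * Derive k (u - s))
    by (intros; apply is_derive_unique, Hd).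
  assert (H2 : forall u s,
    continuity_2d_pt (fun u s => Derive (fun z => h s * k (z - s)) u) u s).
  { intros u s. apply (continuity_2d_pt_ext (fun u s => h s * Derive k (u - s))).
    { intros; symmetry; apply HD. }
    apply (continuity_2d_pt_mult (fun u s => h s) (fun u s => Derive k (u - s))).
    - apply (continuity_2d_comp h (fun u s => s)); auto using continuity_2d_pt_id2.
    - apply (continuity_2d_comp (Derive k) (fun u s => u - s)).
      + now apply C1_Derive_cont.
      + apply continuity_2d_sub. }
  assert (Hc : forall u, cont (fun s => h s * k (u - s))).
  { intros u. apply cont_mult; [exact Hh|]. now apply cont_reflect, C1_cont. }
  assert (Hi : forall u a b, ex_RInt (fun s => h s * k (u - s)) a b).
  { intros. now apply integrable_cont. }
  assert (G := is_derive_RInt_param_bound_comp_aux3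
    (fun u s => h s * k (u - s)) x (fun u => u - y) t 1).
  assert (E : h (t - y) * k y + conv_core h (Derive k) x y t =
    RInt (fun s => Derive (fun u => h s * k (u - s)) t) x (t - y)
      + h (t - y) * k (t - (t - y)) * 1).
  { unfold conv_core. replace (t - (t - y)) with y by ring.
    rewrite (RInt_ext (V := R_CompleteNormedModule)
       (fun s => Derive (fun u => h s * k (u - s)) t) (fun s => h s * Derive k (t - s))).
    - ring.
    - intros; apply HD. }
  rewrite E. apply G; clear G.
  - exists (mkposreal 1 Rlt_0_1). auto.
  - exists (mkposreal 1 Rlt_0_1). exists (mkposreal 1 Rlt_0_1). auto.
  - auto_derive; [exact I|ring].
  - exists (mkposreal 1 Rlt_0_1). exists (mkposreal 1 Rlt_0_1). intros u _ s _.
    eexists. apply Hd.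
  - intros s _. apply H2.
  - exists (mkposreal 1 Rlt_0_1). intros; apply H2.
  - apply continuity_pt_filterlim, Hc.
Qed.

Lemma conv_core_C1 h k x y : cont h -> C1 k -> C1 (conv_core h k x y).
Proof.
  intros Hh Hk.
  apply (C1_intro _ (fun t => h (t - y) * k y + conv_core h (Derive k) x y t)).
  - intros t. now apply conv_core_derive.
  - apply cont_plus.
    + apply cont_mult; [now apply cont_shift|apply cont_const].
    + apply conv_core_cont; [exact Hh|now apply C1_Derive_cont].
Qed.

(** One C1 factor is enough for the coefficients of the convolution to be C1. *)
Lemma conv_C1 u v : pieces cont u -> pieces C1 v -> pieces C1 (conv u v).
Proof.
  intros Hu Hv. induction Hv as [v E|v0 v y k Hv IH Hy Hk E].
  - apply pieces_nil. intros t. apply RInt_zero. intros s _. rewrite E. ring.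
  - assert (Ev : v = fun t => v0 t + 1 * (step y t * k t))
      by (apply functional_extensionality; intros t; rewrite E; ring).
    assert (Hk1 : pieces cont (fun t => step y t * k t))
      by (apply pieces_one; auto using C1_cont).
    apply (pieces_ext C1 (fun t => conv u v0 t + 1 * conv u (fun t => step y t * k t) t)).
    { intros t. rewrite Ev. symmetry. apply conv_lin_r; auto using pieces_C1_cont. }
    apply pieces_lin; [apply stable_C1|exact IH|].
    clear - Hu Hy Hk Hk1.
    induction Hu as [u E|u0 u x h Hu IH Hx Hh E].
    + apply pieces_nil. intros t. apply RInt_zero. intros s _. rewrite E. ring.
    + assert (Eu : u = fun t => u0 t + 1 * (step x t * h t))
        by (apply functional_extensionality; intros t; rewrite E; ring).
      apply (pieces_cons C1 (conv u0 (fun t => step y t * k t)) _ (x + y)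
               (conv_core h k x y)); [exact IH|lra|now apply conv_core_C1|].
      intros t. rewrite Eu, conv_lin_l, conv_one;
        auto using C1_cont, pieces_one. ring.
Qed.

Lemma conv_pieces u v : pieces cont u -> pieces C1 v -> pieces cont (conv u v).
Proof. intros. now apply pieces_C1_cont, conv_C1. Qed.

Lemma pieces_step0 : pieces C1 (step 0).
Proof.
  apply (pieces_ext C1 (fun t => step 0 t * 1)); [intros; ring|].
  apply pieces_one; [lra|apply C1_const].
Qed.

(** Convolution with the unit step, so that the algebra of convolutions applies to it;
    [primitiveE] is the formula by an integral. *)
Definition primitive (u : R -> R) : R -> R := conv u (step 0).

Lemma primitive_C1 u : pieces cont u -> pieces C1 (primitive u).
Proof. intros Hu. unfold primitive. apply conv_C1; [exact Hu|apply pieces_step0]. Qed.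

Lemma primitiveE u t : 0 <= t -> primitive u t = RInt u 0 t.
Proof.
  intros Ht. apply RInt_eq; [exact Ht|]. intros s Hs. rewrite step_1 by lra. ring.
Qed.

(** * Associativity of convolution with a primitive *)

Lemma conv_core_comm h k x y t : cont h -> cont k ->
  conv_core h k x y t = conv_core k h y x t.
Proof.
  intros Hh Hk. unfold conv_core.
  transitivity (RInt (fun s => h s * k (t - s)) (t - (t - x)) (t - y)).
  { now replace (t - (t - x)) with x by ring. }
  rewrite <- (RInt_reflect (fun s => h s * k (t - s)) t y (t - x)).
  - apply RInt_ext_R. intros s. replace (t - (t - s)) with s by ring. ring.
  - apply integrable_cont, cont_mult; [exact Hh|now apply cont_reflect].
Qed.

Lemma conv_core_start h k x y : conv_core h k x y (x + y) = 0.
Proof.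
  unfold conv_core. replace (x + y - y) with x by ring.
  apply RInt_zero. intros s. rewrite Rmin_left, Rmax_left by lra. lra.
Qed.

Lemma conv_core_1_derive h x s : cont h ->
  is_derive (conv_core h (fun _ => 1) x 0) s (h s).
Proof.
  intros Hh. evar_last; [apply conv_core_derive; auto using C1_const|].
  unfold conv_core. rewrite RInt_zero.
  - rewrite Rminus_0_r. simpl. ring.
  - intros z _. rewrite Derive_const. ring.
Qed.

(** Both sides vanish at [t = x + y] and have derivative [conv_core h k x y]. *)
Lemma conv_core_primitive h k x y t : cont h -> C1 k ->
  conv_core (conv_core h (fun _ => 1) x 0) k x y t
  = conv_core (conv_core h k x y) (fun _ => 1) (x + y) 0 t.
Proof.
  intros Hh Hk. set (P := conv_core h (fun _ => 1) x 0).
  assert (HdP : forall s, is_derive P s (h s)) by (intros; now apply conv_core_1_derive).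
  assert (HP : C1 P) by now apply (C1_intro _ h).
  assert (P0 : P x = 0) by (unfold P; rewrite <- (Rplus_0_r x) at 2; apply conv_core_start).
  rewrite conv_core_comm by auto using C1_cont.
  assert (Hd : forall s, is_derive (conv_core k P y x) s (conv_core h k x y s)).
  { intros s. evar_last; [apply conv_core_derive; auto using C1_cont|].
    rewrite P0, (conv_core_comm h k) by auto using C1_cont. simpl.
    replace (Derive P) with h; [ring|].
    apply functional_extensionality. intros z. symmetry. now apply is_derive_unique. }
  assert (Hc : cont (conv_core h k x y)) by auto using conv_core_cont, C1_cont.
  assert (H := is_RInt_derive (V := R_CompleteNormedModule) (conv_core k P y x)
     (conv_core h k x y) (x + y) t (fun s _ => Hd s) (fun s _ => Hc s)).
  apply is_RInt_unique in H.
  unfold conv_core at 2. rewrite Rminus_0_r.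
  rewrite (RInt_ext (V := R_CompleteNormedModule) _ (conv_core h k x y))
    by (intros; apply Rmult_1_r).
  rewrite H, (Rplus_comm x y), conv_core_start. unfold minus, plus, opp, zero; simpl. ring.
Qed.

Lemma primitive_lin u v c t : pieces cont u -> pieces cont v ->
  primitive (fun s => u s + c * v s) t = primitive u t + c * primitive v t.
Proof.
  intros Hu Hv. unfold primitive.
  apply conv_lin_l; auto using pieces_C1_cont, pieces_step0.
Qed.

Lemma conv_zero_l u v t : (forall s, u s = 0) -> conv u v t = 0.
Proof. intros E. apply RInt_zero. intros s _. rewrite E. ring. Qed.

Lemma conv_zero_r u v t : (forall s, v s = 0) -> conv u v t = 0.
Proof. intros E. apply RInt_zero. intros s _. rewrite E. ring. Qed.

Lemma primitive_zero u t : (forall s, u s = 0) -> primitive u t = 0.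
Proof. unfold primitive. apply conv_zero_l. Qed.

Lemma conv_one_fun h k x y : 0 <= x -> 0 <= y -> cont h -> cont k ->
  conv (fun s => step x s * h s) (fun s => step y s * k s)
  = fun t => step (x + y) t * conv_core h k x y t.
Proof. intros. apply functional_extensionality. intros t. now apply conv_one. Qed.

Lemma primitive_one h x : 0 <= x -> cont h ->
  primitive (fun s => step x s * h s)
  = fun t => step x t * conv_core h (fun _ => 1) x 0 t.
Proof.
  intros Hx Hh. unfold primitive.
  replace (step 0) with (fun s => step 0 s * 1)
    by (apply functional_extensionality; intros; ring).
  rewrite conv_one_fun by (auto using cont_const; lra).
  now rewrite Rplus_0_r.
Qed.

(** Associativity of convolution in the case where one factor is the unit step.  By
    bilinearity it is enough to compare single pieces. *)
Lemma primitive_conv u v t : pieces cont u -> pieces C1 v ->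
  primitive (conv u v) t = conv (primitive u) v t.
Proof.
  intros Hu Hv. revert t. induction Hv as [v E|v0 v y k Hv IH Hy Hk E]; intros t.
  - rewrite (conv_zero_r _ v) by exact E.
    apply primitive_zero. intros s. now apply conv_zero_r.
  - assert (Hk1 : pieces C1 (fun t => step y t * k t)) by now apply pieces_one.
    assert (Ev : v = fun t => v0 t + 1 * (step y t * k t))
      by (apply functional_extensionality; intros s; rewrite E; ring).
    assert (Huv : conv u v = fun t => conv u v0 t + 1 * conv u (fun t => step y t * k t) t).
    { apply functional_extensionality. intros s. rewrite Ev.
      apply conv_lin_r; auto using pieces_C1_cont. }
    rewrite Huv, primitive_lin by auto using conv_pieces.
    rewrite Ev, conv_lin_r by auto using pieces_C1_cont, primitive_C1.
    rewrite IH. do 2 f_equal. clear - Hu Hy Hk Hk1.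
    revert t. induction Hu as [u E|u0 u x h Hu IH Hx Hh E]; intros t.
    + rewrite (conv_zero_l (primitive u)).
      * apply primitive_zero. intros s. now apply conv_zero_l.
      * intros s. now apply primitive_zero.
    + assert (Hh1 : pieces cont (fun t => step x t * h t)) by now apply pieces_one.
      assert (Eu : u = fun t => u0 t + 1 * (step x t * h t))
        by (apply functional_extensionality; intros s; rewrite E; ring).
      set (v := fun t => step y t * k t) in *.
      assert (Huv : conv u v = fun t => conv u0 v t + 1 * conv (fun t => step x t * h t) v t).
      { apply functional_extensionality. intros s. rewrite Eu.
        apply conv_lin_l; auto using pieces_C1_cont. }
      assert (HPu : primitive u
         = fun t => primitive u0 t + 1 * primitive (fun t => step x t * h t) t).
      { apply functional_extensionality. intros s. rewrite Eu. now apply primitive_lin. }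
      rewrite Huv, HPu.
      rewrite primitive_lin, conv_lin_l by auto using conv_pieces, pieces_C1_cont, primitive_C1.
      rewrite IH. do 2 f_equal. unfold v.
      rewrite conv_one_fun, primitive_one, primitive_one, conv_one
        by (auto using C1_cont, C1_const, conv_core_C1, conv_core_cont; lra).
      f_equal. symmetry. now apply conv_core_primitive.
Qed.

(** * Bounds *)

Lemma cont_bounded h a b : cont h -> exists M, 0 <= M /\ forall t, a <= t <= b -> Rabs (h t) <= M.
Proof.
  intros Hh.
  destruct (bounded_continuity (K := R_AbsRing) (V := R_NormedModule) h a b) as [M HM].
  { intros t _. apply Hh. }
  exists (Rmax 0 M). split; [apply Rmax_l|]. intros t Ht.
  apply Rle_trans with M; [|apply Rmax_r]. apply Rlt_le, (HM t Ht).
Qed.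

Lemma C1_lipschitz_on h a b : C1 h ->
  exists L, 0 <= L /\ forall x y, a <= x <= b -> a <= y <= b ->
    Rabs (h x - h y) <= L * Rabs (x - y).
Proof.
  intros Hh. destruct (cont_bounded (Derive h) a b) as (L & L0 & HL).
  { now apply C1_Derive_cont. }
  exists L. split; [exact L0|]. intros x y Hx Hy.
  destruct (MVT_gen h y x (Derive h)) as (c & Hc & E).
  - intros z _. apply Derive_correct, Hh.
  - intros z _. now apply continuity_pt_filterlim, C1_cont.
  - rewrite E, Rabs_mult. apply Rmult_le_compat_r; [apply Rabs_pos|].
    apply HL. revert Hc. unfold Rmin, Rmax. destruct Rle_dec; lra.
Qed.

Lemma RInt_bound (f : R -> R) l r M : integrable f -> l <= r ->
  (forall t, l <= t <= r -> Rabs (f t) <= M) -> Rabs (RInt f l r) <= (r - l) * M.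
Proof. intros Hf Hlr H. apply abs_RInt_le_const; auto. Qed.

Lemma RInt_sub (f g : R -> R) l r : integrable f -> integrable g ->
  RInt (fun s => f s + -1 * g s) l r = RInt f l r - RInt g l r.
Proof.
  intros Hf Hg. rewrite RInt_plus_R; [|apply Hf|apply integrable_scal, Hg].
  rewrite RInt_scal_R by apply Hg.
  change (RInt f l r + -1 * RInt g l r = RInt f l r - RInt g l r :> R). ring.
Qed.

(** Between the times [x] and [z], a piece [step y * k] of [v] changes the convolution in
    two ways: the factor [k] is translated, and the end of the domain of integration
    moves.  Both effects are of order [z - x]. *)
Lemma conv_lipschitz T v : 0 <= T -> pieces C1 v ->
  exists L, 0 <= L /\ forall u B, pieces cont u -> (forall t, Rabs (u t) <= B) ->
    forall x y, 0 <= x <= T -> 0 <= y <= T ->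
    Rabs (conv u v x - conv u v y) <= L * B * Rabs (x - y).
Proof.
  intros HT Hv. induction Hv as [v E|v0 v y k Hv (L0 & L00 & HL0) Hy Hk E].
  - exists 0. split; [lra|]. intros u B Hu HB s t _ _.
    rewrite !(conv_zero_r _ v) by exact E. rewrite Rminus_diag, Rabs_R0. lra.
  - destruct (cont_bounded k 0 T (C1_cont _ Hk)) as (M & M0 & HM).
    destruct (C1_lipschitz_on k 0 T Hk) as (L1 & L10 & HL1).
    assert (HTL : 0 <= T * L1) by now apply Rmult_le_pos.
    exists (L0 + (T * L1 + M)). split; [lra|].
    intros u B Hu HB.
    assert (HB0 : 0 <= B) by (eapply Rle_trans; [apply Rabs_pos|apply (HB 0)]).
    assert (Hk1 : pieces cont (fun t => step y t * k t))
      by (apply pieces_one; auto using C1_cont).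
    assert (Ev : v = fun t => v0 t + 1 * (step y t * k t))
      by (apply functional_extensionality; intros s; rewrite E; ring).
    (* Beyond the cut-off [Rmax 0 (t - y)] the factor [step y (t - s)] vanishes. *)
    assert (Hcut : forall t, 0 <= t -> conv u (fun t => step y t * k t) t
               = RInt (fun s => u s * k (t - s)) 0 (Rmax 0 (t - y))).
    { intros t Ht. unfold conv.
      assert (Hm : 0 <= Rmax 0 (t - y) <= t)
        by (unfold Rmax; destruct Rle_dec; lra).
      rewrite <- (RInt_Chasles_R _ 0 (Rmax 0 (t - y)) t)
        by now apply (conv_integrable u (fun t => step y t * k t)).
      rewrite (RInt_eq0 _ (Rmax 0 (t - y)) t); [|lra|].
      - rewrite Rplus_0_r. apply RInt_eq; [lra|]. intros s Hs.
        rewrite step_1; [ring|]. revert Hs. unfold Rmax. destruct Rle_dec; lra.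
      - intros s Hs. rewrite step_0; [ring|].
        assert (t - y <= Rmax 0 (t - y)) by apply Rmax_r. lra. }
    assert (Hi : forall t, integrable (fun s => u s * k (t - s))).
    { intros t. apply (integrable_ext (fun s => k (t - s) * u s)); [intros; ring|].
      apply (multiplier_of_pieces u Hu (fun s => k (t - s))).
      now apply cont_reflect, C1_cont. }
    assert (Hle : forall x z, 0 <= x <= z -> z <= T ->
      Rabs (conv u (fun t => step y t * k t) z - conv u (fun t => step y t * k t) x)
      <= (T * L1 + M) * B * (z - x)).
    { intros x z Hx Hz. rewrite !Hcut by lra.
      assert (Hax := Rmax_l 0 (x - y)). assert (Haz : x - y <= Rmax 0 (x - y)) by apply Rmax_r.
      set (a := Rmax 0 (x - y)) in *. set (b := Rmax 0 (z - y)).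
      assert (Hab : a <= b <= a + (z - x) /\ b <= z /\ a <= x).
      { unfold a, b, Rmax. repeat destruct Rle_dec; lra. }
      rewrite <- (RInt_Chasles_R _ 0 a b (Hi z)).
      replace (RInt (fun s => u s * k (z - s)) 0 a + RInt (fun s => u s * k (z - s)) a b
               - RInt (fun s => u s * k (x - s)) 0 a)
        with ((RInt (fun s => u s * k (z - s)) 0 a - RInt (fun s => u s * k (x - s)) 0 a)
              + RInt (fun s => u s * k (z - s)) a b) by ring.
      replace (RInt (fun s => u s * k (z - s)) 0 a - RInt (fun s => u s * k (x - s)) 0 a)
        with (RInt (fun s => u s * k (z - s) + -1 * (u s * k (x - s))) 0 a).
      2:{ apply RInt_sub; apply Hi. }
      eapply Rle_trans; [apply Rabs_triang|].
      assert (H1 : Rabs (RInt (fun s => u s * k (z - s) + -1 * (u s * k (x - s))) 0 a)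
                   <= (a - 0) * (B * (L1 * (z - x)))).
      { apply RInt_bound; [|lra|].
        - apply integrable_plus; [apply Hi|apply integrable_scal, Hi].
        - intros s Hs.
          replace (u s * k (z - s) + -1 * (u s * k (x - s)))
            with (u s * (k (z - s) - k (x - s))) by ring.
          rewrite Rabs_mult. apply Rmult_le_compat; auto using Rabs_pos.
          replace (z - x) with (Rabs ((z - s) - (x - s)))
            by (rewrite Rabs_pos_eq; lra).
          apply HL1; lra. }
      assert (H2 : Rabs (RInt (fun s => u s * k (z - s)) a b) <= (b - a) * (B * M)).
      { apply RInt_bound; [apply Hi|lra|]. intros s Hs. rewrite Rabs_mult.
        apply Rmult_le_compat; auto using Rabs_pos. apply HM; lra. }
      assert (BL : 0 <= B * (L1 * (z - x))) by (repeat apply Rmult_le_pos; lra).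
      assert (BM : 0 <= B * M) by (apply Rmult_le_pos; lra).
      assert ((a - 0) * (B * (L1 * (z - x))) <= T * (B * (L1 * (z - x))))
        by (apply Rmult_le_compat_r; lra).
      assert ((b - a) * (B * M) <= (z - x) * (B * M)) by (apply Rmult_le_compat_r; lra).
      lra. }
    intros x z Hx Hz.
    rewrite Ev, !conv_lin_r by auto using pieces_C1_cont.
    replace (conv u v0 x + 1 * conv u (fun t => step y t * k t) x -
             (conv u v0 z + 1 * conv u (fun t => step y t * k t) z))
      with ((conv u v0 x - conv u v0 z)
            + (conv u (fun t => step y t * k t) x - conv u (fun t => step y t * k t) z)) by ring.
    eapply Rle_trans; [apply Rabs_triang|].
    assert (H1 := HL0 u B Hu HB x z Hx Hz).
    assert (H2 : Rabs (conv u (fun t => step y t * k t) x - conv u (fun t => step y t * k t) z)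
                 <= (T * L1 + M) * B * Rabs (x - z)).
    { destruct (Rle_dec x z) as [H|H].
      - rewrite (Rabs_minus_sym x z), Rabs_minus_sym, (Rabs_pos_eq (z - x)) by lra.
        apply Hle; lra.
      - rewrite (Rabs_pos_eq (x - z)) by lra. apply Hle; lra. }
    lra.
Qed.

(** * Exceptional points *)

(** By induction on the exceptional points: the interval is split at each of them. *)
Lemma is_RInt_agree S (f g : R -> R) l r : l <= r ->
  (forall t, l < t < r -> ~ In t S -> f t = g t) -> integrable f ->
  is_RInt g l r (RInt f l r).
Proof.
  intros Hlr Heq Hf. revert l r Hlr Heq.
  induction S as [|p S IH]; intros l r Hlr Heq.
  - apply (is_RInt_ext f).
    + intros t. rewrite Rmin_left, Rmax_right by lra. intros Ht. apply Heq; auto.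
    + apply (RInt_correct (V := R_CompleteNormedModule)), Hf.
  - destruct (Rlt_dec l p) as [Hl|Hl]; [destruct (Rlt_dec p r) as [Hr|Hr]|].
    + rewrite <- (RInt_Chasles_R f l p r Hf).
      apply (is_RInt_Chasles (V := R_NormedModule) g l p r); apply IH; try lra.
      * intros t Ht HS. apply Heq; [lra|]. intros [->|H]; [lra|auto].
      * intros t Ht HS. apply Heq; [lra|]. intros [->|H]; [lra|auto].
    + apply IH; [exact Hlr|]. intros t Ht HS. apply Heq; [lra|]. intros [->|H]; [lra|auto].
    + apply IH; [exact Hlr|]. intros t Ht HS. apply Heq; [lra|]. intros [->|H]; [lra|auto].
Qed.

Lemma RInt_agree S (f g : R -> R) l r : l <= r ->
  (forall t, l < t < r -> ~ In t S -> f t = g t) -> integrable f ->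
  RInt g l r = RInt f l r.
Proof. intros. now apply is_RInt_unique, (is_RInt_agree S). Qed.

(** * Piecewise C1 functions on an interval *)

(** Inductive form of [piecewise_C1]: the pieces are listed from left to right. *)
Inductive pw : R -> R -> (R -> R) -> Prop :=
| pw_nil l u : pw l l u
| pw_cons l m r u h : l < m -> C1 h -> (forall t, l < t < m -> u t = h t) ->
    pw m r u -> pw l r u.

Lemma pw_of_piecewise l r u : piecewise_C1 l r u -> pw l r u.
Proof.
  intros (n & x & <- & <- & Hx). revert x Hx.
  induction n as [|n IH]; intros x Hx; [constructor|].
  destruct (Hx O) as (H01 & h & Hh & E); [lia|].
  apply (pw_cons _ (x 1%nat) _ _ h); auto.
  apply (IH (fun i => x (S i))). intros i Hi. apply Hx. lia.
Qed.

Lemma piecewise_of_pw l r u : pw l r u -> piecewise_C1 l r u.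
Proof.
  intros H. induction H as [l u|l m r u h Hlm Hh E H (n & x & x0 & xn & Hx)].
  - exists O, (fun _ => l). repeat split; auto; lia.
  - exists (S n), (fun i => match i with O => l | S j => x j end).
    split; [reflexivity|]. split; [exact xn|].
    intros [|i] Hi.
    + rewrite x0. split; [exact Hlm|]. now exists h.
    + apply Hx. lia.
Qed.

Lemma pw_le l r u : pw l r u -> l <= r.
Proof. intros H. induction H; lra. Qed.

Lemma pw_add l r u v h : pw l r u -> C1 h ->
  (forall t, l < t < r -> v t = u t + h t) -> pw l r v.
Proof.
  intros H Hh. induction H as [l u|l m r u k Hlm Hk E H IH]; intros Ev; [constructor|].
  assert (Hmr := pw_le _ _ _ H).
  apply (pw_cons l m r v (fun t => k t + h t)); auto using C1_plus.
  - intros t Ht. rewrite Ev, E by lra. reflexivity.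
  - apply IH. intros t Ht. apply Ev. lra.
Qed.

Lemma pw_ext l r u v : pw l r u -> (forall t, l < t < r -> v t = u t) -> pw l r v.
Proof.
  intros H E. apply (pw_add l r u v (fun _ => 0)); auto using C1_const.
  intros t Ht. rewrite E by lra. ring.
Qed.

Lemma pw_cat l m r u : pw l m u -> pw m r u -> pw l r u.
Proof.
  intros H H'. induction H as [l u|l m0 m u k Hlm Hk E H IH]; [exact H'|].
  apply (pw_cons l m0 r u k); auto.
Qed.

Lemma pw_split l m r u : pw l r u -> l <= m <= r -> pw l m u /\ pw m r u.
Proof.
  intros H. induction H as [l u|l x r u k Hlx Hk E H IH]; intros Hm.
  - replace m with l by lra. split; constructor.
  - destruct (Rle_dec x m) as [Hxm|Hxm].
    + destruct IH as [IH1 IH2]; [lra|]. split; [|exact IH2].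
      now apply (pw_cons l x m u k).
    + split.
      * destruct (Req_dec l m) as [<-|Hne]; [constructor|].
        apply (pw_cons l m m u k); auto; [lra| |constructor].
        intros t Ht. apply E. lra.
      * apply (pw_cons m x r u k); auto; [lra|]. intros t Ht. apply E. lra.
Qed.

(** An exceptional point in the interior becomes a new break point. *)
Lemma pw_agree S l r u v : pw l r u ->
  (forall t, l < t < r -> ~ In t S -> v t = u t) -> pw l r v.
Proof.
  revert l r. induction S as [|p S IH]; intros l r H E.
  - apply (pw_ext l r u); auto.
  - destruct (Rlt_dec l p) as [Hl|Hl]; [destruct (Rlt_dec p r) as [Hr|Hr]|].
    + destruct (pw_split l p r u H) as [H1 H2]; [lra|].
      apply (pw_cat l p r v); apply IH; auto; intros t Ht HS; apply E; try lra;
        intros [->|HI]; auto; lra.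
    + apply IH; auto. intros t Ht HS. apply E; [lra|]. intros [->|HI]; auto; lra.
    + apply IH; auto. intros t Ht HS. apply E; [lra|]. intros [->|HI]; auto; lra.
Qed.

Lemma pw_of_pieces l r u : l <= r -> pieces C1 u -> pw l r u.
Proof.
  intros Hlr H. induction H as [u E|u v x h Hu IH Hx Hh E].
  - destruct (Req_dec l r) as [<-|Hne]; [constructor|].
    apply (pw_cons l r r u (fun _ => 0)); auto using C1_const, pw_nil. lra.
  - destruct (Rle_dec x l) as [Hl|Hl]; [|destruct (Rle_dec r x) as [Hr|Hr]].
    + apply (pw_add l r u v h); auto. intros t Ht. rewrite E, step_1 by lra. ring.
    + apply (pw_ext l r u v); auto. intros t Ht. rewrite E, step_0 by lra. ring.
    + destruct (pw_split l x r u IH) as [H1 H2]; [lra|]. apply (pw_cat l x r v).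
      * apply (pw_ext l x u v); auto. intros t Ht. rewrite E, step_0 by lra. ring.
      * apply (pw_add x r u v h); auto. intros t Ht. rewrite E, step_1 by lra. ring.
Qed.

(** A piece [h] on [(l, m)] is encoded as [step l * h - step m * h]. *)
Lemma pieces_of_pw l r u : 0 <= l -> pw l r u ->
  exists v S, pieces C1 v /\ (forall t, t < l -> v t = 0) /\
    (forall t, r <= t -> v t = 0) /\
    forall t, l <= t < r -> ~ In t S -> u t = v t.
Proof.
  intros Hl H. induction H as [l u|l m r u h Hlm Hh E H IH].
  - exists (fun _ => 0), nil. split; [now apply pieces_nil|].
    repeat split; auto. intros t Ht. lra.
  - destruct IH as (v & S & Hv & V0 & V1 & EV); [lra|].
    assert (Hmr := pw_le _ _ _ H).
    exists (fun t => v t + (step l t * h t + -1 * (step m t * h t))), (l :: S).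
    split; [|split; [|split]].
    + apply pieces_plus; [exact Hv|].
      apply pieces_lin; auto using stable_C1; apply pieces_one; auto; lra.
    + intros t Ht. rewrite V0, !step_0 by lra. ring.
    + intros t Ht. rewrite V1, !step_1 by lra. ring.
    + intros t Ht HS. rewrite (step_1 l) by lra. destruct (Rlt_dec t m) as [Htm|Htm].
      * rewrite V0, step_0, E; try lra.
        assert (l <> t) by (intros ->; apply HS; now left). lra.
      * rewrite step_1 by lra. rewrite EV; [ring|lra|]. intros HI. apply HS. now right.
Qed.

(** * Inversion of the delay operator *)

Lemma lipschitz_cont L u : lipschitz L u -> cont u.
Proof.
  intros H t. apply continuity_pt_filterlim. intros eps Heps.
  assert (HL : 0 < Rabs L + 1) by (assert (HP := Rabs_pos L); lra).
  exists (eps / (Rabs L + 1)). split; [now apply Rdiv_lt_0_compat|].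
  intros x [_ Hx]. simpl in *. unfold Rdist in *.
  apply Rle_lt_trans with (1 := H x t).
  apply Rle_lt_trans with (Rabs L * Rabs (x - t)).
  { apply Rmult_le_compat_r; [apply Rabs_pos|apply Rle_abs]. }
  apply Rle_lt_trans with ((Rabs L + 1) * Rabs (x - t)).
  { assert (HP := Rabs_pos (x - t)). lra. }
  apply Rmult_lt_reg_r with (/ (Rabs L + 1)); [now apply Rinv_0_lt_compat|].
  replace ((Rabs L + 1) * Rabs (x - t) * / (Rabs L + 1)) with (Rabs (x - t))
    by (field; lra). exact Hx.
Qed.

Lemma anchored_pieces T u : anchored T u -> pieces cont u.
Proof.
  intros (H0 & _ & L & HL). apply (pieces_ext cont (fun t => step 0 t * u t)).
  - intros t. destruct (Rle_dec 0 t).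
    + rewrite step_1 by lra. ring.
    + rewrite H0 by lra. ring.
  - apply pieces_one; [lra|]. now apply (lipschitz_cont L).
Qed.

Definition clamp (T t : R) : R := Rmax 0 (Rmin T t).

Lemma clamp_range T t : 0 <= T -> 0 <= clamp T t <= T.
Proof. intros HT. unfold clamp, Rmax, Rmin. repeat destruct Rle_dec; lra. Qed.

Lemma clamp_id T t : 0 <= t <= T -> clamp T t = t.
Proof. intros Ht. unfold clamp, Rmax, Rmin. repeat destruct Rle_dec; lra. Qed.

Lemma clamp_lo T t : 0 <= T -> t <= 0 -> clamp T t = 0.
Proof. intros HT Ht. unfold clamp, Rmax, Rmin. repeat destruct Rle_dec; lra. Qed.

Lemma clamp_hi T t : 0 <= T -> T <= t -> clamp T t = T.
Proof. intros HT Ht. unfold clamp, Rmax, Rmin. repeat destruct Rle_dec; lra. Qed.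

Lemma clamp_lipschitz T x y : 0 <= T -> Rabs (clamp T x - clamp T y) <= Rabs (x - y).
Proof.
  intros HT. unfold clamp, Rmax, Rmin. repeat destruct Rle_dec;
  unfold Rabs; repeat destruct Rcase_abs; lra.
Qed.

Definition trunc (y : R) (u : R -> R) (t : R) : R := u t - step y t * u t.

Lemma trunc_lt y u t : t < y -> trunc y u t = u t.
Proof. intros H. unfold trunc. rewrite step_0 by lra. ring. Qed.

Lemma trunc_ge y u t : y <= t -> trunc y u t = 0.
Proof. intros H. unfold trunc. rewrite step_1 by lra. ring. Qed.

Lemma pieces_trunc P y u : stable P -> 0 <= y -> pieces P u -> pieces P (trunc y u).
Proof.
  intros HP Hy Hu. apply (pieces_ext P (fun t => u t + -1 * (step y t * u t))).
  - intros t. unfold trunc. ring.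
  - apply pieces_lin; auto using pieces_step.
Qed.

Section Operators.

Context (tau0 tau1 a b : R) (n : nat).
Context (Htau0 : 0 < tau0) (Htau1 : tau0 <= tau1) (Ha : -1 < a < 1) (Hb : b <> 0).
Context (Hn : tau1 <= INR n * tau0).

Let T := tau0 + tau1.

(** The part of the equation without integrals, with [f] and [g] extended by zero. *)
Definition delay_part (f g : R -> R) (t : R) : R :=
  g t - a * g (t - tau0) + b * f (t - tau1).

(** Together [inv_f] and [inv_g] invert [delay_part].  Before [tau1] the equation is
    [g = u + a g(. - tau0)], which unfolds into a sum that stops as soon as
    [n tau0 >= tau1]. *)
Definition inv_g (u : R -> R) : R -> R :=
  trunc tau1 (fun t => rsum n (fun k => a ^ k * u (t - INR k * tau0))).

(** From [tau1] on, [g] vanishes and the equation gives [f]. *)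
Definition inv_f (u : R -> R) : R -> R :=
  trunc tau0 (fun t => step 0 t *
    (/ b * u (t - - tau1) + a / b * inv_g u (t - (tau0 - tau1)))).

Lemma inv_g_pieces P u : stable P -> pieces P u -> pieces P (inv_g u).
Proof.
  intros HP Hu. apply pieces_trunc; [exact HP|lra|].
  clear Hn. induction n as [|k IH]; simpl.
  - now apply pieces_nil.
  - apply (pieces_plus P (fun t => rsum k (fun j => a ^ j * u (t - INR j * tau0)))); auto.
    apply (pieces_scal P (fun t => u (t - INR k * tau0))); auto.
    apply pieces_delay; auto. apply Rmult_le_pos; [apply pos_INR|lra].
Qed.

Lemma inv_f_pieces P u : stable P -> pieces P u -> pieces P (inv_f u).
Proof.
  intros HP Hu. apply pieces_trunc; [exact HP|lra|].
  apply (pieces_ext P (fun t => / b * (step 0 t * u (t - - tau1))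
            + a / b * (step 0 t * inv_g u (t - (tau0 - tau1))))).
  - intros t. ring.
  - apply (pieces_plus P (fun t => / b * (step 0 t * u (t - - tau1)))).
    + apply (pieces_scal P (fun t => step 0 t * u (t - - tau1))); auto using pieces_shift.
    + apply (pieces_scal P (fun t => step 0 t * inv_g u (t - (tau0 - tau1))));
        auto using pieces_shift, inv_g_pieces.
Qed.

Lemma inv_g_ge u t : tau1 <= t -> inv_g u t = 0.
Proof. apply trunc_ge. Qed.

Lemma inv_f_ge u t : tau0 <= t -> inv_f u t = 0.
Proof. apply trunc_ge. Qed.

Lemma inv_g_lin u v c t : inv_g (fun s => u s + c * v s) t = inv_g u t + c * inv_g v t.
Proof.
  unfold inv_g, trunc.
  rewrite (rsum_ext n (fun k => a ^ k * (u (t - INR k * tau0) + c * v (t - INR k * tau0)))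
    (fun k => a ^ k * u (t - INR k * tau0) + c * (a ^ k * v (t - INR k * tau0))))
    by (intros; ring).
  rewrite rsum_lin. ring.
Qed.

Lemma inv_f_lin u v c t : inv_f (fun s => u s + c * v s) t = inv_f u t + c * inv_f v t.
Proof. unfold inv_f, trunc. rewrite inv_g_lin. ring. Qed.

Lemma inv_g_0 t : inv_g (fun _ => 0) t = 0.
Proof. exact (additive_0 (fun u => inv_g u t) (inv_g_lin _ _ (-1) t)). Qed.

Lemma inv_f_0 t : inv_f (fun _ => 0) t = 0.
Proof. exact (additive_0 (fun u => inv_f u t) (inv_f_lin _ _ (-1) t)). Qed.

Lemma inv_g_neg u t : (forall s, s < 0 -> u s = 0) -> t < 0 -> inv_g u t = 0.
Proof.
  intros Hu Ht. unfold inv_g. rewrite trunc_lt by lra. apply rsum_0.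
  intros k _. rewrite Hu; [ring|].
  assert (0 <= INR k * tau0) by (apply Rmult_le_pos; [apply pos_INR|lra]). lra.
Qed.

Lemma inv_f_neg u t : t < 0 -> inv_f u t = 0.
Proof.
  intros Ht. unfold inv_f. rewrite trunc_lt by lra. rewrite step_0 by lra. ring.
Qed.

Lemma inv_g_rec u t : (forall s, s < 0 -> u s = 0) -> t < tau1 ->
  inv_g u t = u t + a * inv_g u (t - tau0).
Proof.
  intros Hu Ht. unfold inv_g. rewrite !trunc_lt by lra.
  pose (x := fun k => a ^ k * u (t - INR k * tau0)).
  assert (E := rsum_telescope n x).
  assert (Ex : x n = 0) by (unfold x; rewrite Hu by lra; ring).
  assert (E0 : x O = u t) by (unfold x; simpl; rewrite Rmult_0_l, Rminus_0_r; ring).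
  rewrite <- rsum_scal.
  rewrite (rsum_ext n (fun i => x (S i) - x i) (fun i => x (S i) + -1 * x i)) in E
    by (intros; ring).
  rewrite rsum_lin, Ex, E0 in E.
  rewrite (rsum_ext n (fun i => a * (a ^ i * u (t - tau0 - INR i * tau0)))
    (fun i => x (S i))).
  - change (rsum n (fun k => a ^ k * u (t - INR k * tau0))) with (rsum n x). lra.
  - intros i _. unfold x. rewrite S_INR.
    replace (t - tau0 - INR i * tau0) with (t - (INR i + 1) * tau0) by ring.
    simpl. ring.
Qed.

Lemma delay_part_inv u t : (forall s, s < 0 -> u s = 0) -> t < T ->
  delay_part (inv_f u) (inv_g u) t = u t.
Proof.
  intros Hu Ht. unfold delay_part, T in *. destruct (Rlt_dec t tau1) as [H|H].
  - rewrite inv_f_neg, (inv_g_rec u t) by (auto; lra). ring.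
  - rewrite inv_g_ge by lra. unfold inv_f. rewrite trunc_lt, step_1 by lra.
    replace (t - tau1 - - tau1) with t by ring.
    replace (t - tau1 - (tau0 - tau1)) with (t - tau0) by ring.
    field. exact Hb.
Qed.

Section Inverse.

Context (u f g : R -> R) (Hu : forall s, s < 0 -> u s = 0).
Context (Hf0 : forall t, t < 0 -> f t = 0) (Hf1 : forall t, tau0 <= t -> f t = 0).
Context (Hg0 : forall t, t < 0 -> g t = 0) (Hg1 : forall t, tau1 <= t -> g t = 0).
Context (HE : forall t, 0 <= t < T -> delay_part f g t = u t).

Lemma inv_g_unique t : inv_g u t = g t.
Proof.
  destruct (Rle_dec tau1 t) as [H|H].
  { rewrite inv_g_ge, Hg1 by lra. reflexivity. }
  assert (Hrec : forall s, s < tau1 -> g s = u s + a * g (s - tau0)).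
  { intros s Hs. destruct (Rlt_dec s 0) as [H0|H0].
    - rewrite Hu, !Hg0 by lra. ring.
    - rewrite <- HE by (unfold T; lra). unfold delay_part. rewrite Hf0 by lra. ring. }
  assert (Hm : forall m, g t = rsum m (fun k => a ^ k * u (t - INR k * tau0))
                              + a ^ m * g (t - INR m * tau0)).
  { induction m as [|m IH].
    - simpl. rewrite Rmult_0_l, Rminus_0_r. ring.
    - rewrite IH, (Hrec (t - INR m * tau0)).
      + rewrite S_INR. simpl.
        replace (t - (INR m + 1) * tau0) with (t - INR m * tau0 - tau0) by ring. ring.
      + assert (0 <= INR m * tau0) by (apply Rmult_le_pos; [apply pos_INR|lra]). lra. }
  unfold inv_g. rewrite trunc_lt by lra. rewrite (Hm n), (Hg0 (t - INR n * tau0)) by lra.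
  ring.
Qed.

Lemma inv_f_unique t : inv_f u t = f t.
Proof.
  destruct (Rle_dec tau0 t) as [H|H]; [rewrite inv_f_ge, Hf1 by lra; reflexivity|].
  destruct (Rlt_dec t 0) as [H0|H0]; [rewrite inv_f_neg, Hf0 by lra; reflexivity|].
  unfold inv_f. rewrite trunc_lt, step_1 by lra. rewrite inv_g_unique.
  replace (t - - tau1) with (t + tau1) by ring.
  rewrite <- HE by (unfold T; lra). unfold delay_part.
  rewrite (Hg1 (t + tau1)) by lra.
  replace (t + tau1 - tau1) with t by ring.
  replace (t - (tau0 - tau1)) with (t + tau1 - tau0) by ring. field. exact Hb.
Qed.

End Inverse.

Lemma inv_g_bound u M t : (forall s, Rabs (u s) <= M) -> Rabs (inv_g u t) <= INR n * M.
Proof.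
  intros HM.
  assert (M0 : 0 <= M) by (eapply Rle_trans; [apply Rabs_pos|apply (HM 0)]).
  destruct (Rle_dec tau1 t) as [H|H].
  - rewrite inv_g_ge, Rabs_R0 by lra. apply Rmult_le_pos; [apply pos_INR|lra].
  - unfold inv_g. rewrite trunc_lt by lra. apply rsum_abs. intros k _.
    rewrite Rabs_mult, <- RPow_abs, <- (Rmult_1_l M).
    apply Rmult_le_compat; auto using Rabs_pos.
    + apply pow_le, Rabs_pos.
    + rewrite <- (pow1 k). apply pow_incr. split; [apply Rabs_pos|].
      apply Rabs_le. lra.
Qed.

Lemma inv_f_bound u M t : (forall s, Rabs (u s) <= M) ->
  Rabs (inv_f u t) <= Rabs (/ b) * (1 + INR n) * M.
Proof.
  intros HM.
  assert (M0 : 0 <= M) by (eapply Rle_trans; [apply Rabs_pos|apply (HM 0)]).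
  assert (Hi := Rabs_pos (/ b)). assert (HN := pos_INR n).
  assert (H0 : 0 <= Rabs (/ b) * (1 + INR n) * M)
    by (repeat apply Rmult_le_pos; lra).
  destruct (Rle_dec tau0 t) as [H|H]; [rewrite inv_f_ge, Rabs_R0 by lra; exact H0|].
  destruct (Rlt_dec t 0) as [H1|H1]; [rewrite inv_f_neg, Rabs_R0 by lra; exact H0|].
  unfold inv_f. rewrite trunc_lt, step_1 by lra.
  replace (1 * (/ b * u (t - - tau1) + a / b * inv_g u (t - (tau0 - tau1))))
    with (/ b * (u (t - - tau1) + a * inv_g u (t - (tau0 - tau1)))) by (field; exact Hb).
  rewrite Rabs_mult, Rmult_assoc. apply Rmult_le_compat_l; [exact Hi|].
  eapply Rle_trans; [apply Rabs_triang|]. rewrite Rabs_mult.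
  assert (H2 := HM (t - - tau1)).
  assert (H3 := inv_g_bound u M (t - (tau0 - tau1)) HM).
  assert (H4 : Rabs a * Rabs (inv_g u (t - (tau0 - tau1))) <= 1 * (INR n * M)).
  { apply Rmult_le_compat; auto using Rabs_pos. apply Rabs_le. lra. }
  lra.
Qed.

Lemma inv_g_local u v t : (forall s, s < T -> u s = v s) -> inv_g u t = inv_g v t.
Proof.
  intros H. destruct (Rle_dec tau1 t) as [H1|H1]; [now rewrite !inv_g_ge by lra|].
  unfold inv_g. rewrite !trunc_lt by lra. apply rsum_ext. intros k _.
  rewrite H; [reflexivity|].
  assert (0 <= INR k * tau0) by (apply Rmult_le_pos; [apply pos_INR|lra]).
  unfold T. lra.
Qed.

Lemma inv_f_local u v t : (forall s, s < T -> u s = v s) -> inv_f u t = inv_f v t.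
Proof.
  intros H. destruct (Rle_dec tau0 t) as [H1|H1]; [now rewrite !inv_f_ge by lra|].
  unfold inv_f. rewrite !trunc_lt by lra. rewrite (inv_g_local u v) by exact H.
  rewrite H by (unfold T; lra). reflexivity.
Qed.

Context (N M : R -> R) (HN : pieces C1 N) (HM : pieces C1 M).

Definition kernel_part (f g : R -> R) (t : R) : R := conv g N t - conv f M t.

(** The argument is clamped to [0, T] so that the value is [anchored]. *)
Definition reduced_op (u : R -> R) (t : R) : R := kernel_part (inv_f u) (inv_g u) (clamp T t).

Lemma kernel_part_lin f g f' g' c t :
  pieces cont f -> pieces cont g -> pieces cont f' -> pieces cont g' ->
  kernel_part (fun s => f s + c * f' s) (fun s => g s + c * g' s) t
  = kernel_part f g t + c * kernel_part f' g' t.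
Proof.
  intros. unfold kernel_part.
  rewrite !conv_lin_l by auto using pieces_C1_cont. ring.
Qed.

Lemma kernel_part_lipschitz : exists L, 0 <= L /\
  forall f g B, pieces cont f -> pieces cont g ->
    (forall t, Rabs (f t) <= B) -> (forall t, Rabs (g t) <= B) ->
    lipschitz (L * B) (fun t => kernel_part f g (clamp T t)).
Proof.
  assert (HT : 0 <= T) by (unfold T; lra).
  destruct (conv_lipschitz T N HT HN) as (LN & LN0 & HLN).
  destruct (conv_lipschitz T M HT HM) as (LM & LM0 & HLM).
  exists (LN + LM). split; [lra|]. intros f g B Hf Hg HfB HgB x y.
  assert (B0 : 0 <= B) by (eapply Rle_trans; [apply Rabs_pos|apply (HfB 0)]).
  unfold kernel_part.
  assert (H1 := HLN g B Hg HgB _ _ (clamp_range T x HT) (clamp_range T y HT)).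
  assert (H2 := HLM f B Hf HfB _ _ (clamp_range T x HT) (clamp_range T y HT)).
  assert (Hc := clamp_lipschitz T x y HT).
  assert (H3 : (LN + LM) * B * Rabs (clamp T x - clamp T y) <= (LN + LM) * B * Rabs (x - y)).
  { apply Rmult_le_compat_l; [apply Rmult_le_pos; lra|exact Hc]. }
  replace (conv g N (clamp T x) - conv f M (clamp T x)
           - (conv g N (clamp T y) - conv f M (clamp T y)))
    with ((conv g N (clamp T x) - conv g N (clamp T y))
          - (conv f M (clamp T x) - conv f M (clamp T y))) by ring.
  eapply Rle_trans; [apply Rabs_triang|]. rewrite Rabs_Ropp. lra.
Qed.

Lemma kernel_part_anchored f g B : pieces cont f -> pieces cont g ->
  (forall t, Rabs (f t) <= B) -> (forall t, Rabs (g t) <= B) ->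
  anchored T (fun t => kernel_part f g (clamp T t)).
Proof.
  assert (HT : 0 <= T) by (unfold T; lra).
  intros Hf Hg HfB HgB. split; [|split].
  - intros t Ht. rewrite clamp_lo by auto. unfold kernel_part.
    rewrite !conv_nonpos by (auto; lra). ring.
  - intros t Ht. rewrite !(clamp_hi T) by (auto; lra). reflexivity.
  - destruct kernel_part_lipschitz as (L & _ & HL). exists (L * B). now apply HL.
Qed.

Lemma reduced_op_smoothing : smoothing T reduced_op.
Proof.
  assert (HT : 0 <= T) by (unfold T; lra).
  assert (Hg : forall u, anchored T u -> pieces cont (inv_g u))
    by (intros; apply inv_g_pieces; eauto using stable_cont, anchored_pieces).
  assert (Hf : forall u, anchored T u -> pieces cont (inv_f u))
    by (intros; apply inv_f_pieces; eauto using stable_cont, anchored_pieces).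
  set (C := INR n + Rabs (/ b) * (1 + INR n)).
  assert (HNn := pos_INR n).
  assert (C0 : 0 <= Rabs (/ b) * (1 + INR n)).
  { apply Rmult_le_pos; [apply Rabs_pos|lra]. }
  assert (HB : forall u M0, (forall t, Rabs (u t) <= M0) ->
     forall t, Rabs (inv_f u t) <= C * M0 /\ Rabs (inv_g u t) <= C * M0).
  { intros u M0 H t.
    assert (0 <= M0) by (eapply Rle_trans; [apply Rabs_pos|apply (H 0)]).
    assert (H1 := inv_f_bound u M0 t H). assert (H2 := inv_g_bound u M0 t H).
    assert (0 <= INR n * M0) by (apply Rmult_le_pos; lra).
    assert (0 <= Rabs (/ b) * (1 + INR n) * M0) by (apply Rmult_le_pos; lra).
    unfold C. lra. }
  split; [|split; [|split]].
  - intros u v c Hu Hv t. unfold reduced_op.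
    replace (inv_f (fun s => u s + c * v s)) with (fun s => inv_f u s + c * inv_f v s)
      by (apply functional_extensionality; intros; symmetry; apply inv_f_lin).
    replace (inv_g (fun s => u s + c * v s)) with (fun s => inv_g u s + c * inv_g v s)
      by (apply functional_extensionality; intros; symmetry; apply inv_g_lin).
    apply kernel_part_lin; auto.
  - intros u Hu t Ht. destruct (anchored_bounded T u HT Hu) as (M0 & _ & H).
    apply (kernel_part_anchored (inv_f u) (inv_g u) (C * M0)); auto; intros; now apply HB.
  - intros u Hu t Ht. unfold reduced_op. rewrite !(clamp_hi T) by (auto; lra). reflexivity.
  - destruct kernel_part_lipschitz as (L & L0 & HL).
    exists (L * C). split; [apply Rmult_le_pos; unfold C; lra|].
    intros u M0 Hu H. rewrite Rmult_assoc. apply HL; auto; intros; now apply HB.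
Qed.

End Operators.

(** * Integration against exponentials *)

Lemma pieces_bounded u T : pieces cont u -> exists B, 0 <= B /\
  forall t, t <= T -> Rabs (u t) <= B.
Proof.
  intros H. induction H as [u E|u v x h Hu (B & B0 & HB) Hx Hh E].
  - exists 0. split; [lra|]. intros t _. rewrite E, Rabs_R0. lra.
  - destruct (cont_bounded h x T Hh) as (M & M0 & HM).
    exists (B + M). split; [lra|]. intros t Ht. rewrite E.
    eapply Rle_trans; [apply Rabs_triang|]. apply Rplus_le_compat; [now apply HB|].
    destruct (Rle_dec x t).
    + rewrite step_1, Rmult_1_l by lra. apply HM; lra.
    + rewrite step_0, Rmult_0_l, Rabs_R0 by lra. exact M0.
Qed.

Lemma pieces_bounded_support u T : pieces cont u -> (forall t, T <= t -> u t = 0) ->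
  exists B, 0 <= B /\ forall t, Rabs (u t) <= B.
Proof.
  intros Hu H0. destruct (pieces_bounded u T Hu) as (B & B0 & HB).
  exists B. split; [exact B0|]. intros t. destruct (Rle_dec t T).
  - now apply HB.
  - rewrite H0, Rabs_R0 by lra. exact B0.
Qed.

Lemma primitive_eventually u tau t : pieces cont u -> 0 <= tau ->
  (forall s, tau <= s -> u s = 0) -> tau <= t -> primitive u t = primitive u tau.
Proof.
  intros Hu Htau H0 Ht. rewrite !primitiveE by lra.
  rewrite <- (RInt_Chasles_R u 0 tau t) by now apply pieces_integrable.
  rewrite (RInt_eq0 u tau t); [ring|lra|]. intros s Hs. apply H0. lra.
Qed.

(** At time [tau0 + tau1], where [M (t - s)] is nonzero, [f] has reached its final
    value. *)
Lemma conv_eventually_const f M alpha tau0 tau1 : 0 <= tau0 -> 0 <= tau1 ->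
  pieces cont f -> pieces cont M ->
  (forall t, tau0 <= t -> f t = alpha) -> (forall t, tau1 <= t -> M t = 0) ->
  conv f M (tau0 + tau1) = alpha * primitive M tau1.
Proof.
  intros H0 H1 Hf HM Ef EM. rewrite conv_comm, primitiveE by auto.
  unfold conv.
  rewrite <- (RInt_Chasles_R _ 0 tau1) by now apply (conv_integrable M f).
  rewrite (RInt_eq0 _ tau1); [|lra|intros s Hs; rewrite EM by lra; ring].
  rewrite Rplus_0_r, <- RInt_scal_R by now apply pieces_integrable.
  apply RInt_eq; [lra|]. intros s Hs. rewrite Ef by lra. ring.
Qed.

Lemma primitive_delay u d t : 0 <= d -> pieces cont u ->
  primitive (fun s => u (s - d)) t = primitive u (t - d).
Proof.
  intros Hd Hu. unfold primitive.
  apply conv_delay; auto using pieces_C1_cont, pieces_step0.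
Qed.

Lemma pieces_step_at x : 0 <= x -> pieces C1 (step x).
Proof.
  intros Hx. apply (pieces_ext C1 (fun t => step x t * 1)); [intros; ring|].
  apply pieces_one; [lra|apply C1_const].
Qed.

Lemma step_shift x d t : step x (t - d) = step (x + d) t.
Proof. unfold step. repeat destruct Rle_dec; lra. Qed.

Lemma conv_step x M t : 0 <= x -> pieces cont M ->
  conv (step x) M t = primitive M (t - x).
Proof.
  intros Hx HM. unfold primitive.
  assert (H0 := pieces_C1_cont _ pieces_step0).
  replace (step x) with (fun s => step 0 (s - x))
    by (apply functional_extensionality; intros; rewrite step_shift; f_equal; ring).
  rewrite conv_delay, conv_comm; auto.
Qed.

(** For a single piece [step x * h] this is the fundamental theorem of calculus for
    [E * H] on [x, t], where [H] is the primitive of [h] that vanishes at [x]. *)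
Lemma integration_by_parts E dE v t : (forall s, is_derive E s (dE s)) -> cont dE ->
  pieces cont v -> 0 <= t ->
  RInt (fun s => dE s * primitive v s + E s * v s) 0 t = E t * primitive v t :> R.
Proof.
  intros HE HdE Hv Ht.
  assert (HEc : cont E).
  { intros s. apply (ex_derive_continuous (V := R_NormedModule)). eexists; apply HE. }
  induction Hv as [v Ev|v0 v x h Hv IH Hx Hh Ev].
  - rewrite primitive_zero by exact Ev.
    rewrite RInt_zero; [ring|]. intros s _. rewrite primitive_zero, Ev by exact Ev. ring.
  - assert (Hh1 : pieces cont (fun t => step x t * h t)) by now apply pieces_one.
    assert (Ef : v = fun t => v0 t + 1 * (step x t * h t))
      by (apply functional_extensionality; intros s; rewrite Ev; ring).
    assert (Hi : forall w, pieces cont w ->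
      integrable (fun s => dE s * primitive w s + E s * w s)).
    { intros w Hw. apply integrable_plus; apply multiplier_of_pieces; auto.
      now apply pieces_C1_cont, primitive_C1. }
    assert (Hp : forall s, primitive v s
               = primitive v0 s + 1 * primitive (fun t => step x t * h t) s).
    { intros s. rewrite Ef. now apply primitive_lin. }
    rewrite Hp, Rmult_plus_distr_l, <- IH, Rmult_1_l.
    rewrite (RInt_ext_R _ (fun s =>
      (dE s * primitive v0 s + E s * v0 s) +
      (dE s * primitive (fun t => step x t * h t) s + E s * (step x s * h s))))
      by (intros s; rewrite Hp, Ev; ring).
    rewrite RInt_plus_R by (now apply Hi).
    apply (f_equal2 Rplus); [reflexivity|].
    set (H := conv_core h (fun _ => 1) x 0).
    assert (HdH : forall s, is_derive H s (h s)) by (intros; now apply conv_core_1_derive).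
    assert (HH : cont H) by (apply conv_core_cont; auto using cont_const).
    assert (H0 : H x = 0) by (unfold H; rewrite <- (Rplus_0_r x) at 2; apply conv_core_start).
    rewrite primitive_one by auto. fold H.
    set (d := fun s => dE s * H s + E s * h s).
    assert (Hd : cont d) by (apply cont_plus; now apply cont_mult).
    rewrite (RInt_ext_R _ (fun s => step x s * d s))
      by (intros s; unfold d; ring).
    destruct (Rle_dec x t) as [Hxt|Hxt].
    + rewrite step_1 by lra.
      assert (Hsd : integrable (fun s => step x s * d s))
        by now apply pieces_integrable, pieces_one.
      rewrite <- (RInt_Chasles_R _ 0 x t Hsd).
      rewrite (RInt_eq0 _ 0 x); [|lra|intros s Hs; rewrite step_0 by lra; ring].
      rewrite (RInt_eq (fun s => step x s * d s) d x t);
        [|lra|intros s Hs; rewrite step_1 by lra; ring].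
      assert (G := is_RInt_derive (V := R_CompleteNormedModule) (fun s => E s * H s) d x t).
      rewrite (is_RInt_unique (V := R_CompleteNormedModule) _ _ _ _ (G
         (fun s _ => is_derive_mult (K := R_AbsRing) E H s _ _ (HE s) (HdH s) Rmult_comm)
         (fun s _ => Hd s))).
      unfold minus, plus, opp; simpl. rewrite H0. ring.
    + rewrite step_0 by lra.
      rewrite RInt_eq0; [ring|lra|]. intros s Hs. rewrite step_0 by lra. ring.
Qed.

(** The real and imaginary parts of [exp (- lambda t)], [lambda = lr + i li]. *)
Definition er (lr li t : R) : R := exp (- (lr * t)) * cos (li * t).
Definition ei (lr li t : R) : R := - (exp (- (lr * t)) * sin (li * t)).

Lemma er_derive lr li t : is_derive (er lr li) t (- (lr * er lr li t - li * ei lr li t)).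
Proof. unfold er, ei. auto_derive; [exact I|]. ring. Qed.

Lemma ei_derive lr li t : is_derive (ei lr li) t (- (lr * ei lr li t + li * er lr li t)).
Proof. unfold er, ei. auto_derive; [exact I|]. ring. Qed.

Lemma er_cont lr li : cont (er lr li).
Proof.
  intros t. apply (ex_derive_continuous (V := R_NormedModule)). eexists; apply er_derive.
Qed.

Lemma ei_cont lr li : cont (ei lr li).
Proof.
  intros t. apply (ex_derive_continuous (V := R_NormedModule)). eexists; apply ei_derive.
Qed.

Lemma er_0 lr li : er lr li 0 = 1.
Proof. unfold er. rewrite !Rmult_0_r, Ropp_0, exp_0, cos_0. ring. Qed.

Lemma ei_0 lr li : ei lr li 0 = 0.
Proof. unfold ei. rewrite !Rmult_0_r, sin_0. ring. Qed.

Lemma er_ei_neq_0 lr li t : 0 < er lr li t * er lr li t + ei lr li t * ei lr li t.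
Proof.
  unfold er, ei. assert (H := sin2_cos2 (li * t)). unfold Rsqr in H.
  assert (He := exp_pos (- (lr * t))). set (e := exp (- (lr * t))) in *.
  set (c := cos (li * t)) in *. set (s := sin (li * t)) in *.
  replace (e * c * (e * c) + - (e * s) * - (e * s)) with (e * e * (s * s + c * c)) by ring.
  rewrite H, Rmult_1_r. now apply Rmult_lt_0_compat.
Qed.

Lemma cont_opp f : cont f -> cont (fun t => - f t).
Proof. intros Hf t. now apply (continuous_opp (V := R_NormedModule)). Qed.

Lemma cont_sub f g : cont f -> cont g -> cont (fun t => f t - g t).
Proof. intros Hf Hg t. now apply (continuous_minus (V := R_NormedModule)). Qed.

(** [X + i Y = x + i y + primitive (lambda (X + i Y) - (c1 + i c2) N)] *)
Section Exponential.

Context (lr li c1 c2 x y tau : R) (v1 v2 N : R -> R).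
Context (Htau : 0 <= tau) (Hv1 : pieces cont v1) (Hv2 : pieces cont v2)
        (HN : pieces cont N).
Let X t := x + primitive v1 t.
Let Y t := y + primitive v2 t.
Context (E1 : forall t, 0 < t < tau -> v1 t = lr * X t - li * Y t - c1 * N t).
Context (E2 : forall t, 0 < t < tau -> v2 t = lr * Y t + li * X t - c2 * N t).

(** Integration of the derivative of [E * (z + primitive v)]. *)
Lemma derive_const_primitive E dE v z t : (forall s, is_derive E s (dE s)) -> cont dE ->
  pieces cont v -> 0 <= t ->
  RInt (fun s => dE s * (z + primitive v s) + E s * v s) 0 t
  = E t * (z + primitive v t) - E 0 * z :> R.
Proof.
  intros HE HdE Hv Ht.
  rewrite (RInt_ext_R _
    (fun s => (dE s * primitive v s + E s * v s) + z * dE s))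
    by (intros s; ring).
  rewrite RInt_plus_R.
  - rewrite (integration_by_parts E dE) by auto.
    rewrite RInt_scal_R by now apply integrable_cont.
    rewrite (is_RInt_unique (V := R_CompleteNormedModule) dE 0 t _
      (is_RInt_derive (V := R_CompleteNormedModule) E dE 0 t
         (fun s _ => HE s) (fun s _ => HdE s))).
    unfold minus, plus, opp; simpl. ring.
  - assert (HEc : cont E).
    { intros s. apply (ex_derive_continuous (V := R_NormedModule)). eexists; apply HE. }
    apply integrable_plus; apply multiplier_of_pieces; auto.
    now apply pieces_C1_cont, primitive_C1.
  - now apply integrable_cont, cont_mult; [apply cont_const|].
Qed.

Let e := er lr li.
Let e' := ei lr li.
Let de t := - (lr * e t - li * e' t).
Let de' t := - (lr * e' t + li * e t).

Let Hde : forall s, is_derive e s (de s).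
Proof. intros. apply er_derive. Qed.
Let Hde' : forall s, is_derive e' s (de' s).
Proof. intros. apply ei_derive. Qed.
Let Cde : cont de.
Proof.
  apply cont_opp, cont_sub; apply cont_mult; auto using cont_const, er_cont, ei_cont;
  [apply er_cont|apply ei_cont].
Qed.
Let Cde' : cont de'.
Proof.
  apply cont_opp, cont_plus; apply cont_mult; auto using cont_const;
  [apply ei_cont|apply er_cont].
Qed.

Let Hint z v E dE : cont E -> cont dE -> pieces cont v ->
  integrable (fun s => dE s * (z + primitive v s) + E s * v s).
Proof.
  intros HE HdE Hv.
  apply (integrable_ext (fun s => z * dE s + (dE s * primitive v s + E s * v s)));
    [intros; ring|].
  apply integrable_plus; [now apply integrable_scal, integrable_cont|].
  apply integrable_plus; apply multiplier_of_pieces; auto.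
  now apply pieces_C1_cont, primitive_C1.
Qed.

Let HNe : integrable (fun s => e s * N s).
Proof. apply multiplier_of_pieces; auto. apply er_cont. Qed.
Let HNe' : integrable (fun s => e' s * N s).
Proof. apply multiplier_of_pieces; auto. apply ei_cont. Qed.

(** Real part of [exp (- lambda tau) Z(tau) - Z(0) = - (c1 + i c2) * int exp (- lambda s) N],
    where [Z = X + i Y].  Multiplying [Z' = lambda Z - (c1 + i c2) N] by [exp (- lambda t)]
    removes the term [lambda Z]. *)
Lemma exponential_re :
  e tau * X tau - e' tau * Y tau - x
  = - (c1 * RInt (fun s => e s * N s) 0 tau - c2 * RInt (fun s => e' s * N s) 0 tau).
Proof.
  assert (H1 := derive_const_primitive e de v1 x tau Hde Cde Hv1 Htau).
  assert (H2 := derive_const_primitive e' de' v2 y tau Hde' Cde' Hv2 Htau).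
  fold (X tau) in H1. fold (Y tau) in H2.
  unfold e at 3 in H1. unfold e' at 3 in H2. rewrite er_0 in H1. rewrite ei_0 in H2.
  transitivity (RInt (fun s => (de s * (x + primitive v1 s) + e s * v1 s)
      + -1 * (de' s * (y + primitive v2 s) + e' s * v2 s)) 0 tau).
  - rewrite RInt_sub; [|apply Hint; auto; apply er_cont|apply Hint; auto; apply ei_cont].
    rewrite H1, H2. ring.
  - rewrite (RInt_eq _ (fun s => (- c1) * (e s * N s) + c2 * (e' s * N s))); [|exact Htau|].
    + rewrite RInt_plus_R; [|apply integrable_scal, HNe|apply integrable_scal, HNe'].
      rewrite !RInt_scal_R; [simpl; ring|apply HNe'|apply HNe].
    + intros s Hs. rewrite E1, E2 by exact Hs. fold (X s). fold (Y s).
      unfold de, de'. ring.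
Qed.

End Exponential.

Lemma primitive_opp v t : pieces cont v -> primitive (fun s => -1 * v s) t = - primitive v t.
Proof.
  intros Hv. assert (Z : pieces cont (fun _ => 0)) by now apply pieces_nil.
  assert (H := primitive_lin (fun _ => 0) v (-1) t Z Hv).
  rewrite (primitive_zero (fun _ => 0)) in H by reflexivity.
  replace (fun s : R => 0 + -1 * v s) with (fun s => -1 * v s) in H
    by (apply functional_extensionality; intros; ring). lra.
Qed.

Lemma exponential_im lr li c1 c2 x y tau v1 v2 N :
  0 <= tau -> pieces cont v1 -> pieces cont v2 -> pieces cont N ->
  (forall t, 0 < t < tau ->
     v1 t = lr * (x + primitive v1 t) - li * (y + primitive v2 t) - c1 * N t) ->
  (forall t, 0 < t < tau ->
     v2 t = lr * (y + primitive v2 t) + li * (x + primitive v1 t) - c2 * N t) ->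
  er lr li tau * (y + primitive v2 tau) + ei lr li tau * (x + primitive v1 tau) - y
  = - (c2 * RInt (fun s => er lr li s * N s) 0 tau
       + c1 * RInt (fun s => ei lr li s * N s) 0 tau).
Proof.
  intros Htau Hv1 Hv2 HN E1 E2.
  assert (Hv1' : pieces cont (fun s => -1 * v1 s))
    by (apply pieces_scal; auto using stable_cont).
  (* Multiplying [X + i Y] and its equation by [- i] turns one statement into the other. *)
  assert (E1' : forall t, 0 < t < tau -> v2 t = lr * (y + primitive v2 t)
      - li * (- x + primitive (fun s => -1 * v1 s) t) - c2 * N t).
  { intros t Ht. rewrite primitive_opp, (E2 t Ht) by exact Hv1. ring. }
  assert (E2' : forall t, 0 < t < tau -> -1 * v1 t =
      lr * (- x + primitive (fun s => -1 * v1 s) t)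
      + li * (y + primitive v2 t) - (- c1) * N t).
  { intros t Ht. rewrite primitive_opp, (E1 t Ht) by exact Hv1. ring. }
  assert (H := exponential_re lr li c2 (- c1) y (- x) tau v2 (fun s => -1 * v1 s) N
    Htau Hv2 Hv1' HN E1' E2').
  cbv beta zeta in H. rewrite primitive_opp in H by exact Hv1. lra.
Qed.

(** * The homogeneous equation *)

Section Shift.

Context (tau0 tau1 a b : R).
Context (Htau0 : 0 < tau0) (Htau1 : tau0 <= tau1) (Hb : b <> 0).
Context (N M : R -> R) (HN : pieces C1 N) (HM : pieces C1 M).
Context (HN0 : forall t, tau0 <= t -> N t = 0) (HM0 : forall t, tau1 <= t -> M t = 0).

Let T := tau0 + tau1.
Let dp := delay_part tau0 tau1 a b.
Let kp := kernel_part N M.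

(** The inverse transform of [(f^(s) + c F0(s)) / s]. *)
Definition shift_f (c : R) (f : R -> R) (t : R) : R :=
  c * (step 0 t - a * step tau0 t) + (primitive f t - c * primitive N t).

(** The inverse transform of [(g^(s) - c F1(s)) / s]. *)
Definition shift_g (c : R) (g : R -> R) (t : R) : R :=
  c * (- b * step tau1 t) + (primitive g t - c * primitive M t).

Lemma shift_f_pieces c f : pieces cont f -> pieces C1 (shift_f c f).
Proof.
  intros Hf.
  apply (pieces_ext C1 (fun t => ((primitive f t + (- c) * primitive N t)
     + c * step 0 t) + (- (c * a)) * step tau0 t)).
  - intros t. unfold shift_f. ring.
  - repeat apply pieces_lin; auto using stable_C1, primitive_C1, pieces_C1_cont;
      apply pieces_step_at; lra.
Qed.

Lemma shift_g_pieces c g : pieces cont g -> pieces C1 (shift_g c g).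
Proof.
  intros Hf.
  apply (pieces_ext C1 (fun t => (primitive g t + (- c) * primitive M t)
     + (- (c * b)) * step tau1 t)).
  - intros t. unfold shift_g. ring.
  - repeat apply pieces_lin; auto using stable_C1, primitive_C1, pieces_C1_cont;
      apply pieces_step_at; lra.
Qed.

Lemma conv_shift_f c f V t : pieces cont f -> pieces C1 V ->
  conv (shift_f c f) V t
  = primitive (conv f V) t - c * primitive (conv N V) t
    + c * primitive V t - c * a * primitive V (t - tau0).
Proof.
  intros Hf HV.
  replace (shift_f c f) with (fun t => ((primitive f t + (- c) * primitive N t)
     + c * step 0 t) + (- (c * a)) * step tau0 t)
    by (apply functional_extensionality; intros; unfold shift_f; ring).
  assert (Sc := stable_cont). assert (HVc := pieces_C1_cont _ HV).
  assert (H1 : pieces cont (primitive f)) by auto using pieces_C1_cont, primitive_C1.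
  assert (H2 : pieces cont (primitive N)) by auto using pieces_C1_cont, primitive_C1.
  assert (H3 : pieces cont (step 0)) by (apply pieces_C1_cont, pieces_step_at; lra).
  assert (H4 : pieces cont (step tau0)) by (apply pieces_C1_cont, pieces_step_at; lra).
  rewrite !conv_lin_l by auto using pieces_lin.
  rewrite <- !primitive_conv, !conv_step by (auto using pieces_C1_cont; lra).
  rewrite Rminus_0_r. ring.
Qed.

Lemma conv_shift_g c g V t : pieces cont g -> pieces C1 V ->
  conv (shift_g c g) V t
  = primitive (conv g V) t - c * primitive (conv M V) t
    - c * b * primitive V (t - tau1).
Proof.
  intros Hf HV.
  replace (shift_g c g) with (fun t => (primitive g t + (- c) * primitive M t)
     + (- (c * b)) * step tau1 t)
    by (apply functional_extensionality; intros; unfold shift_g; ring).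
  assert (Sc := stable_cont). assert (HVc := pieces_C1_cont _ HV).
  assert (H1 : pieces cont (primitive g)) by auto using pieces_C1_cont, primitive_C1.
  assert (H2 : pieces cont (primitive M)) by auto using pieces_C1_cont, primitive_C1.
  assert (H3 : pieces cont (step tau1)) by (apply pieces_C1_cont, pieces_step_at; lra).
  rewrite !conv_lin_l by auto using pieces_lin.
  rewrite <- !primitive_conv, !conv_step by (auto using pieces_C1_cont; lra).
  ring.
Qed.

Section Homogeneous.

Context (f g : R -> R) (Hf : pieces cont f) (Hg : pieces cont g).
Context (Hf1 : forall t, tau0 <= t -> f t = 0) (Hg1 : forall t, tau1 <= t -> g t = 0).
Context (HE : forall t, 0 <= t < T -> dp f g t = kp f g t).

Lemma primitive_equation t : 0 <= t <= T ->
  primitive g t - a * primitive g (t - tau0) + b * primitive f (t - tau1)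
  = primitive (conv g N) t - primitive (conv f M) t.
Proof.
  intros Ht.
  assert (Hg0 : pieces cont (fun s => g (s - tau0)))
    by (apply pieces_delay; auto using stable_cont; lra).
  assert (Hf0 : pieces cont (fun s => f (s - tau1)))
    by (apply pieces_delay; auto using stable_cont; lra).
  transitivity (primitive (dp f g) t).
  - replace (dp f g) with (fun s => (g s + (- a) * g (s - tau0)) + b * f (s - tau1))
      by (apply functional_extensionality; intros; unfold dp, delay_part; ring).
    rewrite !primitive_lin by auto using pieces_lin, stable_cont.
    rewrite !primitive_delay by (auto; lra). ring.
  - transitivity (primitive (kp f g) t).
    + rewrite !primitiveE by lra. apply RInt_eq; [lra|]. intros s Hs. apply HE. lra.
    + replace (kp f g) with (fun s => conv g N s + (-1) * conv f M s)
        by (apply functional_extensionality; intros; unfold kp, kernel_part; ring).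
      rewrite primitive_lin by auto using conv_pieces. ring.
Qed.

(** Whatever [c] is, the multiples of [(F0, - F1)] cancel, and what remains is the
    primitive of the equation for [(f, g)]. *)
Lemma shift_equation c t : 0 <= t <= T ->
  dp (shift_f c f) (shift_g c g) t = kp (shift_f c f) (shift_g c g) t.
Proof.
  intros Ht. unfold kp, kernel_part.
  rewrite conv_shift_f, conv_shift_g by auto.
  assert (H := primitive_equation t Ht).
  replace (conv M N) with (conv N M)
    by (apply functional_extensionality; intros; apply conv_comm; auto using pieces_C1_cont).
  unfold dp, delay_part, shift_f, shift_g.
  rewrite !step_shift, Rplus_0_l, (Rplus_comm tau1 tau0). lra.
Qed.

(** [char0] and [char1] are the values of [F0] and [F1] at 0. *)
Definition char0 : R := 1 - a - primitive N tau0.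
Definition char1 : R := b + primitive M tau1.

(** The common solution of the two equations [f^(0) + c F0(0) = 0] and
    [g^(0) - c F1(0) = 0] when they are compatible, written as their least-squares
    solution so that it depends linearly on [(f, g)]. *)
Definition shift_c (f g : R -> R) : R :=
  (primitive g tau1 * char1 - primitive f tau0 * char0) / (char0 * char0 + char1 * char1).

Context (Hchar : char0 * char0 + char1 * char1 <> 0).

Lemma shift_f_tail t : tau0 <= t ->
  shift_f (shift_c f g) f t = primitive f tau0 + shift_c f g * char0.
Proof.
  intros Ht. unfold shift_f, char0. rewrite !step_1 by lra.
  rewrite (primitive_eventually f tau0 t), (primitive_eventually N tau0 t)
    by (auto using pieces_C1_cont; lra). ring.
Qed.

Lemma shift_g_tail t : tau1 <= t ->
  shift_g (shift_c f g) g t = primitive g tau1 - shift_c f g * char1.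
Proof.
  intros Ht. unfold shift_g, char1. rewrite !step_1 by lra.
  rewrite (primitive_eventually g tau1 t), (primitive_eventually M tau1 t)
    by (auto using pieces_C1_cont; lra). ring.
Qed.

(** Past their supports the two shifted functions are constants [al] and [be].  The
    equation at [T] reads [be F0(0) + al F1(0) = 0], the choice of [c] gives
    [al F0(0) - be F1(0) = 0], and the determinant of this system is not zero. *)
Lemma shift_tails_vanish :
  primitive f tau0 + shift_c f g * char0 = 0 /\
  primitive g tau1 - shift_c f g * char1 = 0.
Proof.
  set (al := primitive f tau0 + shift_c f g * char0).
  set (be := primitive g tau1 - shift_c f g * char1).
  assert (H : be * char0 + al * char1 = 0).
  { assert (H := shift_equation (shift_c f g) T). unfold T in H.
    assert (H0 : 0 <= tau0) by lra. assert (H1 : 0 <= tau1) by lra.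
    assert (HT : 0 <= tau0 + tau1 <= tau0 + tau1) by lra. specialize (H HT).
    unfold kp, kernel_part in H.
    rewrite (conv_eventually_const _ M al tau0 tau1 H0 H1) in H
      by (auto using shift_f_pieces, pieces_C1_cont, shift_f_tail).
    rewrite (Rplus_comm tau0 tau1) in H.
    rewrite (conv_eventually_const _ N be tau1 tau0 H1 H0) in H
      by (auto using shift_g_pieces, pieces_C1_cont, shift_g_tail).
    unfold dp, delay_part in H.
    rewrite !shift_g_tail, shift_f_tail in H by lra.
    fold al be in H. unfold char0, char1. lra. }
  assert (H' : al * char0 - be * char1 = 0).
  { unfold al, be, shift_c. field. exact Hchar. }
  split; apply Rmult_eq_reg_r with (char0 * char0 + char1 * char1); auto.
  - rewrite Rmult_0_l.
    replace (al * (char0 * char0 + char1 * char1))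
      with (char0 * (al * char0 - be * char1) + char1 * (be * char0 + al * char1)) by ring.
    rewrite H, H'. ring.
  - rewrite Rmult_0_l.
    replace (be * (char0 * char0 + char1 * char1))
      with (char0 * (be * char0 + al * char1) - char1 * (al * char0 - be * char1)) by ring.
    rewrite H, H'. ring.
Qed.

Lemma shift_f_ge t : tau0 <= t -> shift_f (shift_c f g) f t = 0.
Proof. intros Ht. rewrite shift_f_tail by exact Ht. apply shift_tails_vanish. Qed.

Lemma shift_g_ge t : tau1 <= t -> shift_g (shift_c f g) g t = 0.
Proof. intros Ht. rewrite shift_g_tail by exact Ht. apply shift_tails_vanish. Qed.

End Homogeneous.

Lemma shift_c_lin f g f' g' c :
  pieces cont f -> pieces cont g -> pieces cont f' -> pieces cont g' ->
  shift_c (fun s => f s + c * f' s) (fun s => g s + c * g' s)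
  = shift_c f g + c * shift_c f' g'.
Proof.
  intros. unfold shift_c. rewrite !primitive_lin by auto. unfold Rdiv. ring.
Qed.

Context (n : nat) (Hn : tau1 <= INR n * tau0) (Ha : -1 < a < 1).

Let ph := inv_f tau0 tau1 a b n.
Let ga := inv_g tau0 tau1 a n.
Let Kop := reduced_op tau0 tau1 a b n N M.
Let Ksm : smoothing T Kop := reduced_op_smoothing tau0 tau1 a b n Htau0 Htau1 Ha Hb N M HN HM.

Definition shift (u : R -> R) (t : R) : R :=
  kp (shift_f (shift_c (ph u) (ga u)) (ph u)) (shift_g (shift_c (ph u) (ga u)) (ga u))
     (clamp T t).

Lemma anchored_neg u : anchored T u -> forall s, s < 0 -> u s = 0.
Proof. intros [H _] s Hs. apply H. lra. Qed.

Lemma fixed_equation u : fixed T Kop u ->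
  forall t, 0 <= t < T -> dp (ph u) (ga u) t = kp (ph u) (ga u) t.
Proof.
  intros [Hu Hfix] t Ht. unfold dp, ph, ga.
  rewrite delay_part_inv by (eauto using anchored_neg; unfold T in Ht; lra).
  rewrite Hfix. unfold Kop, reduced_op. fold T. rewrite clamp_id by lra. reflexivity.
Qed.

Lemma ph_pieces u : anchored T u -> pieces cont (ph u).
Proof.
  intros Hu. apply inv_f_pieces; auto using stable_cont. now apply (anchored_pieces T).
Qed.

Lemma ga_pieces u : anchored T u -> pieces cont (ga u).
Proof.
  intros Hu. apply inv_g_pieces; auto using stable_cont. now apply (anchored_pieces T).
Qed.

Context (Hchar : char0 * char0 + char1 * char1 <> 0).

Section OneFixed.

Context (u : R -> R) (Hu : fixed T Kop u).
Let c := shift_c (ph u) (ga u).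

Let Hph : pieces cont (ph u) := ph_pieces u (proj1 Hu).
Let Hga : pieces cont (ga u) := ga_pieces u (proj1 Hu).
Let Hph1 : forall t, tau0 <= t -> ph u t = 0 := inv_f_ge tau0 tau1 a b n u.
Let Hga1 : forall t, tau1 <= t -> ga u t = 0 := inv_g_ge tau0 tau1 a n u.
Let HE := fixed_equation u Hu.

Lemma shift_anchored : anchored T (shift u).
Proof.
  destruct (pieces_bounded_support (shift_f c (ph u)) tau0) as (B & B0 & HB).
  { now apply pieces_C1_cont, shift_f_pieces. }
  { now apply shift_f_ge. }
  destruct (pieces_bounded_support (shift_g c (ga u)) tau1) as (B' & B0' & HB').
  { now apply pieces_C1_cont, shift_g_pieces. }
  { now apply shift_g_ge. }
  apply (kernel_part_anchored tau0 tau1) with (B := B + B'); auto.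
  - now apply pieces_C1_cont, shift_f_pieces.
  - now apply pieces_C1_cont, shift_g_pieces.
  - intros t. specialize (HB t). fold c. lra.
  - intros t. specialize (HB' t). fold c. lra.
Qed.

(** So [shift u] has [delay_part] equal to itself for the shifted pair, which is
    therefore its image under [inv_f] and [inv_g]. *)
Lemma shift_delay_equation t : 0 <= t < T ->
  dp (shift_f c (ph u)) (shift_g c (ga u)) t = shift u t.
Proof.
  intros Ht. unfold shift. fold c. rewrite clamp_id by lra.
  apply shift_equation; auto. lra.
Qed.

Lemma ga_shift t : ga (shift u) t = shift_g c (ga u) t.
Proof.
  apply (inv_g_unique tau0 tau1 a b n Htau0 Hn (shift u) (shift_f c (ph u))).
  - apply anchored_neg, shift_anchored.
  - intros s Hs. eapply pieces_neg; [now apply (shift_f_pieces c)|exact Hs].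
  - intros s Hs. eapply pieces_neg; [now apply (shift_g_pieces c)|exact Hs].
  - now apply shift_g_ge.
  - exact shift_delay_equation.
Qed.

Lemma ph_shift t : ph (shift u) t = shift_f c (ph u) t.
Proof.
  apply (inv_f_unique tau0 tau1 a b n Htau0 Htau1 Hb Hn (shift u)
           (shift_f c (ph u)) (shift_g c (ga u))).
  - apply anchored_neg, shift_anchored.
  - intros s Hs. eapply pieces_neg; [now apply (shift_f_pieces c)|exact Hs].
  - now apply shift_f_ge.
  - intros s Hs. eapply pieces_neg; [now apply (shift_g_pieces c)|exact Hs].
  - now apply shift_g_ge.
  - exact shift_delay_equation.
Qed.

Lemma shift_fixed : fixed T Kop (shift u).
Proof.
  split; [apply shift_anchored|]. intros t. unfold Kop, reduced_op. fold T ph ga.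
  replace (ph (shift u)) with (shift_f c (ph u))
    by (apply functional_extensionality; intros; symmetry; apply ph_shift).
  replace (ga (shift u)) with (shift_g c (ga u))
    by (apply functional_extensionality; intros; symmetry; apply ga_shift).
  reflexivity.
Qed.

End OneFixed.

Lemma shift_linear : linear_on (fixed T Kop) shift.
Proof.
  intros u v k Hu Hv t. unfold shift.
  assert (Hpu := ph_pieces u (proj1 Hu)). assert (Hpv := ph_pieces v (proj1 Hv)).
  assert (Hgu := ga_pieces u (proj1 Hu)). assert (Hgv := ga_pieces v (proj1 Hv)).
  assert (Eph : ph (fun s => u s + k * v s) = fun s => ph u s + k * ph v s)
    by (apply functional_extensionality; intros; apply inv_f_lin).
  assert (Ega : ga (fun s => u s + k * v s) = fun s => ga u s + k * ga v s)
    by (apply functional_extensionality; intros; apply inv_g_lin).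
  rewrite Eph, Ega, shift_c_lin by auto.
  unfold kp. rewrite <- kernel_part_lin
    by (auto using pieces_C1_cont, shift_f_pieces, shift_g_pieces).
  f_equal; apply functional_extensionality; intros s.
  - unfold shift_f. rewrite primitive_lin by auto. ring.
  - unfold shift_g. rewrite primitive_lin by auto. ring.
Qed.

(** The real and imaginary parts of [F0] and [F1] at [lr + i li]. *)
Definition char0_re lr li := 1 - a * er lr li tau0 - RInt (fun s => er lr li s * N s) 0 tau0.
Definition char0_im lr li := - a * ei lr li tau0 - RInt (fun s => ei lr li s * N s) 0 tau0.
Definition char1_re lr li := b * er lr li tau1 + RInt (fun s => er lr li s * M s) 0 tau1.
Definition char1_im lr li := b * ei lr li tau1 + RInt (fun s => ei lr li s * M s) 0 tau1.

Context (Hrank : forall lr li,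
  ~ (char0_re lr li = 0 /\ char0_im lr li = 0 /\ char1_re lr li = 0 /\ char1_im lr li = 0)).

(** The field of complex numbers has no zero divisors. *)
Lemma complex_mult_0 c1 c2 x y : c1 * x - c2 * y = 0 -> c2 * x + c1 * y = 0 ->
  ~ (c1 = 0 /\ c2 = 0) -> x = 0 /\ y = 0.
Proof.
  intros H1 H2 Hc.
  assert (Hx : (c1 * c1 + c2 * c2) * x = 0).
  { replace ((c1 * c1 + c2 * c2) * x)
      with (c1 * (c1 * x - c2 * y) + c2 * (c2 * x + c1 * y)) by ring.
    rewrite H1, H2. ring. }
  assert (Hy : (c1 * c1 + c2 * c2) * y = 0).
  { replace ((c1 * c1 + c2 * c2) * y)
      with (c1 * (c2 * x + c1 * y) - c2 * (c1 * x - c2 * y)) by ring.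
    rewrite H1, H2. ring. }
  assert (Hd : c1 * c1 + c2 * c2 <> 0).
  { intros E. apply Hc. split; nra. }
  split; [destruct (Rmult_integral _ _ Hx)|destruct (Rmult_integral _ _ Hy)];
    auto; contradiction.
Qed.

Section Eigenvector.

Context (lr li : R) (f1 f2 g1 g2 : R -> R) (c1 c2 : R).
Context (Hf1 : pieces cont f1) (Hf2 : pieces cont f2)
        (Hg1 : pieces cont g1) (Hg2 : pieces cont g2).
Let F1 := shift_f c1 f1. Let F2 := shift_f c2 f2.
Let G1 := shift_g c1 g1. Let G2 := shift_g c2 g2.
Context (EF1 : forall t, f1 t = lr * F1 t - li * F2 t)
        (EF2 : forall t, f2 t = lr * F2 t + li * F1 t)
        (EG1 : forall t, g1 t = lr * G1 t - li * G2 t)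
        (EG2 : forall t, g2 t = lr * G2 t + li * G1 t).
Context (HF1 : forall t, tau0 <= t -> F1 t = 0) (HF2 : forall t, tau0 <= t -> F2 t = 0)
        (HG1 : forall t, tau1 <= t -> G1 t = 0) (HG2 : forall t, tau1 <= t -> G2 t = 0).

(* The densities of [F] and [G] between their jumps. *)
Let vf1 t := f1 t + - c1 * N t. Let vf2 t := f2 t + - c2 * N t.
Let vg1 t := g1 t + - c1 * M t. Let vg2 t := g2 t + - c2 * M t.

Let Hvf1 : pieces cont vf1.
Proof. apply pieces_lin; auto using stable_cont, pieces_C1_cont. Qed.
Let Hvf2 : pieces cont vf2.
Proof. apply pieces_lin; auto using stable_cont, pieces_C1_cont. Qed.
Let Hvg1 : pieces cont vg1.
Proof. apply pieces_lin; auto using stable_cont, pieces_C1_cont. Qed.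
Let Hvg2 : pieces cont vg2.
Proof. apply pieces_lin; auto using stable_cont, pieces_C1_cont. Qed.

Lemma shift_f_density c f t : pieces cont f -> 0 <= t ->
  shift_f c f t = c + primitive (fun s => f s + - c * N s) t - c * a * step tau0 t.
Proof.
  intros Hf Ht. rewrite primitive_lin by auto using pieces_C1_cont.
  unfold shift_f. rewrite (step_1 0) by lra. ring.
Qed.

Lemma shift_g_density c g t : pieces cont g -> 0 <= t ->
  shift_g c g t = primitive (fun s => g s + - c * M s) t - c * b * step tau1 t.
Proof.
  intros Hg Ht. rewrite primitive_lin by auto using pieces_C1_cont.
  unfold shift_g. ring.
Qed.

Let EF1d t : 0 <= t -> F1 t = c1 + primitive vf1 t - c1 * a * step tau0 t :=
  shift_f_density c1 f1 t Hf1.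
Let EF2d t : 0 <= t -> F2 t = c2 + primitive vf2 t - c2 * a * step tau0 t :=
  shift_f_density c2 f2 t Hf2.
Let EG1d t : 0 <= t -> G1 t = primitive vg1 t - c1 * b * step tau1 t :=
  shift_g_density c1 g1 t Hg1.
Let EG2d t : 0 <= t -> G2 t = primitive vg2 t - c2 * b * step tau1 t :=
  shift_g_density c2 g2 t Hg2.

Let ode_f1 tau : tau <= tau0 -> forall t, 0 < t < tau ->
  vf1 t = lr * (c1 + primitive vf1 t) - li * (c2 + primitive vf2 t) - c1 * N t.
Proof.
  intros Htau t Ht. unfold vf1 at 1. rewrite EF1, EF1d, EF2d, step_0 by lra. ring.
Qed.

Let ode_f2 tau : tau <= tau0 -> forall t, 0 < t < tau ->
  vf2 t = lr * (c2 + primitive vf2 t) + li * (c1 + primitive vf1 t) - c2 * N t.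
Proof.
  intros Htau t Ht. unfold vf2 at 1. rewrite EF2, EF1d, EF2d, step_0 by lra. ring.
Qed.

Let ode_g1 tau : tau <= tau1 -> forall t, 0 < t < tau ->
  vg1 t = lr * (0 + primitive vg1 t) - li * (0 + primitive vg2 t) - c1 * M t.
Proof.
  intros Htau t Ht. unfold vg1 at 1. rewrite EG1, EG1d, EG2d, step_0 by lra. ring.
Qed.

Let ode_g2 tau : tau <= tau1 -> forall t, 0 < t < tau ->
  vg2 t = lr * (0 + primitive vg2 t) + li * (0 + primitive vg1 t) - c2 * M t.
Proof.
  intros Htau t Ht. unfold vg2 at 1. rewrite EG2, EG1d, EG2d, step_0 by lra. ring.
Qed.

Let HNc : pieces cont N := pieces_C1_cont _ HN.
Let HMc : pieces cont M := pieces_C1_cont _ HM.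

(** The jumps of [F] and [G] at their ends are [- a c] and [- b c].  So the exponential
    identities up to [tau0] and [tau1] say that [c F0(lambda) = 0] and
    [c F1(lambda) = 0]. *)
Lemma eigenvector_jump_0 : c1 = 0 /\ c2 = 0.
Proof.
  apply NNPP. intros Hc. apply (Hrank lr li).
  assert (H0 : 0 <= tau0) by lra. assert (H1 : 0 <= tau1) by lra.
  assert (A1 := exponential_re lr li c1 c2 c1 c2 tau0 vf1 vf2 N H0 Hvf1 Hvf2 HNc
     (ode_f1 tau0 (Rle_refl _)) (ode_f2 tau0 (Rle_refl _))).
  assert (A2 := exponential_im lr li c1 c2 c1 c2 tau0 vf1 vf2 N H0 Hvf1 Hvf2 HNc
     (ode_f1 tau0 (Rle_refl _)) (ode_f2 tau0 (Rle_refl _))).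
  assert (A3 := exponential_re lr li c1 c2 0 0 tau1 vg1 vg2 M H1 Hvg1 Hvg2 HMc
     (ode_g1 tau1 (Rle_refl _)) (ode_g2 tau1 (Rle_refl _))).
  assert (A4 := exponential_im lr li c1 c2 0 0 tau1 vg1 vg2 M H1 Hvg1 Hvg2 HMc
     (ode_g1 tau1 (Rle_refl _)) (ode_g2 tau1 (Rle_refl _))).
  cbv beta zeta in A1, A2, A3, A4.
  assert (B1 := EF1d tau0 H0). assert (B2 := EF2d tau0 H0).
  assert (B3 := EG1d tau1 H1). assert (B4 := EG2d tau1 H1).
  rewrite HF1, step_1 in B1 by lra. rewrite HF2, step_1 in B2 by lra.
  rewrite HG1, step_1 in B3 by lra. rewrite HG2, step_1 in B4 by lra.
  replace (c1 + primitive vf1 tau0) with (c1 * a) in A1, A2 by lra.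
  replace (c2 + primitive vf2 tau0) with (c2 * a) in A1, A2 by lra.
  replace (0 + primitive vg1 tau1) with (c1 * b) in A3, A4 by lra.
  replace (0 + primitive vg2 tau1) with (c2 * b) in A3, A4 by lra.
  assert (C0 : char0_re lr li = 0 /\ char0_im lr li = 0)
    by (apply (complex_mult_0 c1 c2); auto; unfold char0_re, char0_im; lra).
  assert (C1 : char1_re lr li = 0 /\ char1_im lr li = 0)
    by (apply (complex_mult_0 c1 c2); auto; unfold char1_re, char1_im; lra).
  tauto.
Qed.

(** With [c = 0] the same identities up to an arbitrary time [t] read
    [exp (- lambda t) F(t) = 0] and [exp (- lambda t) G(t) = 0]. *)
Lemma eigenvector_0 t : F1 t = 0 /\ F2 t = 0 /\ G1 t = 0 /\ G2 t = 0.
Proof.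
  destruct eigenvector_jump_0 as [Ec1 Ec2].
  destruct (Rlt_dec t 0) as [Ht|Ht].
  { repeat split; eapply pieces_neg; try exact Ht;
      [apply (shift_f_pieces c1 f1)|apply (shift_f_pieces c2 f2)
      |apply (shift_g_pieces c1 g1)|apply (shift_g_pieces c2 g2)]; auto. }
  assert (Ht0 : 0 <= t) by lra.
  assert (He := er_ei_neq_0 lr li t).
  assert (Hnz : ~ (er lr li t = 0 /\ ei lr li t = 0)).
  { intros [E E']. rewrite E, E' in He. lra. }
  assert (HF : F1 t = 0 /\ F2 t = 0).
  { destruct (Rle_dec tau0 t) as [H|H]; [auto|].
    assert (H' : t <= tau0) by lra.
    assert (A1 := exponential_re lr li c1 c2 c1 c2 t vf1 vf2 N Ht0 Hvf1 Hvf2 HNc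
       (ode_f1 t H') (ode_f2 t H')).
    assert (A2 := exponential_im lr li c1 c2 c1 c2 t vf1 vf2 N Ht0 Hvf1 Hvf2 HNc
       (ode_f1 t H') (ode_f2 t H')).
    cbv beta zeta in A1, A2.
    apply (complex_mult_0 (er lr li t) (ei lr li t)); auto;
      rewrite EF1d, EF2d, step_0 by lra; rewrite Ec1, Ec2 in *; lra. }
  assert (HG : G1 t = 0 /\ G2 t = 0).
  { destruct (Rle_dec tau1 t) as [H|H]; [auto|].
    assert (H' : t <= tau1) by lra.
    assert (A1 := exponential_re lr li c1 c2 0 0 t vg1 vg2 M Ht0 Hvg1 Hvg2 HMc
       (ode_g1 t H') (ode_g2 t H')).
    assert (A2 := exponential_im lr li c1 c2 0 0 t vg1 vg2 M Ht0 Hvg1 Hvg2 HMc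
       (ode_g1 t H') (ode_g2 t H')).
    cbv beta zeta in A1, A2.
    apply (complex_mult_0 (er lr li t) (ei lr li t)); auto;
      rewrite EG1d, EG2d, step_0 by lra; rewrite Ec1, Ec2 in *; lra. }
  tauto.
Qed.

End Eigenvector.

Lemma cont_primitive_0 u : anchored T u ->
  (forall t, 0 <= t <= T -> primitive u t = 0) -> forall t, 0 <= t < T -> u t = 0.
Proof.
  intros Hu H0 t Ht. destruct (Req_dec t 0) as [->|Hne].
  { apply Hu. lra. }
  assert (Hc : cont u) by (destruct Hu as (_ & _ & L & HL); now apply (lipschitz_cont L)).
  assert (D1 : is_derive (fun s => RInt u 0 s) t (u t)).
  { apply (is_derive_RInt (V := R_NormedModule) u _ 0).
    - apply filter_forall. intros s. apply (RInt_correct (V := R_CompleteNormedModule)).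
      now apply integrable_cont.
    - apply Hc. }
  assert (D2 : is_derive (fun s => RInt u 0 s) t 0).
  { apply (is_derive_ext_loc (fun _ => 0)).
    - assert (Hd : 0 < Rmin t (T - t)) by (unfold Rmin; destruct Rle_dec; lra).
      exists (mkposreal _ Hd). intros s Hs.
      assert (Hs' : Rabs (s - t) < Rmin t (T - t)) by exact Hs.
      assert (H1 := Rmin_l t (T - t)). assert (H2 := Rmin_r t (T - t)).
      apply Rabs_lt_between in Hs'.
      rewrite <- primitiveE by lra. rewrite H0 by lra. reflexivity.
    - apply (is_derive_const (V := R_NormedModule)). }
  apply is_derive_unique in D1. apply is_derive_unique in D2. congruence.
Qed.

Lemma fixed_of_zero u : fixed T Kop u -> (forall t, ph u t = 0) -> (forall t, ga u t = 0) ->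
  forall t, u t = 0.
Proof.
  intros [Hu Hfix] H1 H2 t. rewrite Hfix. unfold Kop, reduced_op, kernel_part.
  rewrite !conv_zero_l by assumption. ring.
Qed.

(** The case of the eigenvalue 0.  From [c = 0] the primitives of both functions vanish,
    hence also the primitive of the continuous function [u = K u]. *)
Lemma shift_injective u : fixed T Kop u ->
  (forall t, ph (shift u) t = 0) -> (forall t, ga (shift u) t = 0) -> forall t, u t = 0.
Proof.
  intros Hu H1 H2.
  set (c := shift_c (ph u) (ga u)).
  assert (E1 : forall t, shift_f c (ph u) t = 0)
    by (intros; unfold c; rewrite <- ph_shift; auto).
  assert (E2 : forall t, shift_g c (ga u) t = 0)
    by (intros; unfold c; rewrite <- ga_shift; auto).
  assert (Ec : c = 0).
  { assert (H := E1 0). rewrite shift_f_density in H by (auto using ph_pieces, (proj1 Hu); lra).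
    rewrite step_0 in H by lra.
    rewrite primitiveE, RInt_zero in H by
      (lra || (intros s; rewrite Rmin_left, Rmax_left by lra; lra)). lra. }
  assert (P1 : forall t, primitive (ph u) t = 0).
  { intros t. assert (H := E1 t). unfold shift_f in H. rewrite Ec in H. lra. }
  assert (P2 : forall t, primitive (ga u) t = 0).
  { intros t. assert (H := E2 t). unfold shift_g in H. rewrite Ec in H. lra. }
  assert (Hph := ph_pieces u (proj1 Hu)). assert (Hga := ga_pieces u (proj1 Hu)).
  assert (Z : forall t, 0 <= t < T -> u t = 0).
  { apply cont_primitive_0; [apply Hu|]. intros t Ht.
    rewrite primitiveE by lra.
    transitivity (primitive (fun s => conv (ga u) N s + -1 * conv (ph u) M s) t).
    - rewrite primitiveE by lra. apply RInt_eq; [lra|]. intros s Hs.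
      rewrite (proj2 Hu s). unfold Kop, reduced_op, kernel_part. fold T ph ga.
      rewrite clamp_id by lra. ring.
    - rewrite primitive_lin by auto using conv_pieces.
      rewrite !primitive_conv by auto. rewrite !conv_zero_l by auto. ring. }
  assert (Z' : forall t, t < T -> u t = 0).
  { intros t Ht. destruct (Rlt_dec t 0); [apply (proj1 Hu); lra|apply Z; lra]. }
  assert (Hl : forall t, t < T -> u t = (fun _ => 0) t) by exact Z'.
  apply fixed_of_zero; [exact Hu| |]; intros t.
  - unfold ph. rewrite (inv_f_local tau0 tau1 a b n Htau0 u (fun _ => 0)) by exact Hl.
    apply inv_f_0.
  - unfold ga. rewrite (inv_g_local tau0 tau1 a n Htau0 u (fun _ => 0)) by exact Hl.
    apply inv_g_0.
Qed.

Lemma linear_combination (A : (R -> R) -> R -> R) u v x y t :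
  (forall u v c t, A (fun s => u s + c * v s) t = A u t + c * A v t) ->
  A (fun s => x * u s + y * v s) t = x * A u t + y * A v t.
Proof.
  intros HA. rewrite (HA (fun s => x * u s)).
  assert (H0 := additive_0 (fun u => A u t) (HA _ _ (-1) t)). cbv beta in H0.
  assert (H1 := HA (fun _ => 0) u x t). cbv beta in H1.
  replace (fun s : R => 0 + x * u s) with (fun s => x * u s) in H1
    by (apply functional_extensionality; intros; ring). lra.
Qed.

(** A nonzero solution would give an eigenvector of [shift].  Its eigenvalue is not 0 by
    [shift_injective], so [eigenvector_0] applies with the inverse eigenvalue. *)
Theorem kernel_trivial u : fixed T Kop u -> forall t, u t = 0.
Proof.
  intros Hu. apply NNPP. intros Hne.
  assert (HT : 0 < T) by (unfold T; lra).
  assert (Hnz : exists u, fixed T Kop u /\ exists t, u t <> 0).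
  { exists u. split; [exact Hu|]. now apply not_all_ex_not in Hne. }
  destruct (kernel_eigenvector T Kop HT Ksm shift shift_fixed shift_linear Hnz)
    as (mr & mi & p & q & Hp & Hq & (t0 & Ht0) & HS).
  assert (Lph : forall u v c t, ph (fun s => u s + c * v s) t = ph u t + c * ph v t)
    by (intros; apply inv_f_lin).
  assert (Lga : forall u v c t, ga (fun s => u s + c * v s) t = ga u t + c * ga v t)
    by (intros; apply inv_g_lin).
  assert (Sp : shift p = fun s => mr * p s + - mi * q s)
    by (apply functional_extensionality; intros s; rewrite (proj1 (HS s)); ring).
  assert (Sq : shift q = fun s => mr * q s + mi * p s)
    by (apply functional_extensionality; intros s; apply (HS s)).
  destruct (Req_dec (mr * mr + mi * mi) 0) as [Hd|Hd].
  - assert (Hmr : mr = 0) by nra. assert (Hmi : mi = 0) by nra.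
    assert (Hp0 : forall t, p t = 0).
    { apply shift_injective; [exact Hp| |]; intros t; rewrite Sp, linear_combination by auto;
        rewrite Hmr, Hmi; ring. }
    assert (Hq0 : forall t, q t = 0).
    { apply shift_injective; [exact Hq| |]; intros t; rewrite Sq, linear_combination by auto;
        rewrite Hmr, Hmi; ring. }
    destruct Ht0 as [H|H]; now apply H.
  - assert (Efp : forall t, shift_f (shift_c (ph p) (ga p)) (ph p) t = mr * ph p t - mi * ph q t)
      by (intros; rewrite <- ph_shift, Sp, linear_combination by auto; ring).
    assert (Efq : forall t, shift_f (shift_c (ph q) (ga q)) (ph q) t = mr * ph q t + mi * ph p t)
      by (intros; rewrite <- ph_shift, Sq, linear_combination by auto; ring).
    assert (Egp : forall t, shift_g (shift_c (ph p) (ga p)) (ga p) t = mr * ga p t - mi * ga q t)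
      by (intros; rewrite <- ga_shift, Sp, linear_combination by auto; ring).
    assert (Egq : forall t, shift_g (shift_c (ph q) (ga q)) (ga q) t = mr * ga q t + mi * ga p t)
      by (intros; rewrite <- ga_shift, Sq, linear_combination by auto; ring).
    assert (Z : forall t, ph p t = 0 /\ ph q t = 0 /\ ga p t = 0 /\ ga q t = 0).
    { intros t.
      (* The inverse of [mr + i mi]. *)
      destruct (eigenvector_0 (mr / (mr * mr + mi * mi)) (- mi / (mr * mr + mi * mi))
        (ph p) (ph q) (ga p) (ga q) (shift_c (ph p) (ga p)) (shift_c (ph q) (ga q)))
        with (t := t) as (H1 & H2 & H3 & H4);
        try (apply ph_pieces; apply Hp || apply Hq);
        try (apply ga_pieces; apply Hp || apply Hq);
        try (intros s; rewrite ?Efp, ?Efq, ?Egp, ?Egq; field; exact Hd);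
        try (intros s Hs; rewrite ?Efp, ?Efq; unfold ph; rewrite !inv_f_ge by exact Hs; ring);
        try (intros s Hs; rewrite ?Egp, ?Egq; unfold ga; rewrite !inv_g_ge by exact Hs; ring).
      rewrite Efp in H1. rewrite Efq in H2. rewrite Egp in H3. rewrite Egq in H4.
      assert (Hm : ~ (mr = 0 /\ mi = 0)) by (intros [E E']; apply Hd; rewrite E, E'; ring).
      destruct (complex_mult_0 mr mi (ph p t) (ph q t)); auto; [lra|].
      destruct (complex_mult_0 mr mi (ga p t) (ga q t)); auto; lra. }
    destruct Ht0 as [H|H]; apply H; [apply (fixed_of_zero p Hp)|apply (fixed_of_zero q Hq)];
      intros t; apply Z.
Qed.

End Shift.

(** * Back to the three equations *)

(** Replacing a piecewise C1 function by a sum of pieces supported in [0, sigma), at the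
    cost of finitely many exceptional points. *)
Definition represents (sigma : R) (u v : R -> R) : Prop :=
  pieces C1 v /\ (forall t, sigma <= t -> v t = 0) /\
  exists S, forall t, 0 <= t < sigma -> ~ In t S -> u t = v t.

Lemma piecewise_represents sigma u : piecewise_C1 0 sigma u ->
  exists v, represents sigma u v.
Proof.
  intros H. apply pw_of_piecewise in H.
  destruct (pieces_of_pw 0 sigma u (Rle_refl 0) H) as (v & S & Hv & _ & V1 & E).
  exists v. split; [exact Hv|]. split; [exact V1|]. now exists S.
Qed.

Lemma represents_piecewise sigma u v : 0 <= sigma -> represents sigma u v ->
  piecewise_C1 0 sigma u.
Proof.
  intros Hs (Hv & _ & S & E). apply piecewise_of_pw, (pw_agree S 0 sigma v).
  - now apply pw_of_pieces.
  - intros t Ht HS. apply E; auto. lra.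
Qed.

Definition zext (sigma : R) (u : R -> R) (t : R) : R :=
  if Rlt_dec t 0 then 0 else if Rlt_dec t sigma then u t else 0.

Lemma zext_in sigma u t : 0 <= t < sigma -> zext sigma u t = u t.
Proof. intros H. unfold zext. destruct (Rlt_dec t 0), (Rlt_dec t sigma); lra || easy. Qed.

Lemma zext_neg sigma u t : t < 0 -> zext sigma u t = 0.
Proof. intros H. unfold zext. destruct (Rlt_dec t 0); lra || easy. Qed.

Lemma zext_ge sigma u t : sigma <= t -> zext sigma u t = 0.
Proof. intros H. unfold zext. destruct (Rlt_dec t 0), (Rlt_dec t sigma); lra || easy. Qed.

Lemma represents_zext sigma u v : represents sigma u v ->
  exists S, forall t, ~ In t S -> zext sigma u t = v t.
Proof.
  intros (Hv & V1 & S & E). exists S. intros t HS.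
  destruct (Rlt_dec t 0) as [H|H].
  { rewrite zext_neg by exact H. symmetry. now apply (pieces_neg _ _ _ Hv). }
  destruct (Rle_dec sigma t) as [H'|H'].
  - rewrite zext_ge, V1 by exact H'. reflexivity.
  - rewrite zext_in by lra. apply E; [lra|exact HS].
Qed.

(** The integrals in the three equations run over the windows on which the zero
    extensions of both factors live. *)
Lemma conv_window sigma rho f M f0 M0 l r t :
  represents sigma f f0 -> represents rho M M0 ->
  0 <= l -> l <= r -> r <= t ->
  (forall s, l < s < r -> s < sigma /\ t - s < rho) ->
  (forall s, 0 < s < l -> rho <= t - s) ->
  (forall s, r < s < t -> sigma <= s) ->
  RInt (fun s => f s * M (t - s)) l r = conv f0 M0 t.
Proof.
  intros (Hf & Hf1 & S & Ef) (HM & HM1 & S' & EM) Hl Hlr Hrt Hin Hlo Hhi.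
  assert (Hi : integrable (fun s => f0 s * M0 (t - s)))
    by (apply conv_integrable; now apply pieces_C1_cont).
  unfold conv.
  rewrite <- (RInt_Chasles_R _ 0 l t Hi), <- (RInt_Chasles_R _ l r t Hi).
  rewrite (RInt_eq0 _ 0 l), (RInt_eq0 _ r t); try lra.
  - rewrite Rplus_0_l, Rplus_0_r.
    apply (RInt_agree (S ++ map (fun s => t - s) S')); auto.
    intros s Hs HS. destruct (Hin s Hs). rewrite Ef, EM; auto; try lra.
    + intros HI. apply HS, in_or_app. right.
      apply in_map_iff. exists (t - s). split; [ring|exact HI].
    + intros HI. apply HS, in_or_app. now left.
  - intros s Hs. rewrite Hf1 by (apply Hhi; lra). ring.
  - intros s Hs. rewrite HM1 by (apply Hlo; lra). ring.
Qed.

Lemma conv_agree S u v N t : pieces cont v -> pieces cont N -> 0 <= t ->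
  (forall s, ~ In s S -> u s = v s) -> conv u N t = conv v N t.
Proof.
  intros Hv HN Ht E. apply (RInt_agree S); auto using conv_integrable.
  intros s _ HS. now rewrite E.
Qed.

Section Equations.

Context (tau0 tau1 a b : R) (Htau0 : 0 < tau0) (Htau1 : tau0 <= tau1).
Context (N M N0 M0 : R -> R) (HN : represents tau0 N N0) (HM : represents tau1 M M0).

Lemma equations_reduced f g f0 g0 : represents tau0 f f0 -> represents tau1 g g0 ->
  ((forall nu, 0 <= nu < tau0 -> I1 N M f g nu = 0) /\
   (forall nu, tau0 <= nu < tau1 -> I2 tau0 a N M f g nu = 0) /\
   (forall nu, tau1 <= nu <= tau1 + tau0 -> I3 tau0 tau1 a b N M f g nu = 0)) <->
  ((forall nu, 0 <= nu < tau0 + tau1 ->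
      delay_part tau0 tau1 a b (zext tau0 f) (zext tau1 g) nu
      = kernel_part N0 M0 f0 g0 nu - zext tau0 N nu) /\
   b * f tau0 = a * g tau1).
Proof.
  intros Hf Hg.
  assert (E1 : forall nu, 0 <= nu < tau0 -> I1 N M f g nu =
    delay_part tau0 tau1 a b (zext tau0 f) (zext tau1 g) nu
      - (kernel_part N0 M0 f0 g0 nu - zext tau0 N nu)).
  { intros nu Hnu. unfold I1, kernel_part, delay_part.
    rewrite (conv_window tau0 tau1 f M f0 M0 0 nu nu),
      (conv_window tau1 tau0 g N g0 N0 0 nu nu) by (auto; lra || (intros; lra)).
    rewrite (zext_neg _ g (nu - tau0)), (zext_neg _ f (nu - tau1)) by lra.
    rewrite !zext_in by lra. ring. }
  assert (E2 : forall nu, tau0 <= nu < tau1 -> I2 tau0 a N M f g nu =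
    delay_part tau0 tau1 a b (zext tau0 f) (zext tau1 g) nu
      - (kernel_part N0 M0 f0 g0 nu - zext tau0 N nu)).
  { intros nu Hnu. unfold I2, kernel_part, delay_part.
    rewrite (conv_window tau0 tau1 f M f0 M0 0 tau0 nu),
      (conv_window tau1 tau0 g N g0 N0 (nu - tau0) nu nu) by (auto; lra || (intros; lra)).
    rewrite (zext_neg _ f (nu - tau1)), (zext_ge _ N nu) by lra.
    rewrite !zext_in by lra. ring. }
  assert (E3 : forall nu, tau1 <= nu < tau1 + tau0 -> I3 tau0 tau1 a b N M f g nu =
    delay_part tau0 tau1 a b (zext tau0 f) (zext tau1 g) nu
      - (kernel_part N0 M0 f0 g0 nu - zext tau0 N nu)).
  { intros nu Hnu. unfold I3, kernel_part, delay_part.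
    rewrite (conv_window tau0 tau1 f M f0 M0 (nu - tau1) tau0 nu),
      (conv_window tau1 tau0 g N g0 N0 (nu - tau0) tau1 nu) by (auto; lra || (intros; lra)).
    rewrite (zext_ge _ g nu), (zext_ge _ N nu) by lra.
    rewrite !zext_in by lra. ring. }
  assert (ET : I3 tau0 tau1 a b N M f g (tau1 + tau0) = b * f tau0 - a * g tau1).
  { unfold I3. rewrite !RInt_zero.
    - replace (tau1 + tau0 - tau1) with tau0 by ring.
      replace (tau1 + tau0 - tau0) with tau1 by ring. ring.
    - intros s. rewrite Rmin_left, Rmax_left by lra. lra.
    - intros s. rewrite Rmin_left, Rmax_left by lra. lra. }
  split.
  - intros (H1 & H2 & H3). split.
    + intros nu Hnu. apply Rminus_diag_uniq.
      destruct (Rlt_dec nu tau0); [rewrite <- E1 by lra; apply H1; lra|].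
      destruct (Rlt_dec nu tau1); [rewrite <- E2 by lra; apply H2; lra|].
      rewrite <- E3 by lra. apply H3. lra.
    + rewrite H3 in ET by lra. lra.
  - intros [H Hend]. split; [|split]; intros nu Hnu.
    + rewrite E1, H by lra. ring.
    + rewrite E2, H by lra. ring.
    + destruct (Rlt_dec nu (tau1 + tau0)).
      * rewrite E3, H by lra. ring.
      * replace nu with (tau1 + tau0) by lra. rewrite ET. lra.
Qed.

Lemma Cexp_opp_mult t lr li : Cexp (- (RtoC t * (lr, li))) = (er lr li t, ei lr li t).
Proof.
  unfold Cexp, er, ei, Re, Im, RtoC, Copp, Cmult; simpl.
  replace (- (t * lr - 0 * li)) with (- (lr * t)) by ring.
  replace (- (t * li + 0 * lr)) with (- (li * t)) by ring.
  rewrite cos_neg, sin_neg. f_equal. ring.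
Qed.

Lemma CInt_exp sigma u v lr li : 0 <= sigma -> represents sigma u v ->
  CInt (fun nu => RtoC (u nu) * Cexp (- (RtoC nu * (lr, li))))%C 0 sigma
  = (RInt (fun s => er lr li s * v s) 0 sigma, RInt (fun s => ei lr li s * v s) 0 sigma).
Proof.
  intros Hs (Hv & _ & S & E). unfold CInt.
  apply (is_RInt_unique (V := C_R_CompleteNormedModule)).
  assert (Hv' := pieces_C1_cont _ Hv).
  apply (is_RInt_fct_extend_pair (U := R_NormedModule) (V := R_NormedModule)); cbn [fst snd].
  - apply (is_RInt_agree S); [exact Hs| |].
    + intros t Ht HS. rewrite Cexp_opp_mult, E by (auto; lra). unfold RtoC, Cmult; simpl. ring.
    + apply multiplier_of_pieces; [exact Hv'|apply er_cont].
  - apply (is_RInt_agree S); [exact Hs| |].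
    + intros t Ht HS. rewrite Cexp_opp_mult, E by (auto; lra). unfold RtoC, Cmult; simpl. ring.
    + apply multiplier_of_pieces; [exact Hv'|apply ei_cont].
Qed.

Lemma F0_char lr li :
  F0 tau0 a N (lr, li) = (char0_re tau0 a N0 lr li, char0_im tau0 a N0 lr li).
Proof.
  unfold F0. rewrite (CInt_exp _ _ N0), Cexp_opp_mult by (auto; lra).
  unfold char0_re, char0_im, RtoC, Cminus, Copp, Cplus, Cmult; simpl. f_equal; ring.
Qed.

Lemma F1_char lr li :
  F1 tau1 b M (lr, li) = (char1_re tau1 b M0 lr li, char1_im tau1 b M0 lr li).
Proof.
  unfold F1. rewrite (CInt_exp _ _ M0), Cexp_opp_mult by (auto; lra).
  unfold char1_re, char1_im, RtoC, Cplus, Cmult; simpl. f_equal; ring.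
Qed.

Context (Hrank : forall s : C, ~ (F0 tau0 a N s = RtoC 0 /\ F1 tau1 b M s = RtoC 0)).

Lemma char_rank lr li :
  ~ (char0_re tau0 a N0 lr li = 0 /\ char0_im tau0 a N0 lr li = 0 /\
     char1_re tau1 b M0 lr li = 0 /\ char1_im tau1 b M0 lr li = 0).
Proof.
  intros (H1 & H2 & H3 & H4). apply (Hrank (lr, li)).
  rewrite F0_char, F1_char, H1, H2, H3, H4. now split.
Qed.

Lemma er_zero t : er 0 0 t = 1.
Proof. unfold er. rewrite !Rmult_0_l, Ropp_0, exp_0, cos_0. ring. Qed.

Lemma ei_zero t : ei 0 0 t = 0.
Proof. unfold ei. rewrite !Rmult_0_l, sin_0. ring. Qed.

(** The rank condition at [s = 0]. *)
Lemma char_at_0 :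
  char0 tau0 a N0 * char0 tau0 a N0 + char1 tau1 b M0 * char1 tau1 b M0 <> 0.
Proof.
  intros H. apply (char_rank 0 0).
  assert (H0 : char0 tau0 a N0 = 0) by nra. assert (H1 : char1 tau1 b M0 = 0) by nra.
  unfold char0 in H0. unfold char1 in H1. rewrite primitiveE in H0, H1 by lra.
  unfold char0_re, char0_im, char1_re, char1_im. rewrite !er_zero, !ei_zero.
  rewrite (RInt_ext_R (fun s => er 0 0 s * N0 s) N0) by (intros; rewrite er_zero; ring).
  rewrite (RInt_ext_R (fun s => er 0 0 s * M0 s) M0) by (intros; rewrite er_zero; ring).
  rewrite (RInt_zero (fun s => ei 0 0 s * N0 s)) by (intros; rewrite ei_zero; ring).
  rewrite (RInt_zero (fun s => ei 0 0 s * M0 s)) by (intros; rewrite ei_zero; ring).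
  repeat split; lra.
Qed.

Context (Ha : -1 < a < 1) (Hb : b <> 0).
Context (n : nat) (Hn : tau1 <= INR n * tau0).

Let T := tau0 + tau1.
Let ph := inv_f tau0 tau1 a b n.
Let ga := inv_g tau0 tau1 a n.
Let kp := kernel_part N0 M0.
Let Kop := reduced_op tau0 tau1 a b n N0 M0.
Let HN0 : pieces C1 N0 := proj1 HN.
Let HM0 : pieces C1 M0 := proj1 HM.
Let HT : 0 < T.
Proof. unfold T. lra. Qed.
Let Ksm : smoothing T Kop := reduced_op_smoothing tau0 tau1 a b n Htau0 Htau1 Ha Hb N0 M0 HN0 HM0.

Lemma Kop_trivial u : anchored T u -> (forall t, u t = Kop u t) -> forall t, u t = 0.
Proof.
  intros Hu Hfix.
  apply (kernel_trivial tau0 tau1 a b Htau0 Htau1 Hb N0 M0 HN0 HM0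
           (proj1 (proj2 HN)) (proj1 (proj2 HM)) n Hn Ha char_at_0 char_rank).
  now split.
Qed.

(** A change of the data at finitely many points changes the solution at finitely many
    points only. *)
Lemma inv_g_agree S d : (forall t, ~ In t S -> d t = 0) ->
  exists S', forall t, ~ In t S' -> ga d t = 0.
Proof.
  intros Hd.
  exists (flat_map (fun k => map (fun s => s + INR k * tau0) S) (seq 0 n)).
  intros t Ht. unfold ga, inv_g, trunc. rewrite rsum_0; [ring|].
  intros k Hk. rewrite Hd; [ring|]. intros HI. apply Ht.
  apply in_flat_map. exists k. split; [apply in_seq; lia|].
  apply in_map_iff. exists (t - INR k * tau0). split; [ring|exact HI].
Qed.

Lemma inv_f_agree S d : (forall t, ~ In t S -> d t = 0) ->
  exists S', forall t, ~ In t S' -> ph d t = 0.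
Proof.
  intros Hd. destruct (inv_g_agree S d Hd) as [S' HS'].
  exists (map (fun s => s - tau1) S ++ map (fun s => s + (tau0 - tau1)) S').
  intros t Ht. unfold ph, inv_f, trunc. fold ga. rewrite Hd, HS'; [ring| |].
  - intros HI. apply Ht, in_or_app. right. apply in_map_iff.
    exists (t - (tau0 - tau1)). split; [ring|exact HI].
  - intros HI. apply Ht, in_or_app. left. apply in_map_iff.
    exists (t - - tau1). split; [ring|exact HI].
Qed.

Lemma ph_sub u v t : ph (fun s => u s + -1 * v s) t = ph u t + -1 * ph v t.
Proof. apply inv_f_lin. Qed.

Lemma ga_sub u v t : ga (fun s => u s + -1 * v s) t = ga u t + -1 * ga v t.
Proof. apply inv_g_lin. Qed.

(** The pointwise values of [N] must be respected in the equation, while under integrals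
    [N0] may replace it.  So the solution is built from [w - N], and its
    representative from [w - N0]. *)
Lemma existence : exists f g f0 g0,
  represents tau0 f f0 /\ represents tau1 g g0 /\
  (forall nu, 0 <= nu < tau0 + tau1 ->
      delay_part tau0 tau1 a b (zext tau0 f) (zext tau1 g) nu
      = kernel_part N0 M0 f0 g0 nu - zext tau0 N nu) /\
  b * f tau0 = a * g tau1.
Proof.
  assert (Sc := stable_cont). assert (HN0c := pieces_C1_cont _ HN0).
  assert (HphN : pieces cont (ph N0)) by now apply inv_f_pieces.
  assert (HgaN : pieces cont (ga N0)) by now apply inv_g_pieces.
  destruct (pieces_bounded_support (ph N0) tau0 HphN) as (B & B0 & HB);
    [intros; now apply inv_f_ge|].
  destruct (pieces_bounded_support (ga N0) tau1 HgaN) as (B' & B0' & HB');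
    [intros; now apply inv_g_ge|].
  assert (HKN : anchored T (Kop N0)).
  { apply (kernel_part_anchored tau0 tau1) with (B := B + B'); auto.
    - intros t. apply Rle_trans with B; [apply HB|lra].
    - intros t. apply Rle_trans with B'; [apply HB'|lra]. }
  assert (Hr : anchored T (fun t => 0 + -1 * Kop N0 t))
    by (apply (anchored_lin T (fun _ => 0)); auto using anchored_0).
  destruct (fredholm_solvable T Kop HT Ksm Kop_trivial _ Hr) as (w & Hw & Ew).
  assert (Hwc : pieces cont w) by now apply (anchored_pieces T).
  assert (Hphw : pieces cont (ph w)) by now apply inv_f_pieces.
  assert (Hgaw : pieces cont (ga w)) by now apply inv_g_pieces.
  set (u0 := fun s => w s + -1 * N0 s).
  assert (Hu0 : pieces cont u0) by now apply pieces_lin.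
  set (f0 := ph u0). set (g0 := ga u0).
  assert (Hf0c : pieces cont f0) by now apply inv_f_pieces.
  assert (Hg0c : pieces cont g0) by now apply inv_g_pieces.
  assert (Ew' : forall t, 0 <= t < T -> w t = kp f0 g0 t).
  { intros t Ht. rewrite Ew. unfold Kop, reduced_op. fold T. rewrite clamp_id by lra. fold ph ga.
    replace f0 with (fun s => ph w s + -1 * ph N0 s)
      by (apply functional_extensionality; intros; symmetry; apply ph_sub).
    replace g0 with (fun s => ga w s + -1 * ga N0 s)
      by (apply functional_extensionality; intros; symmetry; apply ga_sub).
    unfold kp. rewrite kernel_part_lin by auto. ring. }
  (* Bootstrap: [w] is a combination of convolutions, hence piecewise C1. *)
  set (u1 := fun s => (conv g0 N0 s + -1 * conv f0 M0 s) + -1 * N0 s).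
  assert (Hu1 : pieces C1 u1)
    by (repeat apply pieces_lin; auto using stable_C1, conv_C1).
  assert (Eu : forall s, s < T -> u0 s = u1 s).
  { intros s Hs. unfold u0, u1. destruct (Rlt_dec s 0).
    - rewrite (proj1 Hw), !conv_nonpos by (auto; lra). ring.
    - rewrite Ew' by lra. unfold kp, kernel_part. ring. }
  assert (Hf0 : pieces C1 f0).
  { apply (pieces_ext C1 (ph u1)).
    - intros t. symmetry. now apply inv_f_local.
    - apply inv_f_pieces; auto using stable_C1. }
  assert (Hg0 : pieces C1 g0).
  { apply (pieces_ext C1 (ga u1)).
    - intros t. symmetry. now apply (inv_g_local tau0 tau1).
    - apply inv_g_pieces; auto using stable_C1. }
  destruct (represents_zext _ _ _ HN) as [S HS].
  set (u := fun s => w s + -1 * zext tau0 N s).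
  assert (Hd : forall t, ~ In t S -> u t + -1 * u0 t = 0)
    by (intros t Ht; unfold u, u0; rewrite HS by exact Ht; ring).
  destruct (inv_f_agree S _ Hd) as [S1 H1]. destruct (inv_g_agree S _ Hd) as [S2 H2].
  assert (Hun : forall s, s < 0 -> u s = 0).
  { intros s Hs. unfold u. rewrite (proj1 Hw), zext_neg by lra. ring. }
  exists (ph u), (ga u), f0, g0.
  split; [|split; [|split]].
  - split; [exact Hf0|]. split; [intros; now apply inv_f_ge|].
    exists S1. intros t _ Ht. specialize (H1 t Ht). rewrite ph_sub in H1. unfold f0. lra.
  - split; [exact Hg0|]. split; [intros; now apply inv_g_ge|].
    exists S2. intros t _ Ht. specialize (H2 t Ht). rewrite ga_sub in H2. unfold g0. lra.
  - intros nu Hnu.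
    replace (zext tau0 (ph u)) with (ph u).
    2:{ apply functional_extensionality. intros t. unfold zext.
        destruct (Rlt_dec t 0); [now apply inv_f_neg|].
        destruct (Rlt_dec t tau0); [reflexivity|apply inv_f_ge; lra]. }
    replace (zext tau1 (ga u)) with (ga u).
    2:{ apply functional_extensionality. intros t. unfold zext.
        destruct (Rlt_dec t 0); [now apply (inv_g_neg tau0 tau1)|].
        destruct (Rlt_dec t tau1); [reflexivity|apply inv_g_ge; lra]. }
    unfold ph, ga. rewrite delay_part_inv by (auto; lra).
    unfold u. rewrite Ew' by (unfold T; lra). unfold kp. ring.
  - unfold ph, ga. rewrite inv_f_ge, inv_g_ge by lra. ring.
Qed.

(** The difference of two solutions satisfies the homogeneous equation; its
    [delay_part] is a difference of convolutions, hence [anchored] and fixed by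
    [reduced_op]. *)
Lemma uniqueness f g f0 g0 f' g' f0' g0' :
  represents tau0 f f0 -> represents tau1 g g0 ->
  represents tau0 f' f0' -> represents tau1 g' g0' ->
  (forall nu, 0 <= nu < tau0 + tau1 ->
      delay_part tau0 tau1 a b (zext tau0 f) (zext tau1 g) nu
      = kernel_part N0 M0 f0 g0 nu - zext tau0 N nu) ->
  (forall nu, 0 <= nu < tau0 + tau1 ->
      delay_part tau0 tau1 a b (zext tau0 f') (zext tau1 g') nu
      = kernel_part N0 M0 f0' g0' nu - zext tau0 N nu) ->
  same_solution tau0 tau1 f g f' g'.
Proof.
  intros Hf Hg Hf' Hg' HE HE'.
  assert (Sc := stable_cont).
  set (df := fun s => zext tau0 f' s + -1 * zext tau0 f s).
  set (dg := fun s => zext tau1 g' s + -1 * zext tau1 g s).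
  set (df0 := fun s => f0' s + -1 * f0 s).
  set (dg0 := fun s => g0' s + -1 * g0 s).
  destruct (represents_zext _ _ _ Hf) as [S1 HS1].
  destruct (represents_zext _ _ _ Hf') as [S1' HS1'].
  destruct (represents_zext _ _ _ Hg) as [S2 HS2].
  destruct (represents_zext _ _ _ Hg') as [S2' HS2'].
  destruct Hf as (Pf & Zf & _), Hg as (Pg & Zg & _),
    Hf' as (Pf' & Zf' & _), Hg' as (Pg' & Zg' & _).
  apply pieces_C1_cont in Pf, Pg, Pf', Pg'.
  assert (Pdf : pieces cont df0) by now apply pieces_lin.
  assert (Pdg : pieces cont dg0) by now apply pieces_lin.
  assert (Edf : forall s, ~ In s (S1 ++ S1') -> df s = df0 s).
  { intros s Hs. unfold df, df0. rewrite HS1, HS1'; [reflexivity| |];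
      intros HI; apply Hs, in_or_app; auto. }
  assert (Edg : forall s, ~ In s (S2 ++ S2') -> dg s = dg0 s).
  { intros s Hs. unfold dg, dg0. rewrite HS2, HS2'; [reflexivity| |];
      intros HI; apply Hs, in_or_app; auto. }
  destruct (pieces_bounded_support df0 tau0 Pdf) as (B & B0 & HB).
  { intros t Ht. unfold df0. rewrite Zf, Zf' by exact Ht. ring. }
  destruct (pieces_bounded_support dg0 tau1 Pdg) as (B' & B0' & HB').
  { intros t Ht. unfold dg0. rewrite Zg, Zg' by exact Ht. ring. }
  set (u := fun t => kp df0 dg0 (clamp T t)).
  assert (Hu : anchored T u).
  { apply (kernel_part_anchored tau0 tau1) with (B := B + B'); auto.
    - intros t. apply Rle_trans with B; [apply HB|lra].
    - intros t. apply Rle_trans with B'; [apply HB'|lra]. }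
  assert (HEu : forall t, 0 <= t < T -> delay_part tau0 tau1 a b df dg t = u t).
  { intros t Ht. unfold u. rewrite clamp_id by lra.
    unfold kp, df0, dg0. rewrite kernel_part_lin by auto.
    specialize (HE t Ht). specialize (HE' t Ht).
    unfold delay_part in *. unfold df, dg. lra. }
  assert (Hphu : forall t, ph u t = df t).
  { apply (inv_f_unique tau0 tau1 a b n Htau0 Htau1 Hb Hn u df dg); auto.
    - intros s Hs. apply Hu. lra.
    - intros s Hs. unfold df. rewrite !zext_neg by lra. ring.
    - intros s Hs. unfold df. rewrite !zext_ge by lra. ring.
    - intros s Hs. unfold dg. rewrite !zext_neg by lra. ring.
    - intros s Hs. unfold dg. rewrite !zext_ge by lra. ring. }
  assert (Hgau : forall t, ga u t = dg t).
  { apply (inv_g_unique tau0 tau1 a b n Htau0 Hn u df dg); auto.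
    - intros s Hs. apply Hu. lra.
    - intros s Hs. unfold df. rewrite !zext_neg by lra. ring.
    - intros s Hs. unfold dg. rewrite !zext_neg by lra. ring.
    - intros s Hs. unfold dg. rewrite !zext_ge by lra. ring. }
  assert (Hu0 : forall t, u t = 0).
  { apply Kop_trivial; [exact Hu|]. intros t. unfold Kop, reduced_op, u at 1, kp, kernel_part.
    fold ph ga T.
    assert (Hc : 0 <= clamp T t) by (apply clamp_range; lra).
    rewrite (conv_agree (S1 ++ S1') (ph u) df0), (conv_agree (S2 ++ S2') (ga u) dg0);
      auto using pieces_C1_cont.
    - intros s Hs. rewrite Hgau. auto.
    - intros s Hs. rewrite Hphu. auto. }
  assert (Hz : u = fun _ => 0) by (now apply functional_extensionality).
  split; intros nu Hnu.
  - assert (H := Hphu nu). unfold df in H. rewrite !zext_in in H by lra.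
    rewrite Hz in H. unfold ph in H. rewrite inv_f_0 in H. lra.
  - assert (H := Hgau nu). unfold dg in H. rewrite !zext_in in H by lra.
    rewrite Hz in H. unfold ga in H. rewrite inv_g_0 in H. lra.
Qed.

End Equations.

Theorem lemma3 (tau0 tau1 a b : R) (N M : R -> R)
  (htau0 : 0 < tau0) (htau1 : tau0 <= tau1)
  (ha : -1 < a < 1)
  (hN : piecewise_C1 0 tau0 N) (hM : piecewise_C1 0 tau1 M)
  (hb : b <> 0)
  (hrank : forall s : C,
     ~ (F0 tau0 a N s = RtoC 0 /\ F1 tau1 b M s = RtoC 0)) :
  exists f g : R -> R,
    is_solution tau0 tau1 a b N M f g /\
    forall f' g' : R -> R,
      is_solution tau0 tau1 a b N M f' g' ->
      same_solution tau0 tau1 f g f' g'.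
Proof.
  destruct (piecewise_represents tau0 N hN) as [N0 HN].
  destruct (piecewise_represents tau1 M hM) as [M0 HM].
  destruct (nfloor_ex (tau1 / tau0)) as [m [_ Hm]].
  { apply Rlt_le, Rdiv_lt_0_compat; lra. }
  assert (Hn : tau1 <= INR (S m) * tau0).
  { rewrite S_INR. apply Rlt_le.
    apply Rmult_lt_reg_r with (/ tau0); [now apply Rinv_0_lt_compat|].
    replace ((INR m + 1) * tau0 * / tau0) with (INR m + 1) by (field; lra). exact Hm. }
  destruct (existence tau0 tau1 a b htau0 htau1 N M N0 M0 HN HM hrank ha hb (S m) Hn)
    as (f & g & f0 & g0 & Hf & Hg & HE & Hend).
  exists f, g. split.
  - split; [apply (represents_piecewise tau0 f f0); auto; lra|].
    split; [apply (represents_piecewise tau1 g g0); auto; lra|].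
    now apply (equations_reduced tau0 tau1 a b htau0 htau1 N M N0 M0 HN HM f g f0 g0).
  - intros f' g' (Hf' & Hg' & H).
    destruct (piecewise_represents tau0 f' Hf') as [f0' Rf'].
    destruct (piecewise_represents tau1 g' Hg') as [g0' Rg'].
    destruct (proj1 (equations_reduced tau0 tau1 a b htau0 htau1 N M N0 M0 HN HM
      f' g' f0' g0' Rf' Rg') H) as [HE' _].
    now apply (uniqueness tau0 tau1 a b htau0 htau1 N M N0 M0 HN HM hrank ha hb (S m) Hn
             f g f0 g0 f' g' f0' g0').
Qed.
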